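(* Let $L>0$, $\rho>0$, $\mu>0$. Suppose $\Phi$ satisfies the assumptions on $\Phi$ listed in the context, and let $u_0\in H^2(0,L)$, $u_1\in L^2(0,L)$. Then the initial boundary value problem $$\begin{cases} \rho\,\partial_{tt}^2 u=-\mu\,\partial_{xxxx}^4 u-\Phi'(u), & t>0,\ 0<x<L,\\ \partial_{xx}^2 u(t,0)=\partial_{xx}^2 u(t,L)=0, & t>0,\\ \partial_{xxx}^3 u(t,0)=\partial_{xxx}^3 u(t,L)=0, & t>0,\\ u(0,x)=u_0(x), & 0<x<L,\\ \partial_t u(0,x)=u_1(x), & 0<x<L, \end{cases}$$ admits a dissipative solution (in the sense defined in the context).
   Context: Assumptions on $\Phi$: $\Phi\in C(\mathbb{R})\cap C^2(\mathbb{R}\setminus\{1,-1\})$, $\Phi\ge 0$, $\Phi$ is constant in $(-\infty,-1]$ and in $[1,\infty)$, convex in $[-1,1]$, decreasing in $[-1,0]$, increasing in $[0,1]$, and $\Phi(u)\ge\kappa u^2$ in $[-1,1]$ for some constant $\kappa>0$. Moreover $\Phi'$ has jump discontinuities at $u=\pm1$, with finite one-sided limits $\Phi'(1^-)=\lim_{u\to1^-}\Phi'(u)$ and $\Phi'(-1^+)=\lim_{u\to-1^+}\Phi'(u)$; one has $\Phi'(u)=0$ for $|u|>1$, $0<\Phi'(u)\le\Phi'(1^-)$ for $0<u<1$, and $\Phi'(-1^+)\le\Phi'(u)<0$ for $-1<u<0$. Notation $h_u\in\partial\Phi'(u)$: for $u:[0,\infty)\times[0,L]\to\mathbb{R}$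 this means that $h_u:[0,\infty)\times[0,L]\to\mathbb{R}$ is a (measurable) function with $h_u(t,x)=\Phi'(u(t,x))$ if $|u(t,x)|<1$; $h_u(t,x)=0$ if $|u(t,x)|>1$; $h_u(t,x)\in[0,\Phi'(1^-)]$ if $u(t,x)=1$; $h_u(t,x)\in[\Phi'(-1^+),0]$ if $u(t,x)=-1$. Energy: $E[u](t)=\int_0^L\left(\frac{\rho(\partial_t u(t,x))^2+\mu(\partial_{xx}^2u(t,x))^2}{2}+\Phi(u(t,x))\right)dx$, and $E[u](0)=\int_0^L\left(\frac{\rho u_1(x)^2+\mu(\partial_{xx}^2u_0(x))^2}{2}+\Phi(u_0(x))\right)dx$. Dissipative solution: a function $u:[0,\infty)\times[0,L]\to\mathbb{R}$ such that (i) $u\in C([0,\infty)\times[0,L])$; (ii) $\partial_t u,\ \partial_{xx}^2u\in L^\infty(0,\infty;L^2(0,L))$; (iii) $u$ is a weak solution: for some $h_u\in\partial\Phi'(u)$ and every test function $\varphi\in C^\infty(\mathbb{R}^2)$ with compact support, $$\int_0^\infty\!\!\int_0^L\left(\rho u\,\partial_{tt}^2\varphi+\mu\,\partial_{xx}^2u\,\partial_{xx}^2\varphi+h_u\varphi\right)dx\,dt-\int_0^L\rho u_1(x)\varphi(0,x)\,dx+\int_0^L\rho u_0(x)\,\partial_t\varphi(0,x)\,dx=0;$$ (iv) $E[u](t)\le E[u](0)$ for almost every $t>0$. *)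

(* Defs.v *)
From HB Require Import structures.
From mathcomp Require Import all_boot all_order all_algebra.
From mathcomp Require Import all_classical all_reals all_analysis.
Set Implicit Arguments.
Unset Strict Implicit.
Unset Printing Implicit Defensive.
Import Order.TTheory GRing.Theory Num.Theory.
Import numFieldNormedType.Exports.
Local Open Scope classical_set_scope.
Local Open Scope ring_scope.

Section potential.
Variable R : realType.
Implicit Types Phi : R -> R.

Definition left_slope_at1 Phi : R := lim (derive1 Phi x @[x --> (1 : R)^'-]).
Definition right_slope_atN1 Phi : R := lim (derive1 Phi x @[x --> (-1 : R)^'+]).

(* [derive1 Phi] takes unspecified values at 1 and -1; they are never used, since
   one-sided limits are taken over punctured neighbourhoods. *)
Record potential Phi : Prop := Potential {
  Phi_continuous : continuous Phi ;
  Phi_C2 : forall x : R, x <> 1 -> x <> -1 ->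
    [/\ derivable Phi x 1, derivable (derive1 Phi : R -> R) x 1
      & {for x, continuous (derive1n 2 Phi)}] ;
  Phi_ge0 : forall x, 0 <= Phi x ;
  Phi_cst_left : forall x, x <= -1 -> Phi x = Phi (-1) ;
  Phi_cst_right : forall x, 1 <= x -> Phi x = Phi 1 ;
  Phi_convex : convex_function (`[-1, 1]%classic : set (convex_lmodType R^o)) Phi ;
  Phi_decreasing : {in `[-1, 0] &, {homo Phi : x y /~ x <= y}} ;
  Phi_increasing : {in `[0, 1] &, {homo Phi : x y / x <= y}} ;
  Phi_coercive : exists2 kappa : R, 0 < kappa &
    forall x, -1 <= x <= 1 -> kappa * x ^+ 2 <= Phi x ;
  dPhi_cvg_left1 : cvg (derive1 Phi x @[x --> (1 : R)^'-]) ;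
  dPhi_cvg_right1 : cvg (derive1 Phi x @[x --> (1 : R)^'+]) ;
  dPhi_jump1 : lim (derive1 Phi x @[x --> (1 : R)^'-])
            <> lim (derive1 Phi x @[x --> (1 : R)^'+]) ;
  dPhi_cvg_leftN1 : cvg (derive1 Phi x @[x --> (-1 : R)^'-]) ;
  dPhi_cvg_rightN1 : cvg (derive1 Phi x @[x --> (-1 : R)^'+]) ;
  dPhi_jumpN1 : lim (derive1 Phi x @[x --> (-1 : R)^'-])
             <> lim (derive1 Phi x @[x --> (-1 : R)^'+]) ;
  dPhi_out : forall x, 1 < `|x| -> derive1 Phi x = 0 ;
  dPhi_pos : forall x, 0 < x < 1 -> 0 < derive1 Phi x <= left_slope_at1 Phi ;
  dPhi_neg : forall x, -1 < x < 0 -> right_slope_atN1 Phi <= derive1 Phi x < 0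
}.

End potential.

Section function_spaces.
Variable R : realType.
Local Notation leb := (@lebesgue_measure R).
Implicit Types (f g : R -> R) (u v w h phi : R * R -> R) (L : R).

(* Points of R * R are pairs (t, x) = (time, space). *)
Definition d_t u : R * R -> R := fun z => derive1 (fun s => u (s, z.2)) z.1.
Definition d_x u : R * R -> R := fun z => derive1 (fun y => u (z.1, y)) z.2.

Fixpoint Ck (k : nat) u : Prop :=
  continuous u /\
  if k is k'.+1 then
    [/\ forall t x, derivable (fun s => u (s, x)) t 1,
        forall t x, derivable (fun y => u (t, y)) x 1,
        Ck k' (d_t u) & Ck k' (d_x u)]
  else True.

Definition test_function1 (D : set R) f :=
  (forall n x, derivable (derive1n n f) x 1) /\
  exists K : set R, [/\ compact K, K `<=` D & forall x, ~ K x -> f x = 0].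

Definition test_function2 (D : set (R * R)) phi :=
  (forall k, Ck k phi) /\
  exists K : set (R * R), [/\ compact K, K `<=` D & forall z, ~ K z -> phi z = 0].

Definition domain L : set (R * R) := `]0, +oo[ `*` `]0, L[.
Definition closed_domain L : set (R * R) := `[0, +oo[ `*` `[0, L].

Definition L2 L f := f \_ `]0, L[ \in Lfun leb 2%:E.

(* [g] is the distributional derivative of order [n] of [f] on (0, L). *)
Definition weak_derivative L (n : nat) f g :=
  forall phi : R -> R, test_function1 `]0, L[ phi ->
  \int[leb]_(x in `]0, L[) (f x * derive1n n phi x) =
  (-1) ^+ n * \int[leb]_(x in `]0, L[) (g x * phi x).

Definition H2 L f := L2 L f /\
  exists f1 f2, [/\ L2 L f1, weak_derivative L 1 f f1,
                    L2 L f2 & weak_derivative L 2 f f2].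

(* L^oo(0, oo; L^2(0, L)); by separability of L^2(0, L), its elements are the
   jointly measurable functions of (t, x) whose sections have an essentially
   bounded L^2 norm. *)
Definition Linfty_L2 L v :=
  measurable_fun (domain L) v /\
  ('N[leb]_+oo[(fun t : R =>
      'N[leb]_2%:E[EFin \o (fun x : R => v (t, x)) \_ `]0%R, L[])
        \_ `]0%R, +oo[] < +oo)%E.

Definition weak_d_t L u v :=
  forall phi, test_function2 (domain L) phi ->
  \int[leb]_(t in `]0, +oo[) \int[leb]_(x in `]0, L[) (u (t, x) * d_t phi (t, x)) =
  - \int[leb]_(t in `]0, +oo[) \int[leb]_(x in `]0, L[) (v (t, x) * phi (t, x)).

Definition weak_d_xx L u w :=
  forall phi, test_function2 (domain L) phi ->
  \int[leb]_(t in `]0, +oo[) \int[leb]_(x in `]0, L[)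
    (u (t, x) * d_x (d_x phi) (t, x)) =
  \int[leb]_(t in `]0, +oo[) \int[leb]_(x in `]0, L[) (w (t, x) * phi (t, x)).

End function_spaces.

Section dissipative_solutions.
Variable R : realType.
Local Notation leb := (@lebesgue_measure R).
Variables (L rho mu : R) (Phi : R -> R).
Implicit Types (f g : R -> R) (u v w h phi : R * R -> R).

Definition in_subdifferential u h :=
  measurable_fun (closed_domain L) h /\
  forall z, closed_domain L z ->
  [/\ `|u z| < 1 -> h z = derive1 Phi (u z),
      1 < `|u z| -> h z = 0,
      u z = 1 -> 0 <= h z <= left_slope_at1 Phi
    & u z = -1 -> right_slope_atN1 Phi <= h z <= 0].

(* Energy of a state with velocity [v], displacement [f] and second space
   derivative [w]. *)
Definition energy (v w f : R -> R) : \bar R :=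
  (\int[leb]_(x in `]0%R, L[)
     ((rho * v x ^+ 2 + mu * w x ^+ 2) / 2 + Phi (f x))%:E)%E.

(* Test functions are not required to vanish at t = 0, x = 0 or x = L: the
   initial conditions and the natural boundary conditions u_xx = u_xxx = 0 are
   contained in this identity. *)
Definition weak_equation (u0 u1 : R -> R) u w h :=
  forall phi, test_function2 setT phi ->
  \int[leb]_(t in `]0, +oo[) \int[leb]_(x in `]0, L[)
     (rho * u (t, x) * d_t (d_t phi) (t, x)
      + mu * w (t, x) * d_x (d_x phi) (t, x)
      + h (t, x) * phi (t, x))
  - \int[leb]_(x in `]0, L[) (rho * u1 x * phi (0, x))
  + \int[leb]_(x in `]0, L[) (rho * u0 x * d_t phi (0, x)) = 0.

(* [v], [w] and [w0] are the weak derivatives u_t, u_xx and u0'', which are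
   unique up to null sets. *)
Definition dissipative_solution (u0 u1 : R -> R) u :=
  {within closed_domain L, continuous u} /\
  exists (v w : R * R -> R) (w0 : R -> R),
    [/\ weak_d_t L u v /\ Linfty_L2 L v,
        weak_d_xx L u w /\ Linfty_L2 L w,
        weak_derivative L 2 u0 w0 /\ L2 L w0,
        exists2 h, in_subdifferential u h & weak_equation u0 u1 u w h
      & {ae leb, forall t, 0 < t ->
          (energy (fun x => v (t, x)) (fun x => w (t, x)) (fun x => u (t, x))
           <= energy u1 w0 u0)%E}].

End dissipative_solutions.

(* Main.v *)
Require Import Defs.
From HB Require Import structures.
From mathcomp Require Import all_boot all_order all_algebra.
From mathcomp Require Import all_classical all_reals all_analysis.
From mathcomp Require Import measurable_realfun ess_sup_inf.
From mathcomp Require Import ring lra zify.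
Set Implicit Arguments.
Unset Strict Implicit.
Unset Printing Implicit Defensive.
Import Order.TTheory GRing.Theory Num.Theory.
Import numFieldNormedType.Exports.
Local Open Scope classical_set_scope.
Local Open Scope ring_scope.

Section calculus.
Variable R : realType.
Implicit Types (f g : R -> R) (x a b : R).
Local Notation leb := (@lebesgue_measure R).

Lemma deriveD f g x df dg : is_derive x 1 f df -> is_derive x 1 g dg ->
  is_derive x 1 (fun y => f y + g y) (df + dg).
Proof. by move=> ? ?; exact: is_deriveD. Qed.

Lemma deriveB f g x df dg : is_derive x 1 f df -> is_derive x 1 g dg ->
  is_derive x 1 (fun y => f y - g y) (df - dg).
Proof. by move=> ? ?; exact: is_deriveB. Qed.

Lemma deriveZ f x df c : is_derive x 1 f df ->
  is_derive x 1 (fun y => c * f y) (c * df).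
Proof. by move=> ?; exact: is_deriveZ. Qed.

Lemma deriveM f g x df dg : is_derive x 1 f df -> is_derive x 1 g dg ->
  is_derive x 1 (fun y => f y * g y) (f x * dg + df * g x).
Proof.
by move=> ? ?; apply: (is_derive_eq (is_deriveM _ _)); rewrite (mulrC df).
Qed.

Lemma derive_sum n (h : nat -> R -> R) x (dh : nat -> R) :
  (forall i, (i < n)%N -> is_derive x 1 (h i) (dh i)) ->
  is_derive x 1 (fun y => \sum_(i < n) h i y) (\sum_(i < n) dh i).
Proof.
move=> H; have -> : (fun y => \sum_(i < n) h i y) = \sum_(i < n) h i.
  by apply/funext => y; rewrite fct_sumE.
by apply: is_derive_sum => i; exact: H.
Qed.

Lemma derive_affine f x df a b : is_derive (a * x + b) 1 f df ->
  is_derive x 1 (fun y => f (a * y + b)) (df * a).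
Proof.
move=> H.
have Hg : is_derive x 1 (fun y => a * y + b) a.
  apply: (is_derive_eq (deriveD (deriveZ a (is_derive_id x (1 : R)))
    (is_derive_cst b x 1))).
  by rewrite mulr1 addr0.
exact: (@is_derive1_comp _ f (fun y => a * y + b) x df a).
Qed.

Lemma derive_shift f x df a : is_derive (x + a) 1 f df ->
  is_derive x 1 (fun y => f (y + a)) df.
Proof.
move=> H; have -> : (fun y => f (y + a)) = (fun y => f (1 * y + a)).
  by apply/funext => y; rewrite mul1r.
rewrite -[df]mulr1; apply: derive_affine; by rewrite mul1r.
Qed.

Lemma is_derive_continuous f x df : is_derive x 1 f df -> {for x, continuous f}.
Proof.
by move=> [H _]; apply/differentiable_continuous/derivable1_diffP.
Qed.

Lemma is_derive_val f x df : is_derive x 1 f df -> derive1 f x = df.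
Proof. by move=> H; rewrite derive1E derive_val. Qed.

Lemma mean_value f df a b : a < b ->
  (forall x, a < x < b -> is_derive x 1 f (df x)) ->
  {within `[a, b], continuous f} ->
  exists2 c, a < c < b & f b - f a = df c * (b - a).
Proof.
move=> ab H cf.
have {}H x : x \in `]a, b[ -> is_derive x 1 f (df x).
  by rewrite in_itv /= => xab; exact: H.
have [c cab E] := MVT ab H cf.
by exists c => //; move: cab; rewrite in_itv.
Qed.

Lemma antiderivative_from f a : continuous f -> (forall x, x <= a -> f x = 0) ->
  exists2 F, forall x, is_derive x 1 F (f x) & forall x, x <= a -> F x = 0.
Proof.
move=> cf f0.
pose F x := (\int[leb]_(t in [set` Interval -oo%O (BRight x)]) f t).
have int u : leb.-integrable [set` Interval -oo%O (BRight u)] (EFin \o f).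
  have /= : leb.-integrable setT (EFin \o (f \_ `[a, Num.max a u])).
    rewrite -restrict_EFin; apply/integrable_restrict => //=.
    rewrite setTI; apply: continuous_compact_integrable.
      exact: segment_compact.
    exact: continuous_subspaceT.
  move=> /(@integrableS _ _ _ leb setT `]-oo, u]%classic) H.
  have {}H := H measurableT (measurable_itv _) (@subsetT _ _).
  apply: eq_integrable H => // x.
  rewrite inE /= in_itv /= => xu.
  rewrite patchE; case: ifPn => //; rewrite notin_setE /= in_itv /= => /negP.
  rewrite negb_and -!ltNge => /orP[xa|]; first by rewrite f0// ltW.
  by rewrite gt_max => /andP[_]; rewrite ltNge xu.
have dF x : is_derive x 1 F (f x).
  have [|||D E] := @continuous_FTC1 R f -oo%O x (x + 1) _ (int _).
  - by rewrite ltrDl.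
  - by rewrite ltNyr.
  - exact: cf.
  - by split => //; rewrite -derive1E.
exists F => // x xa; rewrite /F /Rintegral integral0_eq//= => y.
by rewrite in_itv /= => yx; rewrite f0// (le_trans yx).
Qed.

End calculus.

Section potential_estimates.
Variables (R : realType) (Phi : R -> R).
Hypothesis hPhi : potential Phi.
Implicit Types (x y u e : R).

Local Notation slope1 := (left_slope_at1 Phi).
Local Notation slopeN1 := (right_slope_atN1 Phi).
Local Notation Phi' := (derive1 Phi).

Lemma potential_is_derive x : x <> 1 -> x <> -1 -> is_derive x 1 Phi (Phi' x).
Proof.
move=> x1 xN1; have [H _ _] := Phi_C2 hPhi x1 xN1.
by split => //; rewrite -derive1E.
Qed.

Lemma slope1_gt0 : 0 < slope1.
Proof.
have /andP[h1 h2] : 0 < Phi' (2^-1) <= slope1 by apply: (dPhi_pos hPhi); lra.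
exact: lt_le_trans h1 h2.
Qed.

Lemma slopeN1_lt0 : slopeN1 < 0.
Proof.
have /andP[h1 h2] : slopeN1 <= Phi' (- 2^-1) < 0 by apply: (dPhi_neg hPhi); lra.
exact: le_lt_trans h1 h2.
Qed.

Lemma potential_mean_value x y : x < y ->
  (forall z, x < z < y -> z <> 1 /\ z <> -1) ->
  exists2 c, x < c < y & Phi y - Phi x = Phi' c * (y - x).
Proof.
move=> xy H; apply: mean_value => //.
  by move=> z /H[z1 zN1]; exact: potential_is_derive.
by apply: continuous_subspaceT; exact: Phi_continuous.
Qed.

Let incr_inner x y : 0 <= x -> x <= y -> y <= 1 ->
  0 <= Phi y - Phi x <= slope1 * (y - x).
Proof.
move=> x0; rewrite le_eqVlt => /predU1P[<- _|xy y1].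
  by rewrite !subrr mulr0 lexx.
have [|c /andP[xc cy] ->] := potential_mean_value xy.
  by move=> z /andP[xz zy]; split => ?; lra.
have /andP[c0 c1] : 0 < Phi' c <= slope1 by apply: (dPhi_pos hPhi); lra.
rewrite mulr_ge0 ?ler_wpM2r//=; lra.
Qed.

Lemma potential_incr x y : 0 <= x -> x <= y ->
  0 <= Phi y - Phi x <= slope1 * (y - x).
Proof.
move=> x0 xy; have s0 := slope1_gt0.
have [y1|y1] := leP y 1; first exact: incr_inner.
rewrite (Phi_cst_right hPhi (ltW y1)).
have [x1|x1] := leP x 1.
  have /andP[-> h] := incr_inner x0 x1 (lexx 1); rewrite /=.
  apply: (le_trans h); rewrite ler_pM2l//; lra.
rewrite (Phi_cst_right hPhi (ltW x1)) subrr lexx /= mulr_ge0//; lra.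
Qed.

Let decr_inner x y : -1 <= x -> x <= y -> y <= 0 ->
  slopeN1 * (y - x) <= Phi y - Phi x <= 0.
Proof.
move=> x0; rewrite le_eqVlt => /predU1P[<- _|xy y1].
  by rewrite !subrr mulr0 lexx.
have [|c /andP[xc cy] ->] := potential_mean_value xy.
  by move=> z /andP[xz zy]; split => ?; lra.
have /andP[c0 c1] : slopeN1 <= Phi' c < 0 by apply: (dPhi_neg hPhi); lra.
rewrite ler_wpM2r//=; first by rewrite mulr_le0_ge0//; lra.
lra.
Qed.

Lemma potential_decr x y : x <= y -> y <= 0 ->
  slopeN1 * (y - x) <= Phi y - Phi x <= 0.
Proof.
move=> xy y0; have s0 := slopeN1_lt0.
have [x1|x1] := leP (-1) x; first exact: decr_inner.
rewrite (Phi_cst_left hPhi (ltW x1)).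
have [y1|y1] := leP (-1) y.
  have /andP[h ->] := decr_inner (lexx (-1)) y1 y0; rewrite andbT.
  apply: (le_trans _ h); rewrite ler_nM2l//; lra.
rewrite (Phi_cst_left hPhi (ltW y1)) subrr lexx andbT nmulr_rle0//; lra.
Qed.

Definition potential_lip : R := slope1 - slopeN1.

Lemma potential_lip_gt0 : 0 < potential_lip.
Proof. by have := slope1_gt0; have := slopeN1_lt0; rewrite /potential_lip; lra. Qed.

Lemma potential_lipschitz x y : `|Phi y - Phi x| <= potential_lip * `|y - x|.
Proof.
have s0 := slope1_gt0; have s1 := slopeN1_lt0.
wlog xy : x y / x <= y => [H|].
  have [/H//|/ltW/H] := leP x y.
  by rewrite distrC (distrC x).
have e0 : 0 <= y - x by rewrite subr_ge0.
rewrite (ger0_norm e0) /potential_lip mulrBl ler_norml.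
have h1 : 0 <= slope1 * (y - x) by rewrite mulr_ge0// ltW.
have h2 : slopeN1 * (y - x) <= 0 by rewrite nmulr_rle0.
have [x0|x0] := leP 0 x.
  have /andP[? ?] := potential_incr x0 xy; apply/andP; split; lra.
have [y0|y0] := leP y 0.
  have /andP[? ?] := potential_decr xy y0; apply/andP; split; lra.
have /andP[p1 p2] := potential_incr (lexx 0) (ltW y0).
have /andP[p3 p4] := potential_decr (ltW x0) (lexx 0).
have p5 : slope1 * (y - 0) <= slope1 * (y - x) by rewrite ler_pM2l//; lra.
have p6 : slopeN1 * (y - x) <= slopeN1 * (0 - x) by rewrite ler_nM2l//; lra.
apply/andP; split; lra.
Qed.

Lemma potential_bounded : exists2 B, 0 < B & forall x, 0 <= Phi x <= B.
Proof.
exists (Phi 0 + potential_lip).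
  have := potential_lip_gt0; have := Phi_ge0 hPhi 0; lra.
move=> x; rewrite (Phi_ge0 hPhi)/=.
have aux y : `|y| <= 1 -> Phi y <= Phi 0 + potential_lip.
  move=> y1; have := potential_lipschitz 0 y; rewrite subr0 => h.
  have h2 : potential_lip * `|y| <= potential_lip by rewrite ger_pMr ?potential_lip_gt0.
  have := ler_norm (Phi y - Phi 0); lra.
have [x1|x1] := leP x (-1).
  by rewrite (Phi_cst_left hPhi x1) aux// normrN1.
have [x2|x2] := leP 1 x.
  by rewrite (Phi_cst_right hPhi x2) aux// normr1.
by apply: aux; rewrite ler_norml; apply/andP; split; lra.
Qed.

Definition subdiff_lo u : R :=
  if `|u| < 1 then Phi' u else if u == -1 then slopeN1 else 0.

Definition subdiff_hi u : R :=
  if `|u| < 1 then Phi' u else if u == 1 then slope1 else 0.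

Definition potential_slope e x := (Phi (x + e) - Phi x) / e.

Lemma potential_slope_cvg u eta : 0 < eta -> exists2 delta, 0 < delta &
  forall x e, `|x - u| < delta -> 0 < e < delta ->
  subdiff_lo u - eta <= potential_slope e x <= subdiff_hi u + eta.
Proof.
move=> eta0; rewrite /subdiff_lo /subdiff_hi.
case: ifPn => [u1|].
  have [uN1' u1'] : -1 < u /\ u < 1 by move: u1; rewrite ltr_norml => /andP[].
  have [_ D _] : [/\ derivable Phi u 1, derivable (Phi' : R -> R) u 1 &
      {for u, continuous (derive1n 2 Phi)}] by apply: (Phi_C2 hPhi) => ?; lra.
  have : {for u, continuous (Phi' : R -> R)}.
    exact/differentiable_continuous/derivable1_diffP.
  move=> /cvgrPdist_le /(_ _ eta0) /nbhs_ballP[r /= r0 Hr].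
  pose d := Num.min r (1 - `|u|) / 2.
  have d0 : 0 < d by rewrite divr_gt0// lt_min r0 subr_gt0.
  have [dr du] : 2 * d <= r /\ 2 * d <= 1 - `|u|.
    by rewrite /d mulrC divfK//; split; rewrite ge_min lexx ?orbT.
  have [un1 un2] := (ler_norm u, ler_normr (-u) `|u|).
  exists d => // x e; rewrite ltr_norml => /andP[x1 x2] /andP[e0 ed].
  have nu : - u <= `|u| by rewrite -normrN ler_norm.
  have [||c /andP[c1 c2] E] := @potential_mean_value x (x + e).
  - lra.
  - by move=> z /andP[z1 z2]; split => ?; lra.
  rewrite /potential_slope E addrAC subrr add0r mulfK ?gt_eqF//.
  have /Hr : ball u r c.
    rewrite /ball/= ltr_norml; apply/andP; split; lra.
  by rewrite ler_norml => /andP[? ?]; apply/andP; split; lra.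
rewrite -leNgt => u1.
have [{}u1|[{}u1|[{}u1|{}u1]]] : u = 1 \/ u = -1 \/ u < -1 \/ 1 < u.
  move: u1; rewrite ler_normr => /orP[] h.
    by case: (ltgtP u 1) => ?; [lra|right;right;right|left].
  by right; case: (ltgtP u (-1)) => ?; [right;left|lra|left].
- exists 1 => // x e; rewrite u1 eqxx ltr_norml => /andP[x1 x2] /andP[e0 e1].
  have -> : 1 == -1 :> R = false by apply/eqP; lra.
  have [||p1 p2] := (andP (@potential_incr x (x + e) _ _)); [lra|lra|].
  rewrite /potential_slope; apply/andP; split.
    have : 0 <= (Phi (x + e) - Phi x) / e by rewrite divr_ge0// ltW.
    lra.
  have : (Phi (x + e) - Phi x) / e <= slope1.
    by rewrite ler_pdivrMr//; move: p2; rewrite addrAC subrr add0r.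
  lra.
- exists (1/2) => [|x e]; first lra.
  rewrite u1 eqxx ltr_norml => /andP[x1 x2] /andP[e0 e1].
  have -> : -1 == 1 :> R = false by apply/eqP; lra.
  have [||p1 p2] := (andP (@potential_decr x (x + e) _ _)); [lra|lra|].
  rewrite /potential_slope; apply/andP; split.
    have : slopeN1 <= (Phi (x + e) - Phi x) / e.
      by rewrite ler_pdivlMr//; move: p1; rewrite addrAC subrr add0r.
    lra.
  have : (Phi (x + e) - Phi x) / e <= 0 by rewrite ler_pdivrMr// mul0r.
  lra.
- have -> : u == -1 = false by apply/eqP; lra.
  have -> : u == 1 = false by apply/eqP; lra.
  exists ((-1 - u) / 2) => [|x e]; first lra.
  rewrite ltr_norml => /andP[x1 x2] /andP[e0 e1].
  rewrite /potential_slope (Phi_cst_left hPhi (_ : x <= -1)); last lra.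
  rewrite (Phi_cst_left hPhi (_ : x + e <= -1)); last lra.
  rewrite subrr mul0r; apply/andP; split; lra.
- have -> : u == -1 = false by apply/eqP; lra.
  have -> : u == 1 = false by apply/eqP; lra.
  exists (u - 1) => [|x e]; first lra.
  rewrite ltr_norml => /andP[x1 x2] /andP[e0 e1].
  rewrite /potential_slope (Phi_cst_right hPhi (_ : 1 <= x)); last lra.
  rewrite (Phi_cst_right hPhi (_ : 1 <= x + e)); last lra.
  rewrite subrr mul0r; apply/andP; split; lra.
Qed.

Lemma potential_slope_bound e x : 0 < e -> `|potential_slope e x| <= potential_lip.
Proof.
move=> e0; rewrite /potential_slope normrM normfV (gtr0_norm e0) ler_pdivrMr//.
by have := potential_lipschitz x (x + e); rewrite addrAC subrr add0r (gtr0_norm e0).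
Qed.

Lemma potential_slope_lipschitz e x y : 0 < e ->
  `|potential_slope e y - potential_slope e x| <= (2 * potential_lip / e) * `|y - x|.
Proof.
move=> e0; rewrite /potential_slope -mulrBl normrM normfV (gtr0_norm e0).
rewrite ler_pdivrMr// mulrAC divfK ?gt_eqF//.
have p1 := potential_lipschitz x y.
have := potential_lipschitz (x + e) (y + e).
rewrite (_ : y + e - (x + e) = y - x); last ring.
move=> p2; rewrite (_ : Phi (y + e) - Phi y - (Phi (x + e) - Phi x) =
  (Phi (y + e) - Phi (x + e)) - (Phi y - Phi x)); last ring.
apply: (le_trans (ler_normB _ _)); lra.
Qed.

Lemma potential_smoothing e : 0 < e -> exists2 G : R -> R,
  forall x, is_derive x 1 G (potential_slope e x) &
  forall x, 0 <= G x /\ `|G x - Phi x| <= potential_lip * e.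
Proof.
move=> e0.
have [||P dP _] := @antiderivative_from R (fun x => Phi x - Phi (-1)) (-1).
- by move=> x; apply: cvgB; [exact: (Phi_continuous hPhi)|exact: cvg_cst].
- by move=> x x1; rewrite (Phi_cst_left hPhi x1) subrr.
have EG x : exists2 c, x < c < x + e & Phi (-1) + (P (x + e) - P x) / e = Phi c.
  have [||c ? E] := @mean_value R P (fun x => Phi x - Phi (-1)) x (x + e).
  - lra.
  - by apply: continuous_subspaceT => y; apply: is_derive_continuous.
  - by exists c => //; rewrite E addrAC subrr add0r mulfK ?gt_eqF// addrC subrK.
exists (fun x => Phi (-1) + (P (x + e) - P x) / e) => x.
  rewrite (_ : (fun _ => _) = (fun y => Phi (-1) + e^-1 * (P (y + e) - P y))).
    apply: (is_derive_eq (deriveD (is_derive_cst (Phi (-1)) x 1)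
      (deriveZ e^-1 (deriveB (derive_shift (dP _)) (dP _))))).
    rewrite add0r /potential_slope mulrC; congr (_ / _); ring.
  by apply/funext => y; rewrite [e^-1 * _]mulrC.
have [c /andP[c1 c2] ->] := EG x; split; first exact: (Phi_ge0 hPhi).
apply: (le_trans (potential_lipschitz _ _)).
rewrite ler_pM2l ?potential_lip_gt0// ger0_norm; lra.
Qed.

End potential_estimates.

Section ode.
Variable R : realType.
Implicit Types (f g : R -> R) (t : R).

Lemma geometric_increments_cvg (u : nat -> R) (M : R) :
  (forall k, `|u k.+1 - u k| <= M / 2 ^+ k) ->
  exists l, forall k, `|l - u k| <= 2 * M / 2 ^+ k.
Proof.
move=> H.
have p2 k : 0 < 2 ^+ k :> R by rewrite exprn_gt0.
have pS k : 2 * M / 2 ^+ k.+1 = M / 2 ^+ k.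
  by rewrite exprS invfM mulrACA divff ?mul1r// pnatr_eq0.
have p0 k : 2 * M / 2 ^+ k = M / 2 ^+ k + M / 2 ^+ k by ring.
pose w k := u k - 2 * M / 2 ^+ k; pose v k := u k + 2 * M / 2 ^+ k.
have M0 : 0 <= M by have := H 0%N; rewrite expr0 divr1; exact: le_trans.
have vw k : w k <= v k.
  have : 0 <= 2 * M / 2 ^+ k by rewrite divr_ge0 ?(ltW (p2 k))// mulr_ge0.
  rewrite /w /v; lra.
have wS k : w k <= w k.+1.
  by rewrite /w pS p0; have := H k; rewrite ler_norml => /andP[]; lra.
have vS k : v k.+1 <= v k.
  by rewrite /v pS p0; have := H k; rewrite ler_norml => /andP[]; lra.
have wnd : {homo w : m n / (m <= n)%N >-> m <= n}.
  by apply: homo_leq => // x y z; exact: le_trans.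
have vni m n : (m <= n)%N -> v n <= v m.
  elim: n => [|n IH]; first by rewrite leqn0 => /eqP ->.
  rewrite leq_eqVlt => /predU1P[->//|]; rewrite ltnS => /IH; exact: le_trans.
have wv m n : w m <= v n.
  apply: (@le_trans _ _ (w (maxn m n))); first by rewrite wnd// leq_maxl.
  by apply: (le_trans (vw _)); rewrite vni// leq_maxr.
have hs : has_sup (range w).
  by split; [exists (w 0%N), 0%N|exists (v 0%N) => _ [m _ <-]].
exists (sup (range w)) => k; rewrite ler_distl.
apply/andP; split.
  by apply: ub_le_sup; [case: hs|exists k].
by apply: ge_sup; [case: hs|move=> _ [m _ <-]; exact: wv].
Qed.

Lemma small_geometric (M eps : R) : 0 < eps -> exists k, M / 2 ^+ k <= eps.
Proof.
move=> e0; have [k Hk] : exists k : nat, `|M| / eps <= k%:R.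
  by exists (Num.truncn (`|M| / eps)).+1; apply/ltW/truncnS_gt.
exists k; rewrite ler_pdivrMr ?exprn_gt0//.
apply: (le_trans (ler_norm _)); rewrite mulrC -ler_pdivrMr//.
by apply: (le_trans Hk); rewrite -natrX ler_nat ltnW// ltn_expl.
Qed.

Lemma continuous_pospart : continuous (fun t : R => (t + `|t|) / 2).
Proof.
move=> t; apply: cvgMl; apply: cvgD; first exact: cvg_id.
by apply: cvg_norm; exact: cvg_id.
Qed.

Lemma pospart_ge0 t : 0 <= t -> (t + `|t|) / 2 = t.
Proof. by move=> t0; rewrite ger0_norm//; field. Qed.

Lemma pospart_le0 t : t <= 0 -> (t + `|t|) / 2 = 0.
Proof. by move=> t0; rewrite ler0_norm// subrr mul0r. Qed.

(* Extending the integrand continuously to the left of 0, down to 0 at -1,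
   makes the primitive two-sided differentiable at 0. *)
Lemma primitive_from0 f : continuous f -> exists G : R -> R,
  [/\ continuous G, G 0 = 0 & forall t, 0 <= t -> is_derive t 1 G (f t)].
Proof.
move=> cf; pose p (t : R) := (t + `|t|) / 2.
have [||P dP _] := @antiderivative_from R (fun t => f t * (p (t + 1) - p t)) (-1).
- move=> t; apply: cvgM; first exact: cf.
  apply: cvgB; last exact: continuous_pospart.
  apply: (@continuous_comp _ _ _ (fun t => t + 1) p).
    by apply: cvgD; [exact: cvg_id|exact: cvg_cst].
  exact: continuous_pospart.
- by move=> t t1; rewrite /p !pospart_le0 ?subrr ?mulr0//; lra.
exists (fun t => P t - P 0); split.
- move=> t; apply: cvgB; last exact: cvg_cst.
  exact: is_derive_continuous (dP t).
- by rewrite subrr.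
- move=> t t0; apply: (is_derive_eq (deriveB (dP t) (is_derive_cst (P 0) t 1))).
  have t1 : 0 <= t + 1 by lra.
  by rewrite subr0 /p !pospart_ge0// addrAC subrr add0r mulr1.
Qed.

Lemma nonneg_derive_le f (df : R -> R) t : (forall s : R, 0 <= s -> is_derive s 1 f (df s)) ->
  (forall s : R, 0 <= s -> 0 <= df s) -> 0 <= t -> f 0 <= f t.
Proof.
move=> H p; rewrite le_eqVlt => /predU1P[<-//|t0].
have [||c /andP[c0 ct] E] := @mean_value R f df 0 t t0.
- by move=> x /andP[x0 _]; apply: H; exact: ltW.
- apply: continuous_in_subspaceT => x; rewrite inE /= in_itv /= => /andP[x0 _].
  exact: is_derive_continuous (H _ x0).
rewrite -subr_ge0 E mulr_ge0 ?p// ?ltW// subr_gt0//.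
Qed.

Lemma exp_weighted_bound (K C : R) f (df : R -> R) t : 0 < K ->
  (forall s : R, 0 <= s -> is_derive s 1 f (df s)) -> f 0 = 0 ->
  (forall s : R, 0 <= s -> `|df s| <= C * expR (2 * K * s)) -> 0 <= t ->
  `|f t| <= C / (2 * K) * expR (2 * K * t).
Proof.
move=> K0 H f0 B t0; have K20 : 0 < 2 * K by rewrite mulr_gt0.
have C0 : 0 <= C.
  by have := B 0 (lexx _); rewrite mulr0 expR0 mulr1; exact: le_trans.
pose E (s : R) := C / (2 * K) * expR (2 * K * s + 0).
have dE (s : R) : is_derive s 1 E (C * expR (2 * K * s)).
  apply: (is_derive_eq (deriveZ _ (derive_affine (is_derive_expR _)))).
  by rewrite addr0 [_ * (2 * K)]mulrC mulrA divfK// gt_eqF.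
have CK : 0 <= C / (2 * K) by rewrite divr_ge0// ltW.
have E0 : 0 <= E 0 by rewrite /E mulr_ge0// expR_ge0.
have h1 := @nonneg_derive_le (fun s => E s - f s)
  (fun s => C * expR (2 * K * s) - df s) t
  (fun s s0 => deriveB (dE s) (H s s0)).
have h2 := @nonneg_derive_le (fun s => E s + f s)
  (fun s => C * expR (2 * K * s) + df s) t
  (fun s s0 => deriveD (dE s) (H s s0)).
have EE : E t = C / (2 * K) * expR (2 * K * t) by rewrite /E addr0.
have {}h1 : E 0 - f 0 <= E t - f t.
  by apply: h1 => // s s0; have := B s s0; rewrite ler_norml => /andP[]; lra.
have {}h2 : E 0 + f 0 <= E t + f t.
  by apply: h2 => // s s0; have := B s s0; rewrite ler_norml => /andP[]; lra.
by rewrite -EE ler_norml; apply/andP; split; move: h1 h2; rewrite f0; lra.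
Qed.

Section picard.
Variables (n : nat) (F : (nat -> R) -> nat -> R) (K : R) (x0 : nat -> R).
Hypothesis K0 : 0 < K.
Hypothesis FK : forall (x y : nat -> R) (D : R), (forall j, (j < n)%N -> `|x j - y j| <= D) ->
  forall i, (i < n)%N -> `|F x i - F y i| <= K * D.

Let pos (t : R) := (t + `|t|) / 2.

Let prim f : R -> R := xget (fun=> 0)
  [set G | [/\ continuous G, G 0 = 0 & forall t, 0 <= t -> is_derive t 1 G (f t)]].

Let primP f : continuous f -> [/\ continuous (prim f), prim f 0 = 0 &
  forall t, 0 <= t -> is_derive t 1 (prim f) (f t)].
Proof.
move=> /primitive_from0[G HG].
exact: (@xgetPex _ (fun=> 0) [set G : R -> R | [/\ continuous G, G 0 = 0 &
  forall t, 0 <= t -> is_derive t 1 G (f t)]] (ex_intro _ G HG)).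
Qed.

Let step (X : R -> nat -> R) (t : R) (i : nat) : R :=
  x0 i + prim (fun s => F (X (pos s)) i) t.

Let good (X : R -> nat -> R) := forall i, (i < n)%N ->
  forall s : R, 0 <= s -> forall e : R, 0 < e ->
    \forall r \near s, 0 <= r -> `|X s i - X r i| <= e.

Let good_cont X i : good X -> (i < n)%N ->
  continuous (fun s => F (X (pos s)) i).
Proof.
move=> gX i_n s; apply/cvgrPdist_le => e e0.
have ps r : 0 <= pos r.
  rewrite /pos; case: (leP 0 r) => r0; first by rewrite pospart_ge0.
  by rewrite pospart_le0// ltW.
have H : \forall r \near s, forall j : 'I_n, `|X (pos s) j - X (pos r) j| <= e / K.
  apply: (@filter_forall R 'I_n
    (fun j r => is_true (`|X (pos s) j - X (pos r) j| <= e / K)) (nbhs s) _) => j.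
  have Hn := gX j (ltn_ord j) (pos s) (ps s) (e / K) (divr_gt0 e0 K0).
  have Hc : nbhs s (pos @^-1` [set r | 0 <= r -> `|X (pos s) j - X r j| <= e / K]).
    exact: (@continuous_pospart s _ Hn).
  by apply: filterS Hc => r; apply; exact: ps.
apply: filterS H => r H.
rewrite -[e](divfK (lt0r_neq0 K0)) mulrC.
by apply: FK i_n => j jn; exact: (H (Ordinal jn)).
Qed.

Let step_good X : good X -> good (step X).
Proof.
move=> gX i i_n s s0 e e0; have [c _ _] := primP (good_cont gX i_n).
have /cvgrPdist_le/(_ _ e0) := c s.
apply: filterS => r + _; rewrite /step opprD addrACA subrr add0r//.
Qed.

Let step_derive X i t : good X -> (i < n)%N -> 0 <= t ->
  is_derive t 1 (fun t => step X t i) (F (X t) i).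
Proof.
move=> gX i_n t0; have [_ _ d] := primP (good_cont gX i_n).
have := deriveD (is_derive_cst (x0 i) t 1) (d t t0).
by rewrite add0r /pos pospart_ge0.
Qed.

Let step_contract X Y (C : R) : good X -> good Y ->
  (forall t i, 0 <= t -> (i < n)%N -> `|X t i - Y t i| <= C * expR (2 * K * t)) ->
  forall t i, 0 <= t -> (i < n)%N ->
    `|step X t i - step Y t i| <= C / 2 * expR (2 * K * t).
Proof.
move=> gX gY H t i t0 i_n.
have [_ pX _] := primP (good_cont gX i_n).
have [_ pY _] := primP (good_cont gY i_n).
rewrite (_ : C / 2 = (K * C) / (2 * K)); last first.
  by field; rewrite gt_eqF.
apply: (@exp_weighted_bound K (K * C) (fun t => step X t i - step Y t i)
  (fun t => F (X t) i - F (Y t) i)) => //.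
- by move=> s s0; apply: deriveB; apply: step_derive.
- by rewrite /step pX pY subrr.
- by move=> s s0; rewrite -mulrA; apply: FK => // j jn; exact: H.
Qed.

Lemma picard : exists X : R -> nat -> R, forall i, (i < n)%N ->
  X 0 i = x0 i /\
  forall t, 0 <= t -> is_derive t 1 (fun t => X t i) (F (X t) i).
Proof.
pose X k := iter k step (fun=> x0).
have gX k : good (X k).
  elim: k => [|k IH]; last exact: step_good.
  by move=> i _ s _ e e0; apply: (@filterE _ (nbhs s)) => r _; rewrite /X/= subrr normr0 ltW.
pose B := \sum_(i < n) `|F x0 i|.
have BE i : (i < n)%N -> `|F x0 i| <= B.
  move=> i_n; rewrite /B (bigD1 (Ordinal i_n))//= lerDl.
  by apply: sumr_ge0 => j _.
have B0 : 0 <= B by apply: sumr_ge0.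
pose C := B / (2 * K).
have C0 : 0 <= C by rewrite divr_ge0// mulr_ge0// ltW.
have bX k t i : 0 <= t -> (i < n)%N ->
    `|X k.+1 t i - X k t i| <= C / 2 ^+ k * expR (2 * K * t).
  elim: k t i => [|k IH] t i t0 i_n; last first.
    rewrite exprS invfM mulrCA mulrC [2^-1 * _]mulrC mulrC.
    exact: (step_contract (gX k.+1) (gX k) IH).
  rewrite expr0 divr1.
  apply: (@exp_weighted_bound K B (fun t => X 1%N t i - X 0%N t i)
    (fun s => F x0 i - 0)) => //.
  - move=> s s0; apply: deriveB; first exact: (step_derive (gX 0%N)).
    exact: is_derive_cst.
  - have [_ p0 _] := primP (good_cont (gX 0%N) i_n).
    by rewrite /X /= /step p0 addr0 subrr.
  - move=> s s0; rewrite subr0; apply: (le_trans (BE _ i_n)).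
    by rewrite ler_peMr// -expR0 ler_expR mulr_ge0// mulr_ge0// ltW.
have [Y HY] : exists Y : R -> nat -> R, forall t i, 0 <= t -> (i < n)%N ->
    forall k, `|Y t i - X k t i| <= 2 * C / 2 ^+ k * expR (2 * K * t).
  have H t i : exists l, 0 <= t -> (i < n)%N ->
      forall k, `|l - X k t i| <= 2 * C / 2 ^+ k * expR (2 * K * t).
    have [t0|_] := boolP (0 <= t); last by exists 0.
    have [i_n|_] := boolP (i < n)%N; last by exists 0.
    have [|l Hl] := @geometric_increments_cvg (fun k => X k t i)
       (C * expR (2 * K * t)).
      by move=> k; apply: le_trans (bX k t i t0 i_n) _; rewrite mulrAC.
    by exists l => _ _ k; apply: (le_trans (Hl k)); rewrite mulrA mulrAC.
  have [Y HY] := choice (fun ti : R * nat => H ti.1 ti.2).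
  by exists (fun t i => Y (t, i)) => t i; exact: (HY (t, i)).
have gY : good Y.
  move=> i i_n s s0 e e0.
  have e3 : 0 < e / 3 by rewrite divr_gt0.
  have [k Hk] := small_geometric (2 * C * expR (2 * K * (s + 1))) e3.
  have aux r : 0 <= r -> r <= s + 1 -> `|Y r i - X k r i| <= e / 3.
    move=> r0 rs; apply: (le_trans (HY r i r0 i_n k)).
    apply: le_trans Hk; rewrite [leLHS]mulrAC; apply: ler_wpM2r.
      by rewrite invr_ge0 exprn_ge0.
    apply: ler_wpM2l; first by rewrite mulr_ge0.
    by rewrite ler_expR ler_pM2l// mulr_gt0.
  near=> r => r0.
  have h1 : `|Y s i - X k s i| <= e / 3 by apply: aux => //; rewrite lerDl.
  have rs : r <= s + 1 by apply: ltW; near: r; apply: lt_nbhsl; rewrite ltrDl.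
  have h2 := aux r r0 rs.
  have h3 : `|X k s i - X k r i| <= e / 3.
    move: r0; near: r; exact: (gX k).
  have -> : Y s i - Y r i = (Y s i - X k s i) + (X k s i - X k r i)
     - (Y r i - X k r i) by ring.
  apply: (le_trans (ler_normB _ _)); have := ler_normD (Y s i - X k s i)
    (X k s i - X k r i); lra.
have YE t i : 0 <= t -> (i < n)%N -> step Y t i = Y t i.
  move=> t0 i_n; apply/eqP; rewrite -subr_eq0 -normr_le0; apply/ler_addgt0Pl => e e0.
  rewrite addr0; have e2 : 0 < e / 2 by rewrite divr_gt0.
  have [k Hk] := small_geometric (2 * C * expR (2 * K * t)) e2.
  have h1 := HY t i t0 i_n k.+1.
  have := step_contract gY (gX k) (fun s j s0 jn => HY s j s0 jn k) t0 i_n.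
  rewrite -[step (X k)]/(X k.+1) => h2.
  have E : 2 * C / 2 ^+ k * expR (2 * K * t) <= e / 2 by rewrite mulrAC.
  have E1 : 2 * C / 2 ^+ k / 2 * expR (2 * K * t) <= e / 2.
    apply: le_trans E; rewrite ler_wpM2r ?expR_ge0// ler_pdivrMr// ler_peMr//; last lra.
    by rewrite divr_ge0 ?exprn_ge0// mulr_ge0.
  have E2 : 2 * C / 2 ^+ k.+1 * expR (2 * K * t) <= e / 2.
    by apply: le_trans E1; rewrite exprS invfM [_ / 2]mulrC mulrCA.
  have -> : step Y t i - Y t i = (step Y t i - X k.+1 t i) - (Y t i - X k.+1 t i).
    by ring.
  apply: (le_trans (ler_normB _ _)); lra.
exists (step Y) => i i_n; split.
  have [_ p0 _] := primP (good_cont gY i_n).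
  by rewrite /step p0 addr0.
move=> t t0; have := step_derive gY i_n t0.
suff -> : F (step Y t) i = F (Y t) i by [].
apply/eqP; rewrite -subr_eq0 -normr_le0 -(mulr0 K); apply: FK => // j jn.
by rewrite YE// subrr normr0.
Unshelve. all: by end_near. Qed.

End picard.
End ode.

Section finite_differences.
Variable R : realType.
Implicit Types (a d : nat -> R) (L h t : R).
Local Notation leb := (@lebesgue_measure R).

Definition second_diff (N : nat) h (i j : nat) : R :=
  if (i.+2 < N)%N then
    ((j == i.+2)%:R - 2 * (j == i.+1)%:R + (j == i)%:R) / h ^+ 2
  else 0.

Lemma sum_delta (N c : nat) a : (c < N)%N ->
  \sum_(j < N) ((j : nat) == c)%:R * a j = a c.
Proof.
move=> cN; rewrite (bigD1 (Ordinal cN))//= eqxx mul1r big1 ?addr0// => i ic.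
rewrite (_ : (i : nat) == c = false) ?mul0r//.
by apply: contraNF ic => /eqP ic; apply/eqP/val_inj.
Qed.

Lemma sum_second_diff N h i a :
  \sum_(j < N) second_diff N h i j * a j =
  if (i.+2 < N)%N then (a i.+2 - 2 * a i.+1 + a i) / h ^+ 2 else 0.
Proof.
rewrite /second_diff; case: ifPn => iN; last first.
  by apply: big1 => j _; rewrite mul0r.
have i1N : (i.+1 < N)%N by exact: ltnW.
have i0N : (i < N)%N by exact: ltnW.
under eq_bigr do rewrite mulrAC mulrDl mulrBl -mulrA.
rewrite -mulr_suml big_split sumrB/= -mulr_sumr.
by rewrite !sum_delta.
Qed.

Lemma sum_second_diff_tr N h j (psi : R -> R) : (j < N)%N -> 0 < h ->
  (forall x, x < 0 -> psi x = 0) ->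
  (forall i, (i < N)%N -> (N <= i.+2)%N -> psi (h * i%:R) = 0) ->
  \sum_(i < N) second_diff N h i j * psi (h * i%:R) =
  (psi (h * j%:R) - 2 * psi (h * j%:R - h) + psi (h * j%:R - 2 * h)) / h ^+ 2.
Proof.
move=> jN h0 p0 pN.
pose S (k : nat) := \sum_(i < N) (j == i + k)%N%:R * psi (h * i%:R).
have SE k : S k = psi (h * j%:R - k%:R * h).
  rewrite /S; have [kj|jk] := leqP k j.
    rewrite (_ : h * j%:R - k%:R * h = h * (j - k)%N%:R); last first.
      by rewrite natrB//; ring.
    rewrite -(@sum_delta N (j - k) (fun i => psi (h * i%:R))); last first.
      exact: leq_ltn_trans (leq_subr _ _) jN.
    apply: eq_bigr => i _; congr (_%:R * _); congr nat_of_bool.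
    by rewrite -[in LHS](subnK kj) eqn_add2r eq_sym.
  rewrite big1 => [|i _]; last first.
    rewrite (_ : (j == i + k)%N = false) ?mul0r//; apply/negbTE.
    by rewrite neq_ltn (leq_trans jk)// leq_addl.
  rewrite p0//; move: jk; rewrite -(ltr_nat R) => jk.
  by rewrite mulrC -mulrBl pmulr_llt0// subr_lt0.
have -> : psi (h * j%:R) = S 0%N by rewrite SE mul0r subr0.
have -> : psi (h * j%:R - h) = S 1%N by rewrite SE mul1r.
rewrite -SE /S mulr_sumr -sumrB -big_split/= mulr_suml; apply: eq_bigr => i _ /=.
rewrite /second_diff; case: ifPn => iN.
  by rewrite addn0 addn1 addn2; ring.
by move: iN; rewrite -leqNgt => iN; rewrite pN//; ring.
Qed.

Lemma second_diff_mean (f f1 f2 : R -> R) (x : R) h : 0 < h ->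
  (forall y : R, is_derive y 1 f (f1 y)) -> (forall y : R, is_derive y 1 f1 (f2 y)) ->
  exists2 c, x < c < x + 2 * h &
    (f (x + 2 * h) - 2 * f (x + h) + f x) / h ^+ 2 = f2 c.
Proof.
move=> h0 df df1.
have [|||c /andP[c0 c1] E] := @mean_value R (fun y => f (y + h) - f y)
   (fun y => f1 (y + h) - f1 y) x (x + h).
- lra.
- by move=> y _; exact: (deriveB (derive_shift (df _)) (df _)).
- apply: continuous_subspaceT => y.
  exact: is_derive_continuous (deriveB (derive_shift (df _)) (df _)).
- have [||e /andP[e0 e1] E'] := @mean_value R f1 f2 c (c + h).
  + lra.
  + by apply: continuous_subspaceT => y; exact: is_derive_continuous (df1 _).
  exists e; first by apply/andP; split; lra.
  move: E; rewrite {}E' (_ : x + h + h = x + 2 * h); last ring.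
  move=> E; rewrite (_ : _ + f x = f (x + 2 * h) - f (x + h) - (f (x + h) - f x)).
    by rewrite E; field; exact: lt0r_neq0.
  ring.
Qed.

Section grid_bounds.
Variables (m : nat) (L h : R).
Hypotheses (m0 : (0 < m)%N) (L0 : 0 < L).
Let N := (m + m)%N.
Hypothesis hN : h * N%:R = L.

Lemma grid_h_gt0 : 0 < h.
Proof.
have : 0 < h * N%:R by rewrite hN.
by rewrite pmulr_lgt0// ltr0n addn_gt0 m0.
Qed.
Let h0 := grid_h_gt0.

Definition grid_slope (A2 W2 : R) := (L + W2) / 2 + 2 * (L + A2) / L ^+ 2.
Definition grid_sup (A2 W2 : R) := (L + A2) / (2 * L) + L * grid_slope A2 W2.

Lemma grid_sum_abs (n : nat) a (A2 : R) : (n <= N)%N ->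
  h * (\sum_(j < N) a j ^+ 2) <= A2 ->
  h * (\sum_(j < n) `|a j|) <= (L + A2) / 2.
Proof.
move=> nN HA.
have H1 : \sum_(j < n) `|a j| <= \sum_(j < N) `|a j|.
  rewrite -(subnKC nN) big_split_ord/= lerDl; exact: sumr_ge0.
have H2 : \sum_(j < N) `|a j| <= (N%:R + \sum_(j < N) a j ^+ 2) / 2.
  rewrite -[X in (X + _) / 2](_ : \sum_(j < N) (1 : R) = _); last first.
    by rewrite sumr_const card_ord.
  rewrite -big_split/= mulr_suml; apply: ler_sum => j _.
  rewrite -[a j ^+ 2]real_normK ?num_real//.
  have := sqr_ge0 (`|a j| - 1); rewrite sqrrB1; lra.
have : h * (\sum_(j < n) `|a j|) <= h * ((N%:R + \sum_(j < N) a j ^+ 2) / 2).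
  by rewrite ler_pM2l//; exact: le_trans H2.
move/le_trans; apply; rewrite mulrA ler_pM2r// mulrDr hN; lra.
Qed.

Variables (a : nat -> R) (A2 W2 : R).
Hypothesis HA : h * (\sum_(j < N) a j ^+ 2) <= A2.
Hypothesis HW :
  h * (\sum_(i < N) (\sum_(j < N) second_diff N h i j * a j) ^+ 2) <= W2.

Let p (i : nat) : R := (a i.+1 - a i) / h.

Let p_var i k : (i.+1 < N)%N -> (k.+1 < N)%N -> p i - p k <= (L + W2) / 2.
Proof.
move=> iN kN.
pose w i := \sum_(j < N) second_diff N h i j * a j.
have pw l : (l.+2 < N)%N -> p l.+1 - p l = h * w l.
  move=> lN; rewrite /w sum_second_diff lN /p; field; exact: lt0r_neq0.
have tele l q : (l <= q)%N -> (q.+1 < N)%N -> p q - p l = h * \sum_(l <= r < q) w r.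
  move=> lq qN; rewrite -(telescope_sumr p lq) mulr_sumr.
  apply: eq_big_nat => r /andP[_ rq].
  by rewrite pw//; apply: leq_ltn_trans qN; rewrite ltnS.
have bnd l q : (l <= q)%N -> (q.+1 < N)%N -> `|p q - p l| <= (L + W2) / 2.
  move=> lq qN; rewrite tele// normrM (gtr0_norm h0).
  have qN' : (q <= N)%N by rewrite ltnW// ltnW.
  apply: le_trans (@grid_sum_abs q w W2 qN' HW).
  rewrite ler_pM2l//; apply: (le_trans (ler_norm_sum _ _ _)).
  rewrite -(big_mkord xpredT (fun i => `|w i|)) (@big_cat_nat _ _ _ l 0 q)//= lerDr.
  exact: sumr_ge0.
have [ik|ki] := leqP i k.
  have := bnd i k ik kN; rewrite distrC; exact: le_trans (ler_norm _).
by have := bnd k i (ltnW ki) iN; exact: le_trans (ler_norm _).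
Qed.

Let p_ub i : (i.+1 < N)%N -> p i <= grid_slope A2 W2.
Proof.
move=> iN; set Wc := (L + W2) / 2.
have step k : (k.+1 < N)%N -> h * (p i - Wc) <= a k.+1 - a k.
  move=> kN; have := p_var iN kN; rewrite -/Wc => H.
  have -> : a k.+1 - a k = h * p k by rewrite /p mulrC divfK// gt_eqF.
  by rewrite ler_pM2l//; lra.
have steps j q : (j + q < N)%N -> q%:R * (h * (p i - Wc)) <= a (j + q)%N - a j.
  elim: q => [|q IH] H; first by rewrite mul0r addn0 subrr.
  have := step (j + q)%N; rewrite addnS in H * => /(_ H) h1.
  have := IH (ltnW H); rewrite -natr1 mulrDl mul1r; lra.
have S1 : \sum_(j < m) (m%:R * (h * (p i - Wc))) <= \sum_(j < m) (a (j + m)%N - a j).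
  by apply: ler_sum => j _; apply: steps; rewrite ltn_add2r.
have S2 : \sum_(j < m) (a (j + m)%N - a j) <= \sum_(j < N) `|a j|.
  rewrite /N big_split_ord/= addrC -big_split/=; apply: ler_sum => j _.
  by rewrite addnC; apply: (le_trans (ler_norm _)); exact: ler_normB.
have S3 := grid_sum_abs (leqnn N) HA.
have hm : h * m%:R = L / 2 by rewrite -hN /N natrD; field.
have {S1} : (h * m%:R) * (m%:R * (h * (p i - Wc))) <= (L + A2) / 2.
  rewrite -mulrA; apply: le_trans S3; rewrite ler_pM2l//.
  apply: le_trans S2; apply: le_trans S1.
  by rewrite sumr_const card_ord -[X in _ <= X]mulr_natl.
rewrite (_ : m%:R * (h * (p i - Wc)) = h * m%:R * (p i - Wc)); last ring.
rewrite hm mulrA => H; rewrite /grid_slope -/Wc -lerBlDl.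
have L2 : 0 < L ^+ 2 by rewrite exprn_gt0.
rewrite ler_pdivlMr//; move: H; rewrite expr2; nra.
Qed.

Let lip_ub i q : (i + q < N)%N -> a (i + q)%N - a i <= grid_slope A2 W2 * (h * q%:R).
Proof.
elim: q => [|q IH] H; first by rewrite addn0 subrr mulr0 mulr0.
rewrite addnS in H *.
have := p_ub H; rewrite /p ler_pdivrMr// => h1.
have := IH (ltnW H); rewrite -natr1 mulrDr mulrDr mulr1; lra.
Qed.

Lemma grid_incr_le i j : (i <= j < N)%N ->
  a j - a i <= grid_slope A2 W2 * (h * `|i%:R - j%:R|).
Proof.
move=> /andP[ij jN]; have := @lip_ub i (j - i); rewrite subnKC// => /(_ jN).
by rewrite natrB// distrC ger0_norm// subr_ge0 ler_nat.
Qed.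

End grid_bounds.

Section grid_bounds_sym.
Variables (m : nat) (L h : R).
Hypotheses (m0 : (0 < m)%N) (L0 : 0 < L).
Let N := (m + m)%N.
Hypothesis hN : h * N%:R = L.
Variables (a : nat -> R) (A2 W2 : R).
Hypothesis HA : h * (\sum_(j < N) a j ^+ 2) <= A2.
Hypothesis HW :
  h * (\sum_(i < N) (\sum_(j < N) second_diff N h i j * a j) ^+ 2) <= W2.
Let h0 : 0 < h := grid_h_gt0 m0 L0 hN.

Lemma grid_lipschitz i j : (i < N)%N -> (j < N)%N ->
  `|a i - a j| <= grid_slope L A2 W2 * (h * `|i%:R - j%:R|).
Proof.
move=> iN jN; wlog ij : i j iN jN / (i <= j)%N => [H|].
  have [/H|/ltnW/H] := leqP i j; first exact.
  by rewrite distrC [`|j%:R - _|]distrC; apply.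
have H1 := @grid_incr_le m L h m0 L0 hN a A2 W2 HA HW i j.
have := @grid_incr_le m L h m0 L0 hN (fun j => - a j) A2 W2 _ _ i j.
rewrite ij jN /= in H1 * => H2.
have {}H1 := H1 isT; rewrite ler_norml; apply/andP; split; first lra.
have : - a j - - a i <= grid_slope L A2 W2 * (h * `|i%:R - j%:R|).
  apply: H2 => //.
    by under eq_bigr do rewrite sqrrN.
  under eq_bigr do rewrite (eq_bigr _ (fun j _ => mulrN _ _)) sumrN sqrrN.
  exact: HW.
lra.
Qed.

Lemma grid_slope_ge0 : 0 <= grid_slope L A2 W2.
Proof.
have A0 : 0 <= A2.
  by apply: le_trans HA; apply: mulr_ge0;
  [exact: ltW|apply: sumr_ge0 => ? _; exact: sqr_ge0].
have W0 : 0 <= W2.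
  by apply: le_trans HW; apply: mulr_ge0;
  [exact: ltW|apply: sumr_ge0 => ? _; exact: sqr_ge0].
have LA : 0 <= L + A2 by rewrite addr_ge0// ltW.
have LW : 0 <= L + W2 by rewrite addr_ge0// ltW.
by rewrite /grid_slope addr_ge0 ?divr_ge0 ?mulr_ge0 ?exprn_ge0// ltW.
Qed.

Lemma grid_dist_le i j : (i < N)%N -> (j < N)%N -> h * `|i%:R - j%:R| <= L.
Proof.
move=> iN jN; rewrite -hN ler_pM2l// ler_norml.
have : i%:R <= N%:R :> R by rewrite ler_nat ltnW.
have : j%:R <= N%:R :> R by rewrite ler_nat ltnW.
have : 0 <= i%:R :> R by []. have : 0 <= j%:R :> R by [].
by move=> *; apply/andP; split; lra.
Qed.

Lemma grid_sup_bound i : (i < N)%N -> `|a i| <= grid_sup L A2 W2.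
Proof.
move=> iN; pose P := grid_slope L A2 W2.
have P0 : 0 <= P := grid_slope_ge0.
have H j : (j < N)%N -> `|a i| - P * L <= `|a j|.
  move=> jN; have := grid_lipschitz iN jN; rewrite -/P => h1.
  have h2 : P * (h * `|i%:R - j%:R|) <= P * L by rewrite ler_wpM2l// grid_dist_le.
  have := ler_normD (a i - a j) (a j); rewrite subrK; lra.
have : \sum_(j < N) (`|a i| - P * L) <= \sum_(j < N) `|a j|.
  by apply: ler_sum => j _; exact: H.
rewrite sumr_const card_ord -[X in X <= _]mulr_natl => H1.
have H2 := @grid_sum_abs m L h m0 L0 hN N a A2 (leqnn N) HA.
have : h * (N%:R * (`|a i| - P * L)) <= (L + A2) / 2.
  by apply: le_trans H2; rewrite ler_pM2l.
rewrite mulrA hN => H3; rewrite /grid_sup -/P -lerBlDr (mulrC L P).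
rewrite ler_pdivlMr ?mulr_gt0//.
by rewrite (_ : _ * (2 * L) = 2 * (L * (`|a i| - P * L))); [lra|ring].
Qed.

End grid_bounds_sym.

(* A Lipschitz sequence with a small l2 norm is uniformly small: average over a
   window of k nodes around the given one. *)
Lemma grid_interpolation (N : nat) h (d : nat -> R) (D2 P lam : R) k i :
  0 < h -> 0 < lam -> 0 <= P -> (0 < k <= N)%N -> (i < N)%N ->
  h * (\sum_(j < N) d j ^+ 2) <= D2 ->
  (forall i j, (i < N)%N -> (j < N)%N -> `|d i - d j| <= P * (h * `|i%:R - j%:R|)) ->
  `|d i| <= lam / 2 + D2 / (2 * lam * (h * k%:R)) + P * (h * k%:R).
Proof.
move=> h0 lam0 P0 /andP[k0 kN] iN HD HP.
pose i0 := minn i (N - k).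
have i0N : (i0 + k <= N)%N by rewrite -(subnK kN) leq_add2r geq_minr.
have near_i j : (i0 <= j < i0 + k)%N -> `|i%:R - j%:R| <= k%:R :> R.
  move=> /andP[ij jk]; rewrite ler_norml.
  have [h1 h2] : (j <= i + k)%N /\ (i <= j + k)%N.
    move: ij jk kN iN; rewrite /i0; case: (leqP i (N - k)) => c; lia.
  have : j%:R <= i%:R + k%:R :> R by rewrite -natrD ler_nat.
  have : i%:R <= j%:R + k%:R :> R by rewrite -natrD ler_nat.
  by move=> *; apply/andP; split; lra.
have S1 : \sum_(i0 <= j < i0 + k) (`|d i| - P * (h * k%:R)) <=
    \sum_(i0 <= j < i0 + k) `|d j|.
  apply: ler_sum_nat => j jk; have jN : (j < N)%N.
    by case/andP: jk => _ jk; exact: leq_trans jk i0N.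
  have := HP i j iN jN; have := near_i j jk => h1.
  have : P * (h * `|i%:R - j%:R|) <= P * (h * k%:R).
    by rewrite ler_wpM2l// ler_pM2l.
  have := ler_normD (d i - d j) (d j); rewrite subrK; lra.
have S2 : \sum_(i0 <= j < i0 + k) `|d j| <=
    \sum_(i0 <= j < i0 + k) (lam / 2 + d j ^+ 2 / (2 * lam)).
  apply: ler_sum_nat => j _; rewrite -[d j ^+ 2]real_normK ?num_real//.
  rewrite -subr_ge0 (_ : _ - _ = (`|d j| - lam) ^+ 2 / (2 * lam)); last first.
    by field; rewrite gt_eqF.
  by rewrite divr_ge0 ?sqr_ge0// mulr_ge0// ltW.
have S3 : \sum_(i0 <= j < i0 + k) d j ^+ 2 <= \sum_(j < N) d j ^+ 2.
  rewrite -(big_mkord xpredT (fun j => d j ^+ 2)).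
  rewrite (@big_cat_nat _ _ _ i0 0 N)//=; last exact: leq_trans (leq_addr _ _) i0N.
  rewrite (@big_cat_nat _ _ _ (i0 + k) i0 N)//= ?leq_addr//.
  have q0 s : 0 <= \sum_(j <- s) d j ^+ 2 by apply: sumr_ge0 => j _; exact: sqr_ge0.
  have := q0 (index_iota 0 i0); have := q0 (index_iota (i0 + k) N); lra.
have kR : 0 < k%:R :> R by rewrite ltr0n.
have hk : 0 < h * k%:R by rewrite mulr_gt0.
move: S1; rewrite sumr_const_nat addKn -[X in X <= _]mulr_natl => S1.
move: S2; rewrite [X in _ <= X]big_split/= sumr_const_nat addKn -[X in _ <= X + _]mulr_natl => S2.
have S4 : h * (\sum_(i0 <= j < i0 + k) d j ^+ 2 / (2 * lam)) <= D2 / (2 * lam).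
  rewrite -mulr_suml mulrA ler_pM2r ?invr_gt0 ?mulr_gt0//.
  by apply: le_trans HD; rewrite ler_pM2l.
have : h * (k%:R * (`|d i| - P * (h * k%:R))) <= h * (k%:R * (lam / 2)) + D2 / (2 * lam).
  apply: (@le_trans _ _ (h * (k%:R * (lam / 2) +
      (\sum_(i0 <= j < i0 + k) d j ^+ 2 / (2 * lam))))).
    by rewrite ler_pM2l//; exact: le_trans S1 S2.
  by rewrite mulrDr lerD2l.
rewrite !(mulrA h) => S5; rewrite -lerBlDr.
rewrite -(ler_pM2l hk); apply: (le_trans S5); rewrite mulrDr lerD2l.
by rewrite [leRHS](_ : _ = D2 / (2 * lam))//; field; rewrite ?gt_eqF.
Qed.

Lemma zero_derive_cst (f : R -> R) t :
  (forall s : R, 0 <= s -> is_derive s 1 f 0) -> 0 <= t -> f t = f 0.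
Proof.
move=> H t0; apply/eqP; rewrite eq_le; apply/andP; split.
  have : 0 - f 0 <= 0 - f t; last lra.
  have z (s : R) : 0 <= s -> 0 <= 0 - 0 :> R by rewrite subr0.
  exact: (@nonneg_derive_le R (fun s => 0 - f s) (fun=> 0 - 0) t
    (fun s s0 => deriveB (is_derive_cst 0 s 1) (H s s0)) z t0).
by apply: (@nonneg_derive_le R f (fun=> 0) t H).
Qed.

Lemma l2_time_lipschitz (N : nat) (a b : R -> nat -> R) (B2 s t : R) :
  (forall j, (j < N)%N -> forall r : R, 0 <= r -> is_derive r 1 (fun r => a r j) (b r j)) ->
  (forall r, 0 <= r -> \sum_(j < N) b r j ^+ 2 <= B2) ->
  0 <= s -> s < t ->
  \sum_(j < N) (a t j - a s j) ^+ 2 <= B2 * (t - s) ^+ 2.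
Proof.
move=> dab bB s0 st; pose d j := a t j - a s j.
pose q r := \sum_(j < N) d j * a r j.
have dq (r : R) : 0 <= r -> is_derive r 1 q (\sum_(j < N) d j * b r j).
  move=> r0; apply: (@derive_sum _ _ (fun j r => d j * a r j)
    _ (fun j => d j * b r j)) => j jN.
  by apply: deriveZ; exact: dab.
have [|||c /andP[c0 c1] E] := @mean_value R q (fun r => \sum_(j < N) d j * b r j) s t.
- exact: st.
- by move=> r /andP[sr _]; apply: dq; rewrite (le_trans s0)// ltW.
- apply: continuous_in_subspaceT => r; rewrite inE /= in_itv /= => /andP[sr _].
  by apply: is_derive_continuous (dq r _); exact: le_trans sr.
set D := \sum_(j < N) _.
have ED : D = (\sum_(j < N) d j * b c j) * (t - s).
  by rewrite -E /q -sumrB; apply: eq_bigr => j _; rewrite -mulrBr expr2.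
have H : (\sum_(j < N) d j * b c j) * (t - s) <=
    (D + (t - s) ^+ 2 * \sum_(j < N) b c j ^+ 2) / 2.
  rewrite mulr_sumr -big_split/= !mulr_suml; apply: ler_sum => j _.
  have := sqr_ge0 (d j - (t - s) * b c j).
  rewrite /d; nra.
have c00 : 0 <= c by rewrite (le_trans s0)// ltW.
have : (t - s) ^+ 2 * \sum_(j < N) b c j ^+ 2 <= (t - s) ^+ 2 * B2.
  by rewrite ler_wpM2l ?sqr_ge0// bB.
move: H; rewrite -ED; lra.
Qed.

Lemma ftc_from0 (f df : R -> R) (T : R) : 0 < T ->
  (forall t : R, 0 <= t -> is_derive t 1 f (df t)) ->
  {within `[0, T], continuous df} ->
  \int[leb]_(t in `[0, T]) df t = f T - f 0.
Proof.
move=> T0 H c.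
have cf t : 0 <= t -> {for t, continuous f}.
  by move=> t0; exact: is_derive_continuous (H t t0).
rewrite /Rintegral (continuous_FTC2 T0 c (F := f))//.
- split; first by move=> t; rewrite in_itv/= => /andP[/ltW t0 _]; have [] := H t t0.
  + by apply: cvg_at_right_filter; exact: cf.
  + by apply: cvg_at_left_filter; apply: cf; exact: ltW.
- move=> t; rewrite in_itv/= => /andP[/ltW t0 _].
  exact: is_derive_val (H t t0).
Qed.

End finite_differences.

Section scheme.
Variable R : realType.
Local Notation leb := (@lebesgue_measure R).
Variables (N : nat) (h rho mu : R) (g G : R -> R) (Kg : R).
Hypotheses (rho0 : 0 < rho) (mu0 : 0 < mu).
Hypothesis gK : forall x y, `|g x - g y| <= Kg * `|x - y|.
Hypothesis dG : forall x : R, is_derive x 1 G (g x).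

Let D := second_diff N h.

Definition bending (a : nat -> R) (i : nat) : R :=
  \sum_(k < N) second_diff N h i k * a k.

Definition scheme_force (a : nat -> R) (j : nat) : R :=
  - ((mu * (\sum_(i < N) bending a i * second_diff N h i j) + g (a j)) / rho).

Definition scheme_solution (a b : R -> nat -> R) : Prop :=
  forall j, (j < N)%N -> forall t : R, 0 <= t ->
    is_derive t 1 (fun s => a s j) (b t j) /\
    is_derive t 1 (fun s => b s j) (scheme_force (a t) j).

Lemma scheme_exists (a0 b0 : nat -> R) : exists a b, scheme_solution a b /\
  forall j, (j < N)%N -> a 0 j = a0 j /\ b 0 j = b0 j.
Proof.
pose F (x : nat -> R) (i : nat) : R :=
  if (i < N)%N then x (N + i)%N else scheme_force x (i - N).
pose S := \sum_(i < N) \sum_(k < N) \sum_(j < N) `|D i k| * `|D i j|.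
have S0 : 0 <= S by do 3![apply: sumr_ge0 => ? _]; rewrite mulr_ge0.
have Kg0 : 0 <= Kg.
  by have := gK 1 0; rewrite subr0 normr1 mulr1; exact: le_trans.
pose K := 1 + (mu * S + Kg) / rho.
have K1 : 0 <= (mu * S + Kg) / rho.
  by rewrite divr_ge0 ?addr_ge0 ?mulr_ge0// ltW.
have K0 : 0 < K by rewrite /K; lra.
have FK (x y : nat -> R) (B : R) :
    (forall j, (j < N + N)%N -> `|x j - y j| <= B) ->
    forall i, (i < N + N)%N -> `|F x i - F y i| <= K * B.
  move=> H i iN; have B0 : 0 <= B by exact: le_trans (H i iN).
  rewrite /F; case: ltnP => iN'.
    apply: (le_trans (H _ _)); first by rewrite ltn_add2l.
    by rewrite ler_peMl// /K; lra.
  set j := (i - N)%N; have jN : (j < N)%N by rewrite /j; lia.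
  have xy k : (k < N)%N -> `|x k - y k| <= B.
    by move=> kN; apply: H; apply: leq_trans kN (leq_addr _ _).
  have e1 : scheme_force x j - scheme_force y j =
    - ((mu * (\sum_(i < N) \sum_(k < N) D i k * (x k - y k) * D i j) +
      (g (x j) - g (y j))) / rho).
    rewrite /scheme_force -opprB opprK addrC -mulrBl; congr (- (_ / _)).
    rewrite opprD addrACA -mulrBr -sumrB; congr (mu * _ + _).
    apply: eq_bigr => l _; rewrite -mulrBl -sumrB mulr_suml.
    by apply: eq_bigr => k _; rewrite -mulrBr.
  rewrite e1 normrN normrM normfV (gtr0_norm rho0) ler_pdivrMr//.
  apply: (le_trans (ler_normD _ _)); rewrite normrM (gtr0_norm mu0).
  have h1 : `|\sum_(i < N) \sum_(k < N) D i k * (x k - y k) * D i j| <= S * B.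
    apply: (le_trans (ler_norm_sum _ _ _)); rewrite mulr_suml.
    apply: ler_sum => l _; apply: (le_trans (ler_norm_sum _ _ _)).
    rewrite mulr_suml; apply: ler_sum => k _; rewrite !normrM mulrAC.
    apply: ler_pM => //; last exact: xy.
    rewrite (bigD1 (Ordinal jN))//= lerDl; apply: sumr_ge0 => i' _.
    exact: mulr_ge0.
  have h2 : `|g (x j) - g (y j)| <= Kg * B.
    by apply: (le_trans (gK _ _)); rewrite ler_wpM2l// xy.
  have : mu * `|\sum_(i < N) \sum_(k < N) D i k * (x k - y k) * D i j| <= mu * (S * B).
    by rewrite ler_pM2l.
  have -> : K * B * rho = B * rho + mu * (S * B) + Kg * B.
    by rewrite /K; field; exact: lt0r_neq0.
  have : 0 <= B * rho by rewrite mulr_ge0// ltW.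
  lra.
have [X HX] := @picard R (N + N) F K
  (fun i => if (i < N)%N then a0 i else b0 (i - N)%N) K0 FK.
exists (fun t j => X t j), (fun t j => X t (N + j)%N); split => j jN; last first.
  have [|-> _] := HX j; first exact: leq_trans jN (leq_addr _ _).
  have [|-> _] := HX (N + j)%N; first by rewrite ltn_add2l.
  by rewrite jN ltnNge leq_addr/= addKn.
move=> t t0; split.
  have [|_ /(_ t t0)] := HX j; first exact: leq_trans jN (leq_addr _ _).
  by rewrite /F jN.
have [|_ /(_ t t0)] := HX (N + j)%N; first by rewrite ltn_add2l.
by rewrite /F ltnNge leq_addr/= addKn.
Qed.

Variables (a b : R -> nat -> R).
Hypothesis ab : scheme_solution a b.

Definition scheme_energy (t : R) : R :=
  \sum_(j < N) (rho * b t j ^+ 2 / 2 + G (a t j)) +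
  \sum_(i < N) mu * bending (a t) i ^+ 2 / 2.

Let da j : (j < N)%N -> forall t : R, 0 <= t -> is_derive t 1 (fun s => a s j) (b t j).
Proof. by move=> jN t t0; have [] := ab jN t0. Qed.

Let db j : (j < N)%N -> forall t : R, 0 <= t ->
  is_derive t 1 (fun s => b s j) (scheme_force (a t) j).
Proof. by move=> jN t t0; have [] := ab jN t0. Qed.

Lemma bending_derive i (t : R) : 0 <= t ->
  is_derive t 1 (fun s => bending (a s) i) (bending (b t) i).
Proof.
move=> t0; apply: (@derive_sum _ _ (fun k s => second_diff N h i k * a s k) _
  (fun k => second_diff N h i k * b t k)) => k kN.
exact/deriveZ/da.
Qed.

Let deriveX2 (f : R -> R) df (t c : R) : is_derive t 1 f df ->
  is_derive t 1 (fun s => c * f s ^+ 2 / 2) (c * f t * df).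
Proof.
move=> H; rewrite (_ : (fun s => _) = (fun s => c / 2 * (f s * f s))).
  by apply: (is_derive_eq (deriveZ _ (deriveM H H))); field.
by apply/funext => s; ring.
Qed.

Lemma bending_sum_by_parts (x y : nat -> R) :
  \sum_(j < N) (\sum_(i < N) bending x i * second_diff N h i j) * y j =
  \sum_(i < N) bending x i * bending y i.
Proof.
under eq_bigr do rewrite mulr_suml.
rewrite exchange_big/=; apply: eq_bigr => i _.
by rewrite /bending mulr_sumr; apply: eq_bigr => j _; rewrite mulrA.
Qed.

Lemma scheme_energy_cst t : 0 <= t -> scheme_energy t = scheme_energy 0.
Proof.
apply: zero_derive_cst => s s0.
have H1 := @derive_sum R N (fun j s => rho * b s j ^+ 2 / 2 + G (a s j)) s
  (fun j => rho * b s j * scheme_force (a s) j + g (a s j) * b s j).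
have H2 := @derive_sum R N (fun i s => mu * bending (a s) i ^+ 2 / 2) s
  (fun i => mu * bending (a s) i * bending (b s) i).
apply: (is_derive_eq (deriveD (H1 _) (H2 _))) => {H1 H2}.
- move=> j jN; apply: deriveD; first by apply: deriveX2; exact: db.
  exact: (@is_derive1_comp _ G (fun s => a s j) s _ _ (dG _) (da jN s0)).
- by move=> i _; apply: deriveX2; exact: bending_derive.
under [X in _ + X]eq_bigr do rewrite -mulrA.
rewrite -mulr_sumr -bending_sum_by_parts mulr_sumr -big_split/=.
apply: big1 => j _; rewrite /scheme_force; field; exact: lt0r_neq0.
Qed.

Lemma scheme_continuous j t : (j < N)%N -> 0 <= t ->
  {for t, continuous (fun s => a s j)} /\ {for t, continuous (fun s => b s j)}.
Proof.
move=> jN t0; split; apply: is_derive_continuous; first exact: da.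
exact: db.
Qed.

Lemma continuous_sum_at n (f : nat -> R -> R) t :
  (forall j, (j < n)%N -> {for t, continuous (f j)}) ->
  {for t, continuous (fun s => \sum_(j < n) f j s)}.
Proof.
elim: n => [|n IH] H.
  rewrite (_ : (fun s => _) = (fun=> 0)); first exact: cvg_cst.
  by apply/funext => s; rewrite big_ord0.
rewrite (_ : (fun s => _) = (fun s => \sum_(j < n) f j s + f n s)).
  by apply: continuousD; [apply: IH => j jn; apply: H; exact: ltnW|exact: H].
by apply/funext => s; rewrite big_ord_recr.
Qed.

Lemma lipschitz_continuous : continuous g.
Proof.
have Kg0 : 0 <= Kg.
  by have := gK 1 0; rewrite subr0 normr1 mulr1; exact: le_trans.
move=> x; apply/cvgrPdist_le => e e0.
have d0 : 0 < e / (Kg + 1) by rewrite divr_gt0// ltr_wpDl.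
apply/nbhs_ballP; exists (e / (Kg + 1)) => //= y; rewrite /ball/= => /ltW xy.
apply: (le_trans (gK _ _)); move: xy; rewrite ler_pdivlMr ?ltr_wpDl//.
by have := normr_ge0 (x - y); nra.
Qed.

Section weak_identities.
Variables (T : R) (psi psi1 psi2 : R -> nat -> R).
Hypothesis T0 : 0 < T.
Hypothesis dpsi : forall j (t : R), is_derive t 1 (fun s => psi s j) (psi1 t j).

Lemma scheme_velocity_identity : (forall j, continuous (fun s => psi1 s j)) ->
  (forall j, psi 0 j = 0) -> (forall j, psi T j = 0) ->
  \int[leb]_(t in `[0, T]) (\sum_(j < N) (a t j * psi1 t j + b t j * psi t j)) = 0.
Proof.
move=> c1 p0 pT.
pose q t := \sum_(j < N) a t j * psi t j.
have dq (t : R) : 0 <= t ->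
    is_derive t 1 q (\sum_(j < N) (a t j * psi1 t j + b t j * psi t j)).
  move=> t0; apply: (@derive_sum _ _ (fun j s => a s j * psi s j) _
    (fun j => a t j * psi1 t j + b t j * psi t j)) => j jN.
  by apply: deriveM => //; exact: da.
rewrite (ftc_from0 T0 dq).
  by rewrite /q !big1 ?subrr// => j _; rewrite ?p0 ?pT mulr0.
apply: continuous_in_subspaceT => t; rewrite inE /= in_itv /= => /andP[t0 _].
apply: (@continuous_sum_at _ (fun j t => a t j * psi1 t j + b t j * psi t j)).
move=> j jN; have [ca cb] := scheme_continuous jN t0.
apply: continuousD; apply: continuousM => //; first exact: c1.
exact: is_derive_continuous (dpsi j t).
Qed.

Hypothesis dpsi1 : forall j (t : R), is_derive t 1 (fun s => psi1 s j) (psi2 t j).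

Lemma scheme_weak_identity : (forall j, continuous (fun s => psi2 s j)) ->
  (forall j, psi T j = 0) -> (forall j, psi1 T j = 0) ->
  \int[leb]_(t in `[0, T]) (\sum_(j < N) (rho * a t j * psi2 t j +
      mu * bending (a t) j * bending (psi t) j + g (a t j) * psi t j)) -
  rho * (\sum_(j < N) b 0 j * psi 0 j) +
  rho * (\sum_(j < N) a 0 j * psi1 0 j) = 0.
Proof.
move=> c2 p0 p1.
pose dF t := \sum_(j < N) rho *
  (a t j * psi2 t j + b t j * psi1 t j -
   (b t j * psi1 t j + scheme_force (a t) j * psi t j)).
have dFE t : \sum_(j < N) (rho * a t j * psi2 t j +
      mu * bending (a t) j * bending (psi t) j + g (a t j) * psi t j) = dF t.
  transitivity (\sum_(j < N) (rho * a t j * psi2 t j + g (a t j) * psi t j) +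
      mu * \sum_(i < N) bending (a t) i * bending (psi t) i).
    by rewrite mulr_sumr -big_split/=; apply: eq_bigr => j _; ring.
  rewrite -bending_sum_by_parts mulr_sumr -big_split/=.
  apply: eq_bigr => j _; rewrite /scheme_force; field; exact: lt0r_neq0.
have -> : \int[leb]_(t in `[0, T]) (\sum_(j < N) (rho * a t j * psi2 t j +
      mu * bending (a t) j * bending (psi t) j + g (a t j) * psi t j)) =
    \int[leb]_(t in `[0, T]) dF t by apply: eq_Rintegral => t _; exact: dFE.
pose q t := \sum_(j < N) rho * (a t j * psi1 t j - b t j * psi t j).
have dq (t : R) : 0 <= t -> is_derive t 1 q (dF t).
  move=> t0; apply: (@derive_sum _ _
    (fun j s => rho * (a s j * psi1 s j - b s j * psi s j)) _
    (fun j => rho * (a t j * psi2 t j + b t j * psi1 t j -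
      (b t j * psi1 t j + scheme_force (a t) j * psi t j)))) => j jN.
  apply: deriveZ; apply: deriveB; apply: deriveM => //; first exact: da.
  exact: db.
rewrite (ftc_from0 T0 dq).
  rewrite /q [X in X - _ - _]big1; last by move=> j _; rewrite p0 p1 !mulr0 subrr mulr0.
  by rewrite sub0r -mulr_sumr sumrB; ring.
apply: continuous_in_subspaceT => t; rewrite inE /= in_itv /= => /andP[t0 _].
rewrite (_ : dF = fun t => \sum_(j < N) (rho * a t j * psi2 t j +
    mu * bending (a t) j * bending (psi t) j + g (a t j) * psi t j)); last first.
  by apply/funext => s; rewrite dFE.
apply: (@continuous_sum_at _ (fun j t => rho * a t j * psi2 t j +
    mu * bending (a t) j * bending (psi t) j + g (a t j) * psi t j)) => j jN.
have [ca cb] := scheme_continuous jN t0.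
have cp : {for t, continuous (fun s => psi s j)}.
  exact: is_derive_continuous (dpsi j t).
apply: continuousD; first apply: continuousD.
+ apply: continuousM; last exact: c2.
  by apply: continuousM => //; exact: cvg_cst.
+ apply: continuousM; first apply: continuousM; first exact: cvg_cst.
    exact: is_derive_continuous (bending_derive j t0).
  apply: (@continuous_sum_at _ (fun k s => second_diff N h j k * psi s k)) => k kN.
  apply: continuousM; first exact: cvg_cst.
  exact: is_derive_continuous (dpsi k t).
+ apply: continuousM => //; apply: continuous_comp => //.
  exact: lipschitz_continuous.
Qed.

End weak_identities.
End scheme.

Section convex_hull.
Variables (T : Type) (R : realType).

Inductive hull (S : set (nat -> T -> R)) : set (nat -> T -> R) :=
| hull_base x : S x -> hull S x
| hull_mix a b x y : 0 <= a -> 0 <= b -> a + b = 1 -> hull S x -> hull S y ->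
    hull S (fun i z => a * x i z + b * y i z).

Lemma hull_sub (S S' : set (nat -> T -> R)) : S `<=` S' -> hull S `<=` hull S'.
Proof.
move=> SS x; elim => [{}x /SS|a b {}x y a0 b0 ab _ hx _ hy]; first exact: hull_base.
exact: hull_mix.
Qed.

Definition tail (y : nat -> nat -> T -> R) (m : nat) : set (nat -> T -> R) :=
  [set y k | k in [set k | (m <= k)%N]].

Lemma hull_tail_sub (y : nat -> nat -> T -> R) m m' : (m <= m')%N -> hull (tail y m') `<=` hull (tail y m).
Proof.
move=> mm; apply: hull_sub => _ [k /= mk <-]; exists k => //=.
exact: leq_trans mk.
Qed.

End convex_hull.

Section convex_compactness.
Context d (T : measurableType d) (R : realType).
Variable mu : {measure set T -> \bar R}.
Implicit Types (f g : T -> R) (x y : nat -> T -> R).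

Lemma measurable_EFin_fun (D : set T) f :
  measurable_fun D f -> measurable_fun D (fun z => (f z)%:E).
Proof. by move=> mf; apply/measurable_EFinP. Qed.

Definition sqint f :=
  measurable_fun setT f /\ mu.-integrable setT (fun z => (f z ^+ 2)%:E).

Definition nrm2 f : R := \int[mu]_z (f z ^+ 2).

Lemma sqint_bound f C : measurable_fun setT f ->
  (\int[mu]_z (f z ^+ 2)%:E <= C%:E)%E -> sqint f /\ nrm2 f <= C.
Proof.
move=> mf H.
have i2 : mu.-integrable setT (fun z => (f z ^+ 2)%:E).
  apply/integrableP; split; first by apply: measurable_EFin_fun; exact: measurable_funX.
  apply: le_lt_trans (ltry C); apply: le_trans H.
  apply: ge0_le_integral => //; last by move=> z _; rewrite gee0_abs// lee_fin sqr_ge0.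
  - by apply: measurableT_comp => //; apply: measurable_EFin_fun; exact: measurable_funX.
  - by apply: measurable_EFin_fun; exact: measurable_funX.
split => //; rewrite /nrm2 /Rintegral.
by rewrite -lee_fin fineK// integrable_fin_num.
Qed.

Lemma sqint_mul f g : sqint f -> sqint g ->
  mu.-integrable setT (fun z => (f z * g z)%:E).
Proof.
move=> [mf f2] [mg g2]; have := integrableD measurableT f2 g2.
apply: le_integrable => //.
  by apply: measurable_EFin_fun; exact: measurable_funM.
move=> z _ /=; rewrite lee_fin normrM.
rewrite [leRHS]ger0_norm ?addr_ge0 ?sqr_ge0//.
rewrite -[f z ^+ 2]real_normK ?num_real// -[g z ^+ 2]real_normK ?num_real//.
by have := sqr_ge0 (`|f z| - `|g z|); have := sqr_ge0 (`|f z| + `|g z|); nra.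
Qed.

Lemma sqint_comb a b f g : sqint f -> sqint g ->
  sqint (fun z => a * f z + b * g z).
Proof.
move=> hf hg; have [mf f2] := hf; have [mg g2] := hg; split.
  by apply: measurable_funD; apply: measurable_funM.
have i1 := integrableZl measurableT (a ^+ 2) f2.
have i2 := integrableZl measurableT (b ^+ 2) g2.
have i3 := integrableZl measurableT (2 * a * b) (sqint_mul hf hg).
have := integrableD measurableT i3 (integrableD measurableT i1 i2).
apply: eq_integrable => // z _ /=; rewrite -!EFinM -!EFinD; congr EFin; ring.
Qed.

Lemma nrm2_comb a b f g : sqint f -> sqint g ->
  nrm2 (fun z => a * f z + b * g z) =
  a ^+ 2 * nrm2 f + 2 * a * b * (\int[mu]_z (f z * g z)) + b ^+ 2 * nrm2 g.
Proof.
move=> hf hg; have [mf f2] := hf; have [mg g2] := hg.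
have i3 := sqint_mul hf hg.
rewrite /nrm2 -!RintegralZl// -RintegralD//; last 2 first.
- by have := integrableZl measurableT (a ^+ 2) f2; apply: eq_integrable.
- by have := integrableZl measurableT (2 * a * b) i3; apply: eq_integrable.
rewrite -RintegralD//.
- by apply: eq_Rintegral => z _; ring.
- have j1 := integrableZl measurableT (a ^+ 2) f2.
  have j3 := integrableZl measurableT (2 * a * b) i3.
  by have := integrableD measurableT j1 j3; apply: eq_integrable.
- by have := integrableZl measurableT (b ^+ 2) g2; apply: eq_integrable.
Qed.

Lemma nrm2_ge0 f : 0 <= nrm2 f.
Proof. by apply: Rintegral_ge0 => z _; exact: sqr_ge0. Qed.

Definition state_nrm2 (p : nat) (x : nat -> T -> R) : R := \sum_(i < p) nrm2 (x i).

Section mazur.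
Variables (p : nat) (y : nat -> nat -> T -> R) (C : R).
Hypothesis sy : forall k i, (i < p)%N -> sqint (y k i).
Hypothesis yC : forall k, state_nrm2 p (y k) <= C.

Lemma hull_sqint m x : hull (tail y m) x -> forall i, (i < p)%N -> sqint (x i).
Proof.
elim => [_ [k _ <-] i|a b {}x x' _ _ _ _ hx _ hx' i ip]; first exact: sy.
by apply: sqint_comb; [exact: hx|exact: hx'].
Qed.

Let Q := state_nrm2 p.

Let Q_ge0 x : 0 <= Q x.
Proof. by apply: sumr_ge0 => i _; exact: nrm2_ge0. Qed.

Let parallelogram x x' : (forall i, (i < p)%N -> sqint (x i)) ->
  (forall i, (i < p)%N -> sqint (x' i)) ->
  Q (fun i z => x i z - x' i z) =
  2 * Q x + 2 * Q x' - 4 * Q (fun i z => 2^-1 * x i z + 2^-1 * x' i z).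
Proof.
move=> hx hx'; rewrite /Q /state_nrm2 !mulr_sumr -big_split -sumrB.
apply: eq_bigr => i _ /=.
rewrite (_ : (fun z => x i z - x' i z) = (fun z => 1 * x i z + (-1) * x' i z)).
  rewrite !nrm2_comb; [by field|exact: hx|exact: hx'|exact: hx|exact: hx'].
by apply/funext => z; rewrite mul1r mulN1r.
Qed.

Let dist m := inf [set Q x | x in hull (tail y m)].

Let dist_inf m : has_inf [set Q x | x in hull (tail y m)].
Proof.
split; last by exists 0 => _ [x _ <-].
by exists (Q (y m)), (y m) => //; apply: hull_base; exists m => /=.
Qed.

Let dist_le m x : hull (tail y m) x -> dist m <= Q x.
Proof. by move=> hx; apply: ge_inf; [have [] := dist_inf m|exists x]. Qed.

Let dist_mono m m' : (m <= m')%N -> dist m <= dist m'.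
Proof.
move=> mm; apply: lb_le_inf; first exact: (dist_inf m').1.
by move=> _ [x hx <-]; apply: dist_le; exact: hull_tail_sub hx.
Qed.

Lemma mazur (e : nat -> R) : (forall m, 0 < e m) ->
  exists g : nat -> nat -> T -> R, (forall m, hull (tail y m) (g m)) /\
  forall m m', (m <= m')%N -> state_nrm2 p (fun i z => g m i z - g m' i z) <= e m.
Proof.
move=> e0.
have [g0 Hg0] : exists g0 : nat -> nat -> T -> R, forall m,
    hull (tail y m) (g0 m) /\ Q (g0 m) <= dist m + m.+1%:R^-1.
  suff H m : exists x, hull (tail y m) x /\ Q x <= dist m + m.+1%:R^-1.
    by have [f Hf] := choice H; exists f.
  have m0 : 0 < m.+1%:R^-1 :> R by rewrite invr_gt0.
  have [_ [x hx <-] xd] := inf_adherent m0 (dist_inf m).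
  by exists x; split => //; exact: ltW.
pose S := range dist.
have hS : has_sup S.
  split; first by exists (dist 0%N), 0%N.
  exists C => _ [m _ <-]; apply: le_trans (yC m).
  by apply: dist_le; apply: hull_base; exists m => /=.
have H m m' : (m <= m')%N -> Q (fun i z => g0 m i z - g0 m' i z) <=
    2 * (sup S - dist m) + 4 * m.+1%:R^-1.
  move=> mm; have [h1 q1] := Hg0 m; have [h2 q2] := Hg0 m'.
  have h3 := hull_tail_sub mm h2.
  rewrite parallelogram; [|exact: hull_sqint h1|exact: hull_sqint h2].
  have : dist m <= Q (fun i z => 2^-1 * g0 m i z + 2^-1 * g0 m' i z).
    by apply/dist_le/hull_mix => //; field.
  have : dist m' <= sup S by apply: ub_le_sup; [exact: hS.2|exists m'].
  have : m'.+1%:R^-1 <= m.+1%:R^-1 :> R by rewrite lef_pV2 ?posrE// ler_nat.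
  move: q1 q2; set c := m.+1%:R^-1; set c' := m'.+1%:R^-1.
  rewrite -/c; lra.
have [M HM] : exists M : nat -> nat, forall k m m', (M k <= m)%N -> (m <= m')%N ->
    Q (fun i z => g0 m i z - g0 m' i z) <= e k.
  suff HM k : exists M : nat, forall m m', (M <= m)%N -> (m <= m')%N ->
      Q (fun i z => g0 m i z - g0 m' i z) <= e k.
    by have [f Hf] := choice HM; exists f.
  have e4 : 0 < e k / 4 by rewrite divr_gt0.
  have [_ [M1 _ <-] HM1] := sup_adherent e4 hS.
  pose M2 := Num.truncn (8 / e k).
  exists (maxn M1 M2) => m m'; rewrite geq_max => /andP[m1 m2] mm.
  apply: (le_trans (H m m' mm)).
  have d1 : dist M1 <= dist m by exact: dist_mono.
  have d2 : 4 * m.+1%:R^-1 <= e k / 2.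
    rewrite ler_pdivrMr// mulrC.
    have : 8 / e k <= m.+1%:R.
      by apply/ltW; apply: (lt_le_trans (truncnS_gt _)); rewrite ler_nat ltnS.
    rewrite ler_pdivrMr//; lra.
  move: d2; set c := m.+1%:R^-1; lra.
pose s k := maxn k (\max_(i < k.+1) M i).
have sM k : (M k <= s k)%N.
  by rewrite leq_max; apply/orP; right; rewrite (leq_bigmax (@ord_max k)).
have s_mono k k' : (k <= k')%N -> (s k <= s k')%N.
  move=> kk; rewrite /s geq_max !leq_max kk/=.
  apply/orP; right; apply/bigmax_leqP => i _.
  have ik : (i < k'.+1)%N by exact: leq_trans (ltn_ord i) _.
  exact: (@leq_bigmax _ (fun i : 'I_k'.+1 => M i) (Ordinal ik)).
exists (fun m => g0 (s m)); split => [m|m m' mm].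
  by apply: hull_tail_sub (Hg0 _).1; rewrite leq_max leqnn.
by apply: HM; [exact: sM|exact: s_mono].
Qed.

End mazur.

Lemma riesz_fischer (g : nat -> T -> R) :
  (forall n, measurable_fun setT (g n)) ->
  (forall n, \int[mu]_z ((g n.+1 z - g n z) ^+ 2)%:E <=
     (1 / (2 ^ n.+1)%:R / 4 ^+ n)%:E)%E ->
  exists (G : T -> R) (A : set T), [/\ measurable_fun setT G, measurable A,
    mu (~` A) = 0%E & forall z, A z -> g n z @[n --> \oo] --> G z].
Proof.
move=> mg fast.
pose f n z := (4 ^+ n * (g n.+1 z - g n z) ^+ 2)%:E.
have mf n : measurable_fun setT (f n).
  apply: measurable_EFin_fun; apply: measurable_funM; first exact: measurable_cst.
  by apply: measurable_funX; apply: measurable_funB.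
have f0 n z : (0 <= f n z)%E.
  by rewrite lee_fin mulr_ge0 ?sqr_ge0 ?exprn_ge0.
pose S z := (\sum_(n <oo) f n z)%E.
have mS : measurable_fun setT S.
  by apply: ge0_emeasurable_sum => // k z _ _; exact: f0.
have iS : mu.-integrable setT S.
  apply/integrableP; split => //.
  under eq_integral do rewrite gee0_abs ?nneseries_ge0//.
  rewrite integral_nneseries//.
  apply: (@le_lt_trans _ _ (\sum_(n <oo) (1 / (2 ^ n.+1)%:R)%:E)%E); last first.
    by apply: (le_lt_trans (epsilon_trick0 _ _)); rewrite ?ltry.
  apply: lee_nneseries; first by move=> n *; apply: integral_ge0.
  move=> n _; rewrite /f.
  under eq_integral do rewrite EFinM.
  rewrite ge0_integralZl//.
  - have p4 : 0 < 4 ^+ n :> R by rewrite exprn_gt0.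
    apply: (@le_trans _ _ ((4 ^+ n)%:E * (1 / (2 ^ n.+1)%:R / 4 ^+ n)%:E)%E).
      by rewrite lee_pmul2l ?fast.
    by rewrite -EFinM lee_fin mulrC divfK ?gt_eqF.
  - apply: measurable_EFin_fun; apply: measurable_funX.
    exact: measurable_funB.
  - by move=> z zT; rewrite lee_fin sqr_ge0.
pose A := [set z | (S z < +oo)%E].
have mA : measurable A.
  rewrite -[A]setTI; apply: measurable_lte => //; exact: measurable_cst.
have A0 : mu (~` A) = 0%E.
  have [N [mN N0 sN]] := integrable_ae measurableT iS.
  apply: (subset_measure0 _ mN _ N0); first exact: measurableC.
  move=> z /= Az; apply: sN => /= /(_ I) /fin_numPlt/andP[_ h]; exact: Az.
have cA z : A z -> exists l : R, g n z @[n --> \oo] --> l.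
  move=> Az; pose s := fine (S z).
  have s0 : (0 <= S z)%E by exact: nneseries_ge0.
  have sE : S z = s%:E by rewrite fineK// ge0_fin_numE.
  have sge0 : 0 <= s by rewrite -lee_fin -sE.
  have inc k : `|g k.+1 z - g k z| <= Num.sqrt s / 2 ^+ k.
    have : (f k z <= S z)%E.
      apply: le_trans (nneseries_lim_ge k.+1 (fun i _ _ => f0 i z)).
      rewrite big_nat_recr//= leeDr//; apply: sume_ge0 => i _; exact: f0.
    rewrite sE lee_fin => H.
    rewrite ler_pdivlMr ?exprn_gt0// -[leLHS]ger0_norm ?mulr_ge0 ?exprn_ge0//.
    rewrite -sqrtr_sqr ler_sqrt// exprMn real_normK ?num_real// mulrC.
    by rewrite -exprM mulnC exprM (_ : 2 ^+ 2 = 4)//; ring.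
  have [l Hl] := geometric_increments_cvg inc.
  exists l; apply/cvgrPdist_le => e e0.
  have [k0 Hk0] := small_geometric (2 * Num.sqrt s) e0.
  exists k0 => // k /= kk; apply: (le_trans (Hl k)); apply: le_trans Hk0.
  rewrite ler_wpM2l ?mulr_ge0 ?sqrtr_ge0// lef_pV2 ?posrE ?exprn_gt0//.
  by rewrite ler_eXn2l// ltr1n.
pose h n z := g n z * \1_A z.
pose G z := lim (h n z @[n --> \oo]).
have ch z : h n z @[n --> \oo] --> G z.
  have [Az|Az] := pselect (A z).
    have [l Hl] := cA z Az.
    have E : (fun n => h n z) = (fun n => g n z).
      by apply/funext => n; rewrite /h indicE mem_set// mulr1.
    by apply/cvg_ex; exists l; rewrite E.
  have E : (fun n => h n z) = (fun=> 0).
    by apply/funext => n; rewrite /h indicE memNset// mulr0.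
  by apply/cvg_ex; exists 0; rewrite E; exact: cvg_cst.
exists G, A; split => //.
- apply: (measurable_fun_cvg (h := h)) => [n|z _]; last exact: ch.
  by apply: measurable_funM => //; exact: measurable_indic.
- move=> z Az; have := ch z.
  suff -> : (fun n => h n z) = (fun n => g n z) by [].
  by apply/funext => n; rewrite /h indicE mem_set// mulr1.
Qed.

Lemma fatou_bound (F : nat -> T -> R) (G : T -> R) (A : set T) (C : R) :
  (forall n, measurable_fun setT (F n)) -> measurable_fun setT G ->
  (forall n z, 0 <= F n z) -> (forall z, 0 <= G z) ->
  measurable A -> mu (~` A) = 0%E ->
  (forall z, A z -> F n z @[n --> \oo] --> G z) ->
  (\forall n \near \oo, (\int[mu]_z (F n z)%:E <= C%:E)%E) ->
  (\int[mu]_z (G z)%:E <= C%:E)%E.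
Proof.
move=> mF mG F0 G0 mA A0 cA FC.
pose F' n z := F n z * \1_A z; pose G' z := G z * \1_A z.
have F'0 n z : 0 <= F' n z by rewrite mulr_ge0.
have mF' n : measurable_fun setT (F' n).
  by apply: measurable_funM => //; exact: measurable_indic.
have mG' : measurable_fun setT G'.
  by apply: measurable_funM => //; exact: measurable_indic.
have cF' z : (F' n z)%:E @[n --> \oo] --> (G' z)%:E.
  apply/cvg_EFin; first exact: nearW.
  rewrite /F' /G' indicE; have [Az|Az] := pselect (A z).
    by rewrite mem_set// mulr1; under eq_fun do rewrite mulr1; exact: cA.
  by rewrite memNset// mulr0; under eq_fun do rewrite mulr0; exact: cvg_cst.
have -> : (\int[mu]_z (G z)%:E = \int[mu]_z (G' z)%:E)%E.
  apply: ge0_ae_eq_integral => //; [exact: measurable_EFin_fun|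
    exact: measurable_EFin_fun|by move=> z _; rewrite lee_fin|
    by move=> z _; rewrite lee_fin mulr_ge0|].
  exists (~` A); split => //; first exact: measurableC.
  by move=> z /= zA Az; apply: zA => _; rewrite /G' indicE mem_set// mulr1.
rewrite [leLHS](_ : _ = (\int[mu]_z limn_einf (fun n => (F' n z)%:E))%E); last first.
  apply: eq_integral => z _; rewrite is_cvg_limn_einfE.
    by apply/esym/cvg_lim => //; exact: cF'.
  by apply/cvg_ex; exists (G' z)%:E; exact: cF'.
apply: (le_trans (@fatou _ T R mu setT measurableT (fun n z => (F' n z)%:E) _ _)).
- by move=> n; exact: measurable_EFin_fun.
- by move=> n z _; rewrite lee_fin.
case: FC => N _ HN; rewrite limn_einf_lim; apply: lime_le; first exact: is_cvg_einfs.
exists N => // n /= Nn; apply: (@le_trans _ _ (\int[mu]_z (F' n z)%:E)%E).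
  by apply: ereal_inf_lbound; exists n => /=.
apply: le_trans (HN n Nn); apply: ge0_le_integral => //.
- by move=> z _; rewrite lee_fin.
- exact: measurable_EFin_fun.
- exact: measurable_EFin_fun.
- by move=> z _; rewrite lee_fin /F' indicE; case: (_ \in _); rewrite ?mulr1 ?mulr0.
Qed.

Lemma convex_subsequence_cvg (p : nat) (y : nat -> nat -> T -> R) (C : R) :
  (forall k i, (i < p)%N -> sqint (y k i)) ->
  (forall k, state_nrm2 p (y k) <= C) ->
  exists (g : nat -> nat -> T -> R) (G : nat -> T -> R) (A : set T),
    [/\ forall m, hull (tail y m) (g m), measurable A, mu (~` A) = 0%E,
        forall i z, (i < p)%N -> A z -> g n i z @[n --> \oo] --> G i z
      & forall i, (i < p)%N -> [/\ sqint (G i) &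
          forall m, sqint (fun z => g m i z - G i z) /\
            nrm2 (fun z => g m i z - G i z) <= 1 / 2 ^+ m]].
Proof.
move=> sy yC; pose e m : R := 1 / (2 ^ m.+1)%:R / 4 ^+ m.
have e0 m : 0 < e m by rewrite !divr_gt0 ?exprn_gt0// ltr0n expn_gt0.
have [g [hg Hg]] := mazur sy yC e0.
have sg m i : (i < p)%N -> sqint (g m i) by move=> ip; exact: hull_sqint (hg m) _ ip.
have sB f f' : sqint f -> sqint f' -> sqint (fun z => f z - f' z).
  move=> sf sf'; have := sqint_comb 1 (-1) sf sf'; congr sqint.
  by apply/funext => z; rewrite mul1r mulN1r.
have d2 m m' i : (i < p)%N -> (m <= m')%N ->
    (\int[mu]_z ((g m i z - g m' i z) ^+ 2)%:E <= (e m)%:E)%E.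
  move=> ip mm; have [_ s2] := sB _ _ (sg m i ip) (sg m' i ip).
  rewrite -[leLHS]fineK ?integrable_fin_num// lee_fin.
  apply: le_trans (Hg m m' mm); rewrite /state_nrm2 (bigD1 (Ordinal ip))//= lerDl.
  by apply: sumr_ge0 => j _; exact: nrm2_ge0.
have [GA HGA] : exists GA : nat -> (T -> R) * set T, forall i,
    [/\ (i < p)%N -> measurable_fun setT (GA i).1, measurable (GA i).2,
    mu (~` (GA i).2) = 0%E & (i < p)%N ->
      forall z, (GA i).2 z -> g n i z @[n --> \oo] --> (GA i).1 z].
  suff H i : exists GA : (T -> R) * set T,
      [/\ (i < p)%N -> measurable_fun setT GA.1, measurable GA.2,
      mu (~` GA.2) = 0%E & (i < p)%N ->
        forall z, GA.2 z -> g n i z @[n --> \oo] --> GA.1 z].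
    by have [f Hf] := choice H; exists f.
  have [ip|_] := boolP (i < p)%N; last first.
    by exists (fun=> 0, setT); split => //=; rewrite setCT measure0.
  have [||G [A [mG mA A0 cA]]] := @riesz_fischer (fun m => g m i).
  - by move=> m; exact: (sg m i ip).1.
  - move=> m; apply: le_trans (d2 m m.+1 i ip (leqnSn m)).
    by rewrite (_ : (fun z => _) = (fun z => ((g m i z - g m.+1 i z) ^+ 2)%:E))//;
      apply/funext => z; rewrite -[in RHS]sqrrN opprB.
  by exists (G, A).
pose A := \bigcap_i (GA i).2.
have mA : measurable A.
  by apply: bigcap_measurable => [|i _]; [exists 0%N|have [] := HGA i].
exists g, (fun i => (GA i).1), A; split => //.
- apply: measure_negligible; first exact: measurableC.
  rewrite /A setC_bigcap.
  apply: negligible_bigcup => i; have [_ mAi Ai0 _] := HGA i.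
  by exists (~` (GA i).2); split => //; exact: measurableC.
- by move=> i z ip Az; have [_ _ _] := HGA i; apply => //; exact: Az.
- move=> i ip; have [/(_ ip) mG mAi Ai0 /(_ ip) cA] := HGA i.
  have H m : sqint (fun z => g m i z - (GA i).1 z) /\
      nrm2 (fun z => g m i z - (GA i).1 z) <= e m.
    apply: sqint_bound; first by apply: measurable_funB => //; exact: (sg m i ip).1.
    apply: (@fatou_bound (fun n z => (g m i z - g n i z) ^+ 2) _ (GA i).2) => //.
    + move=> n; apply: measurable_funX; apply: measurable_funB.
        exact: (sg m i ip).1.
      exact: (sg n i ip).1.
    + apply: measurable_funX; apply: measurable_funB => //; exact: (sg m i ip).1.
    + by move=> n z; exact: sqr_ge0.
    + by move=> z; exact: sqr_ge0.
    + move=> z Az; apply: cvgM; (apply: cvgB; [exact: cvg_cst|exact: cA]).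
    + by exists m => // n /= mn; exact: d2.
  split.
    have := sB _ _ (sg 0%N i ip) (H 0%N).1; congr sqint.
    by apply/funext => z; rewrite opprB addrC subrK.
  move=> m; split; first exact: (H m).1.
  apply: (le_trans (H m).2); rewrite /e ler_pdivrMr ?exprn_gt0//.
  apply: (@le_trans _ _ (1 / 2 ^+ m)).
    rewrite !div1r lef_pV2 ?posrE ?exprn_gt0// ?ltr0n ?expn_gt0//.
    by rewrite natrX ler_eXn2l ?ltr1n.
  by rewrite ler_peMr ?divr_ge0 ?exprn_ge0// exprn_ege1// ler1n.
Qed.

End convex_compactness.

Section ascoli.
Variable R : realType.
Implicit Types (t x s y T L e delta : R).

Lemma cluster_point_seq (I : eqType) (f : nat -> I -> R) (M : I -> R) :
  (forall n z, `|f n z| <= M z) ->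
  exists u : I -> R, forall (pts : seq I) e (N : nat), 0 < e ->
    exists n, (N <= n)%N /\ forall z, z \in pts -> `|u z - f n z| < e.
Proof.
move=> fM.
pose PT : topologicalType := prod_topology (fun _ : I => R).
pose K (z : I) : set R := `[- M z, M z]%classic.
have cK : compact [set g : PT | forall z, K z (g z)].
  by apply: (@tychonoff I (fun=> R) K) => z; exact: segment_compact.
pose F : set_system PT := (fun n => f n : PT) @ \oo.
have FF : ProperFilter F by exact: fmap_proper_filter.
have FK : F [set g : PT | forall z, K z (g z)].
  exists 0%N => // n _ z; rewrite /K /= in_itv /=.
  by have := fM n z; rewrite ler_norml.
have [u [_ cu]] := cK F FF FK; move: u cu => /= u cu.
exists u => pts e N e0.
have nu : nbhs u [set g : PT | forall z, z \in pts -> `|u z - g z| < e].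
  elim: pts => [|a pts IH]; first by apply: filterS filterT => g _ z.
  have na : nbhs u [set g : PT | `|u a - g a| < e].
    have P : (@proj I (fun=> R) a g @[g --> u] --> u a) := @proj_continuous I (fun=> R) a u.
    have Q := (@cvgrPdist_lt R R PT (nbhs u) _ (fun g => @proj I (fun=> R) a g) (u a)).1 P e e0.
    exact: Q.
  apply: filterS (filterI na IH) => g [ga gp] z.
  by rewrite inE => /predU1P[->|/gp].
have [|g [[n /= Nn <-] gp]] := cu [set g | exists2 n, (N <= n)%N & f n = g] _ _ nu.
  by exists N => // n /= Nn; exists n.
by exists n; split.
Qed.

Definition strip T L : set (R * R) := [set z | (0 <= z.1 <= T) /\ (0 <= z.2 <= L)].

Lemma finite_net T L delta : 0 < delta -> exists pts : seq (R * R),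
  forall z, strip T L z -> exists2 z', z' \in pts &
    strip T L z' /\ `|z.1 - z'.1| <= delta /\ `|z.2 - z'.2| <= delta.
Proof.
move=> d0; pose I1 := Num.truncn (T / delta); pose I2 := Num.truncn (L / delta).
exists [seq (delta * p.1%:R, delta * p.2%:R) |
  p <- [seq (i, j) | i <- iota 0 I1.+1, j <- iota 0 I2.+1]].
have aux t B : 0 <= t <= B -> let i := Num.truncn (t / delta) in
    [/\ (i < (Num.truncn (B / delta)).+1)%N, 0 <= delta * i%:R <= B &
    `|t - delta * i%:R| <= delta].
  move=> /andP[t0 tB] i.
  have td0 : 0 <= t / delta by rewrite divr_ge0// ltW.
  have i1 : i%:R * delta <= t by rewrite -ler_pdivlMr// truncn_le.
  have i2 : t < i.+1%:R * delta by rewrite -ltr_pdivrMr// truncnS_gt.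
  split.
  - by rewrite ltnS; apply: le_truncn; rewrite ler_pM2r ?invr_gt0.
  - apply/andP; split; first by rewrite mulr_ge0// ltW.
    by rewrite mulrC (le_trans i1).
  - move: i2; rewrite -natr1 mulrDl mul1r mulrC => i2.
    by rewrite ger0_norm; lra.
move=> [t x] [/(aux t T)[i1 i2 i3] /(aux x L)[j1 j2 j3]].
exists (delta * (Num.truncn (t / delta))%:R, delta * (Num.truncn (x / delta))%:R).
  apply: (map_f (fun p : nat * nat => (delta * p.1%:R, delta * p.2%:R))
    (x := (Num.truncn (t / delta), Num.truncn (x / delta)))).
  by apply: allpairs_f; rewrite mem_iota.
by [].
Qed.

Definition unif_equicontinuous L (P : (R * R -> R) -> Prop) : Prop :=
  forall T e, 0 < e -> exists2 delta, 0 < delta &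
    forall g, P g -> forall z z', strip T L z -> strip T L z' ->
      `|z.1 - z'.1| <= delta -> `|z.2 - z'.2| <= delta -> `|g z - g z'| <= e.

(* Step functions are not continuous: equicontinuity is only required beyond a
   rank depending on the tolerance. *)
Lemma asymptotic_ascoli L (f : nat -> R * R -> R) (M : R -> R) :
  (forall n z, 0 <= z.1 -> 0 <= z.2 <= L -> `|f n z| <= M z.1) ->
  (forall T e, 0 < e -> exists (delta : R) (N : nat), 0 < delta /\
    forall n, (N <= n)%N -> forall z z', strip T L z -> strip T L z' ->
      `|z.1 - z'.1| <= delta -> `|z.2 - z'.2| <= delta -> `|f n z - f n z'| <= e) ->
  exists (u : R * R -> R) (s : nat -> nat),
    [/\ forall k, (k <= s k)%N,
        unif_equicontinuous L [set u]
      & forall T e, 0 < e -> exists K, forall k, (K <= k)%N -> forall z,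
          strip T L z -> `|f (s k) z - u z| <= e].
Proof.
move=> fM fe.
pose D : set (R * R) := [set z | 0 <= z.1 /\ 0 <= z.2 <= L].
have DT T z : strip T L z -> D z by move=> [/andP[? _] ?]; split.
pose f' n z := if z \in D then f n z else 0.
have f'E n z : D z -> f' n z = f n z by move=> Dz; rewrite /f' mem_set.
have [|u Hu] := @cluster_point_seq (R * R)%type f' (fun z => `|M z.1|).
  move=> n z; rewrite /f'; case: ifPn => [|_]; last by rewrite normr0.
  by rewrite inE => -[z1 z2]; apply: (le_trans (fM n z z1 z2)); exact: ler_norm.
have ue T e : 0 < e -> exists (delta : R) (N : nat), 0 < delta /\
    (forall n, (N <= n)%N -> forall z z', strip T L z -> strip T L z' ->
      `|z.1 - z'.1| <= delta -> `|z.2 - z'.2| <= delta -> `|f n z - f n z'| <= e) /\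
    (forall z z', strip T L z -> strip T L z' ->
      `|z.1 - z'.1| <= delta -> `|z.2 - z'.2| <= delta -> `|u z - u z'| <= 3 * e).
  move=> e0; have [delta [N [d0 H]]] := fe T e e0.
  exists delta, N; split => //; split => // z z' Tz Tz' h1 h2.
  have [n [Nn Hn]] := Hu [:: z; z'] e N e0.
  have := Hn z; rewrite inE eqxx f'E => [/(_ isT) H1|]; last exact: DT Tz.
  have := Hn z'; rewrite !inE eqxx orbT f'E => [/(_ isT) H2|]; last exact: DT Tz'.
  have H3 := H n Nn z z' Tz Tz' h1 h2.
  rewrite (_ : u z - u z' = (u z - f n z) + (f n z - f n z') - (u z' - f n z')); last ring.
  apply: (le_trans (ler_normB _ _)).
  have := ler_normD (u z - f n z) (f n z - f n z'); lra.
have [s Hs] : exists s : nat -> nat, forall k, (k <= s k)%N /\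
    forall z, strip k%:R L z -> `|f (s k) z - u z| <= 5 * k.+1%:R^-1.
  suff H k : exists n, (k <= n)%N /\
      forall z, strip k%:R L z -> `|f n z - u z| <= 5 * k.+1%:R^-1.
    by have [s Hs] := choice H; exists s.
  set e := k.+1%:R^-1; have e0 : 0 < e by rewrite invr_gt0.
  have [delta [N [d0 [He1 He2]]]] := ue k%:R e e0.
  have [pts Hpts] := finite_net k%:R L d0.
  have [n [Nn Hn]] := Hu pts e (maxn N k) e0.
  move: Nn; rewrite geq_max => /andP[Nn kn].
  exists n; split => // z Tz; have [z' z'p [Tz' [h1 h2]]] := Hpts z Tz.
  have := Hn z' z'p; rewrite f'E => [H1|]; last exact: DT Tz'.
  have H2 := He1 n Nn z z' Tz Tz' h1 h2.
  have H3 := He2 z z' Tz Tz' h1 h2.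
  rewrite (_ : f n z - u z = (f n z - f n z') - (u z' - f n z') - (u z - u z')); last ring.
  apply: (le_trans (ler_normB _ _)).
  have := ler_normB (f n z - f n z') (u z' - f n z'); lra.
exists u, s; split.
- by move=> k; exact: (Hs k).1.
- move=> T e e0; have [|delta [N [d0 [_ H]]]] := ue T (e / 3).
    by rewrite divr_gt0.
  exists delta => // _ -> z z' Tz Tz' h1 h2.
  by apply: (le_trans (H z z' Tz Tz' h1 h2)); rewrite mulrC divfK.
- move=> T e e0; exists (maxn (Num.truncn (5 / e)) (Num.truncn T).+1) => k.
  rewrite geq_max => /andP[k1 k2] z [z1 z2].
  have zk : strip k%:R L z.
    split => //; case/andP: z1 => -> zT /=; apply: (le_trans zT).
    apply/ltW/(lt_le_trans (truncnS_gt _)); by rewrite ler_nat.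
  apply: (le_trans ((Hs k).2 z zk)); rewrite ler_pdivrMr//.
  have : 5 / e <= k.+1%:R.
    by apply/ltW/(lt_le_trans (truncnS_gt _)); rewrite ler_nat ltnS.
  by rewrite ler_pdivrMr// mulrC.
Qed.

Lemma unif_equicontinuous_within L u : 0 < L ->
  unif_equicontinuous L [set u] -> {within closed_domain L, continuous u}.
Proof.
move=> L0 H; apply/subspace_continuousP => z [/=].
rewrite !in_itv/= andbT => z1 /andP[z20 z2L].
apply/cvgrPdist_le => e e0.
have [delta d0 Hd] := H (z.1 + 1) e e0.
pose r := Num.min delta 1.
have r0 : 0 < r by rewrite lt_min d0/=.
rewrite near_withinE; apply/nbhs_ballP; exists r => //= z' [/= b1 b2] [/=].
rewrite !in_itv/= andbT => z1' /andP[z20' z2L'].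
have [rd r1] : r <= delta /\ r <= 1 by split; rewrite ge_min lexx ?orbT.
move: b1 b2; rewrite /ball/= => b1 b2.
apply: (Hd u) => //.
- by split; apply/andP; split => //; lra.
- split; apply/andP; split => //.
  by move: b1; rewrite ltr_norml => /andP[]; lra.
- by apply: ltW; exact: lt_le_trans rd.
- by apply: ltW; exact: lt_le_trans rd.
Qed.

End ascoli.

Section smooth_kernel.
Variable R : realType.
Implicit Types (f g : R -> R) (x y a b c : R).

Fixpoint smooth_upto (n : nat) f : Prop :=
  if n is n'.+1 then
    exists2 f', forall x : R, is_derive x 1 f (f' x) & smooth_upto n' f'
  else True.

Lemma smooth_upto_le n f : smooth_upto n.+1 f -> smooth_upto n f.
Proof.
elim: n f => [//|n IH] f [f' df sf']; exists f' => //; exact: IH.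
Qed.

Lemma smooth_uptoZ n f c : smooth_upto n f -> smooth_upto n (fun x => c * f x).
Proof.
elim: n f => [//|n IH] f [f' df sf']; exists (fun x => c * f' x); last exact: IH.
by move=> x; exact: deriveZ.
Qed.

Lemma smooth_uptoD n f g : smooth_upto n f -> smooth_upto n g ->
  smooth_upto n (fun x => f x + g x).
Proof.
elim: n f g => [//|n IH] f g [f' df sf'] [g' dg sg'].
exists (fun x => f' x + g' x); last exact: IH.
by move=> x; exact: deriveD.
Qed.

Lemma smooth_uptoM n f g : smooth_upto n f -> smooth_upto n g ->
  smooth_upto n (fun x => f x * g x).
Proof.
elim: n f g => [//|n IH] f g sf sg.
have [f' df sf'] := sf; have [g' dg sg'] := sg.
exists (fun x => f x * g' x + f' x * g x); first by move=> x; exact: deriveM.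
by apply: smooth_uptoD; apply: IH => //; exact: smooth_upto_le.
Qed.

Lemma smooth_upto_affine n f a b : smooth_upto n f ->
  smooth_upto n (fun x => f (a * x + b)).
Proof.
elim: n f => [//|n IH] f [f' df sf'].
exists (fun x => a * f' (a * x + b)); last by apply: smooth_uptoZ; exact: IH.
by move=> x; rewrite mulrC; exact: derive_affine.
Qed.

Lemma smooth_upto_derivable f : (forall n, smooth_upto n f) ->
  forall n x, derivable (derive1n n f) x 1.
Proof.
move=> sf n x; have := sf n.+1; elim: n f {sf} => [|n IH] f [f' df sf'].
  by have [] := df x.
rewrite /derive1n iterSr -/(derive1n n _) (_ : derive1 f = f'); first exact: IH.
by apply/funext => y; exact: is_derive_val (df y).
Qed.

Lemma deriveXn f x df k : is_derive x 1 f df ->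
  is_derive x 1 (fun y => f y ^+ k) (k%:R * f x ^+ k.-1 * df).
Proof.
move=> H; elim: k => [|k IH]; first by rewrite !mul0r; exact: is_derive_cst.
have -> : (fun y => f y ^+ k.+1) = (fun y => f y * f y ^+ k).
  by apply/funext => y; rewrite exprS.
apply: (is_derive_eq (deriveM H IH)) => /=.
case: k {IH} => [|k] /=; first by rewrite !mul0r mulr0 add0r expr0 !mul1r mulr1.
by rewrite exprS -!natr1; ring.
Qed.

Definition flat (k : nat) x : R := if 0 < x then x ^- k * expR (- x^-1) else 0.

Lemma flat_bound k x : 0 < x -> `|flat k x| <= k.+2%:R ^+ k.+2 * x ^+ 2.
Proof.
move=> x0; rewrite /flat x0; have y0 : 0 < x^-1 by rewrite invr_gt0.
rewrite ger0_norm; last by rewrite mulr_ge0 ?expR_ge0// invr_ge0 exprn_ge0// ltW.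
set m := k.+2; have m0 : 0 < m%:R :> R by rewrite ltr0n.
have H : (x^-1 / m%:R) ^+ m <= expR x^-1.
  rewrite -[X in expR X](@divfK _ m%:R) ?gt_eqF// [X in expR X]mulrC expRM_natl.
  apply: lerXn2r; rewrite ?nnegrE ?expR_ge0 ?divr_ge0 ?ltW//.
  by have := expR_ge1Dx (x^-1 / m%:R); lra.
rewrite expRN ler_pdivrMr ?expR_gt0//.
apply: (@le_trans _ _ (m%:R ^+ m * x ^+ 2 * (x^-1 / m%:R) ^+ m)); last first.
  by rewrite ler_wpM2l// mulr_ge0 ?exprn_ge0// ltW.
have mm0 : m%:R ^+ m != 0 :> R by rewrite expf_neq0// gt_eqF.
rewrite [leRHS](_ : _ = x ^- k)// exprMn !exprVn.
move: mm0; set M := m%:R ^+ m => mm0; rewrite /m !exprS; field.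
by rewrite mm0 expf_neq0 gt_eqF.
Qed.

Lemma flat_derive k x :
  is_derive x 1 (flat k) (- k%:R * flat k.+1 x + flat k.+2 x).
Proof.
have [x0|x0|->] := ltgtP x 0.
- have H : \near x, 0 = flat k x.
    by near=> y; rewrite /flat lt_gtF//; near: y; exact: lt_nbhsl.
  apply: (is_derive_eq (near_eq_is_derive H (is_derive_cst 0 x 1))).
  by rewrite /flat !(lt_gtF x0) mulr0 addr0.
- have H : \near x, x^-1 ^+ k * expR (- x^-1) = flat k x.
    by near=> y; rewrite /flat ifT ?exprVn//; near: y; exact: lt_nbhsr.
  have xn0 : x != 0 by rewrite gt_eqF.
  have dV : is_derive x 1 (fun y : R => y^-1) (- x ^- 2).
    have h := @is_derive_id R R x 1.
    split; first exact: (@derivableV _ _ id).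
    by rewrite (@deriveV _ _ id)// derive_val [_ *: _]mulr1.
  have dE : is_derive x 1 (fun y : R => expR (- y^-1)) (expR (- x^-1) * x ^- 2).
    have dN : is_derive x 1 (fun y : R => - y^-1) (x ^- 2).
      by apply: (is_derive_eq (is_deriveN dV)); rewrite opprK.
    exact: (@is_derive1_comp _ expR (fun y : R => - y^-1) x _ _ (is_derive_expR _) dN).
  have dX : is_derive x 1 (fun y : R => y^-1 ^+ k) (k%:R * x^-1 ^+ k.-1 * - x ^- 2).
    exact: (deriveXn k dV).
  apply: (is_derive_eq (near_eq_is_derive H (deriveM dX dE))).
  rewrite /flat !x0; case: k {dX H} => [|k] /=.
    by rewrite mul0r oppr0 !mul0r add0r addr0 expr0 mul1r mulrC.
  rewrite !exprVn !exprS expr0 mulr1; field.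
  by rewrite xn0 expf_neq0.
- rewrite /flat ltxx mulr0 addr0.
  suff H : (fun h => h^-1 *: (flat k (h *: 1 + 0) - flat k 0)) @ 0^' --> (0 : R).
    split; first by apply/cvg_ex; exists 0.
    by apply/cvg_lim.
  set C := k.+2%:R ^+ k.+2 : R.
  have C0 : 0 <= C by rewrite exprn_ge0.
  apply/cvgrPdist_le => e e0; near=> h.
  rewrite sub0r normrN {2}/flat ltxx subr0 addr0 [h *: 1]mulr1.
  have hn0 : h != 0 by near: h; exact: nbhs_dnbhs_neq.
  have [h0|h0] := ltP 0 h; last first.
    by rewrite /flat ltNge h0/= scaler0 normr0 ltW.
  rewrite normrZ normfV (gtr0_norm h0) mulrC ler_pdivrMr//.
  apply: (le_trans (flat_bound k h0)); rewrite -/C expr2 mulrA ler_pM2r//.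
  have : h <= e / (C + 1).
    apply: (le_trans (ler_norm _)); near: h; apply: dnbhs0_le.
    by rewrite divr_gt0// ltr_wpDl.
  rewrite ler_pdivlMr ?ltr_wpDl// => H; apply: le_trans H.
  by rewrite mulrC ler_pM2l//; lra.
Unshelve. all: by end_near. Qed.

Lemma flat_smooth n k : smooth_upto n (flat k).
Proof.
elim: n k => [//|n IH] k; exists (fun x => - k%:R * flat k.+1 x + flat k.+2 x).
  by move=> x; exact: flat_derive.
by apply: smooth_uptoD => //; exact: smooth_uptoZ.
Qed.

Lemma flat_ge0 k x : 0 <= flat k x.
Proof.
by rewrite /flat; case: ifPn => // x0; rewrite mulr_ge0 ?expR_ge0// invr_ge0 exprn_ge0// ltW.
Qed.

Lemma smooth_upto_continuous n f : smooth_upto n.+1 f -> continuous f.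
Proof. by move=> [f' df _] x; exact: is_derive_continuous (df x). Qed.

Lemma nondecreasing_derive_ge0 f df : (forall x : R, is_derive x 1 f (df x)) ->
  (forall x, 0 <= df x) -> forall a b, a <= b -> f a <= f b.
Proof.
move=> H p a b; rewrite le_eqVlt => /predU1P[->//|ab].
have [|c _ E] := @mean_value R f df a b ab (fun x _ => H x).
  by apply: continuous_subspaceT => x; exact: is_derive_continuous (H x).
by rewrite -subr_ge0 E mulr_ge0// subr_ge0 ltW.
Qed.

Definition is_kernel (th th1 th2 th3 : R -> R) (C : R) : Prop :=
  [/\ forall n, smooth_upto n th,
      forall x, 0 <= th x <= C,
      forall x, x <= 1/4 \/ 3/4 <= x -> th x = 0,
      [/\ forall x : R, is_derive x 1 th1 (th x),
          forall x : R, is_derive x 1 th2 (th1 x)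
        & forall x : R, is_derive x 1 th3 (th2 x)]
    & [/\ forall x, x <= 1/4 -> th1 x = 0 /\ th2 x = 0,
          forall x, x <= 1/4 -> th3 x = 0
        & forall x, 3/4 <= x -> th1 x = 1]].

Lemma kernel_exists : exists th th1 th2 th3 C, is_kernel th th1 th2 th3 C.
Proof.
pose b x := flat 0 (1 * x + - (1/4)) * flat 0 (-1 * x + 3/4).
have sb n : smooth_upto n b.
  by apply: smooth_uptoM; apply: smooth_upto_affine; exact: flat_smooth.
have b0 x : 0 <= b x by rewrite mulr_ge0// flat_ge0.
have bz x : x <= 1/4 \/ 3/4 <= x -> b x = 0.
  rewrite /b => -[h|h].
    by rewrite {1}/flat ltNge (_ : 1 * x + - (1/4) <= 0) ?mul0r//; lra.
  by rewrite {2}/flat ltNge (_ : -1 * x + 3/4 <= 0) ?mulr0//; lra.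
have cb : continuous b := smooth_upto_continuous (sb 1%N).
have [B dB B0] := antiderivative_from cb (fun x h => bz x (or_introl h)).
have B1 x : 3/4 <= x -> B x = B (3/4).
  rewrite le_eqVlt => /predU1P[<-//|h].
  have [|c /andP[c1 _] E] := @mean_value R B b (3/4) x h (fun y _ => dB y).
    by apply: continuous_subspaceT => y; exact: is_derive_continuous (dB y).
  by apply/eqP; rewrite -subr_eq0 E bz ?mul0r//; right; exact: ltW.
have Bmono := nondecreasing_derive_ge0 dB b0.
have Bpos : 0 < B (3/4).
  have h34 : 3/8 < 5/8 :> R by lra.
  have [|c /andP[c1 c2] E] := @mean_value R B b (3/8) (5/8) h34 (fun y _ => dB y).
    by apply: continuous_subspaceT => y; exact: is_derive_continuous (dB y).
  have bc : 0 < b c.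
    rewrite /b /flat (_ : 0 < 1 * c + - (1/4)); last lra.
    rewrite (_ : 0 < -1 * c + 3/4); last lra.
    by rewrite !expr0 !invr1 !mul1r mulr_gt0// expR_gt0.
  have h1 : 0 <= B (3/8) by rewrite -(B0 (1/4)) ?lexx// Bmono//; lra.
  have h2 : B (5/8) <= B (3/4) by apply: Bmono; lra.
  have : 0 < b c * (5/8 - 3/8) by rewrite mulr_gt0//; lra.
  lra.
pose m := B (3/4).
pose th x := m^-1 * b x; pose th1 x := m^-1 * B x.
have dth1 (x : R) : is_derive x 1 th1 (th x) by exact: deriveZ.
have c1 : continuous th1 by move=> x; exact: is_derive_continuous (dth1 x).
have z1 x : x <= 1/4 -> th1 x = 0 by move=> hx; rewrite /th1 B0 ?mulr0.
have [th2 dth2 z2] := antiderivative_from c1 z1.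
have c2 : continuous th2 by move=> x; exact: is_derive_continuous (dth2 x).
have [th3 dth3 z3] := antiderivative_from c2 z2.
have bC x : b x <= 1.
  have fl y : flat 0 y <= 1.
    rewrite /flat; case: ifPn => // y0; rewrite expr0 invr1 mul1r.
    by rewrite -expR0 ler_expR oppr_le0 invr_ge0 ltW.
  by rewrite /b mulr_ile1// ?flat_ge0.
have m0 : 0 < m^-1 by rewrite invr_gt0.
exists th, th1, th2, th3, m^-1; split.
- by move=> n; exact: smooth_uptoZ.
- by move=> x; rewrite mulr_ge0 ?(ltW m0)//= ger_pMr.
- by move=> x /bz xz; rewrite /th xz mulr0.
- by [].
- split => // x hx; first by split; [exact: z1|exact: z2].
  by rewrite /th1 B1// mulVf// gt_eqF.
Qed.

End smooth_kernel.

Section integration_helpers.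
Context d (T : measurableType d) (R : realType).
Variable mu : {measure set T -> \bar R}.
Variables (D : set T) (mD : measurable D).
Implicit Types (f g : T -> R).

Lemma integrable_scale (k : R) f : mu.-integrable D (fun x => (f x)%:E) ->
  mu.-integrable D (fun x => (k * f x)%:E).
Proof. by move=> fi; have := integrableZl mD k fi; apply: eq_integrable. Qed.

Lemma integrable_add f g : mu.-integrable D (fun x => (f x)%:E) ->
  mu.-integrable D (fun x => (g x)%:E) ->
  mu.-integrable D (fun x => (f x + g x)%:E).
Proof. by move=> fi gi; have := integrableD mD fi gi; apply: eq_integrable. Qed.

Lemma integrable_sub f g : mu.-integrable D (fun x => (f x)%:E) ->
  mu.-integrable D (fun x => (g x)%:E) ->
  mu.-integrable D (fun x => (f x - g x)%:E).
Proof. by move=> fi gi; have := integrableB mD fi gi; apply: eq_integrable. Qed.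

Lemma integrable_bounded_mul f g (B : R) :
  mu.-integrable D (fun x => (f x)%:E) -> measurable_fun D g ->
  (forall x, D x -> `|g x| <= B) -> mu.-integrable D (fun x => (f x * g x)%:E).
Proof.
move=> fi mg gB; have mf : measurable_fun D f.
  by apply/measurable_EFinP; exact: measurable_int fi.
have := integrableZl mD B fi; apply: le_integrable => //.
  by apply: measurable_EFin_fun; exact: measurable_funM.
move=> x Dx /=; rewrite lee_fin !normrM mulrC ler_wpM2r//.
exact: le_trans (gB x Dx) (ler_norm _).
Qed.

Lemma integrable_bounded g (B : R) : (mu D < +oo)%E -> measurable_fun D g ->
  (forall x, D x -> `|g x| <= B) -> mu.-integrable D (fun x => (g x)%:E).
Proof.
move=> Dfin mg gB.
have : mu.-integrable D (cst B%:E).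
  apply/integrableP; split; first exact: measurable_cst.
  by rewrite /= integral_cst// lte_mul_pinfty.
apply: le_integrable => //; first exact: measurable_EFin_fun.
by move=> x Dx /=; rewrite lee_fin (le_trans (gB x Dx))// ler_norm.
Qed.

Lemma Rintegral_sum (n : nat) (f : nat -> T -> R) :
  (forall j, (j < n)%N -> mu.-integrable D (fun x => (f j x)%:E)) ->
  mu.-integrable D (fun x => (\sum_(j < n) f j x)%:E) /\
  \int[mu]_(x in D) (\sum_(j < n) f j x) = \sum_(j < n) \int[mu]_(x in D) f j x.
Proof.
elim: n => [|n IH] H.
  rewrite big_ord0; split.
    have := integrable0 mu D; apply: eq_integrable => // x _ /=.
    by rewrite big_ord0.
  rewrite /Rintegral integral0_eq// => x _; by rewrite big_ord0.
have [|i1 e1] := IH; first by move=> j jn; apply: H; exact: ltnW.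
have i2 := H n (ltnSn n).
split.
  have := integrableD mD i1 i2; apply: eq_integrable => // x _ /=.
  by rewrite big_ord_recr.
rewrite big_ord_recr/= -e1 -RintegralD//; apply: eq_Rintegral => x _.
by rewrite big_ord_recr.
Qed.

Lemma eq_ge0_integral_Rintegral f : mu.-integrable D (fun x => (f x)%:E) ->
  (\int[mu]_(x in D) (f x)%:E = (\int[mu]_(x in D) f x)%:E)%E.
Proof. by move=> fi; rewrite /Rintegral fineK// integrable_fin_num. Qed.

(* Jensen's inequality for the weight [K], in the form
   [0 <= \int (f - c)^2 K] with [c = \int f K]. *)
Lemma sqr_average_le f (K : T -> R) (B : R) :
  mu.-integrable D (fun x => (f x)%:E) ->
  mu.-integrable D (fun x => (f x ^+ 2)%:E) ->
  mu.-integrable D (fun x => (K x)%:E) ->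
  measurable_fun D K -> (forall x, D x -> 0 <= K x <= B) ->
  \int[mu]_(x in D) K x <= 1 ->
  (\int[mu]_(x in D) (f x * K x)) ^+ 2 <= \int[mu]_(x in D) (f x ^+ 2 * K x).
Proof.
move=> fi f2i Ki mK KB K1.
have KB' x : D x -> `|K x| <= B.
  by move=> /KB /andP[K0 ?]; rewrite ger0_norm.
have fK := integrable_bounded_mul fi mK KB'.
have f2K := integrable_bounded_mul f2i mK KB'.
set c := \int[mu]_(x in D) (f x * K x).
have E : \int[mu]_(x in D) ((f x - c) ^+ 2 * K x) =
    \int[mu]_(x in D) (f x ^+ 2 * K x) - 2 * c * c +
    c ^+ 2 * \int[mu]_(x in D) K x.
  have j1 : mu.-integrable D (fun x => (2 * c * (f x * K x))%:E).
    exact: integrable_scale.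
  have j2 : mu.-integrable D (fun x => (c ^+ 2 * K x)%:E).
    exact: integrable_scale.
  have j3 : mu.-integrable D (fun x => (f x ^+ 2 * K x - 2 * c * (f x * K x))%:E).
    exact: integrable_sub.
  have <- : \int[mu]_(x in D) (2 * c * (f x * K x)) = 2 * c * c.
    by rewrite RintegralZl.
  rewrite -(RintegralZl (c ^+ 2) mD Ki) -(RintegralB mD f2K j1).
  rewrite -(RintegralD mD j3 j2).
  by apply: eq_Rintegral => x _; ring.
have : 0 <= \int[mu]_(x in D) ((f x - c) ^+ 2 * K x).
  apply: Rintegral_ge0 => x Dx; rewrite mulr_ge0 ?sqr_ge0//.
  by case/andP: (KB x Dx).
rewrite E; have := sqr_ge0 c; nra.
Qed.

Lemma average_bound (n : nat) (h C B : R) f (K : nat -> T -> R) : 0 <= h ->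
  mu.-integrable D (fun x => (f x)%:E) ->
  mu.-integrable D (fun x => (f x ^+ 2)%:E) ->
  (forall j, (j < n)%N -> mu.-integrable D (fun x => (K j x)%:E)) ->
  (forall j, (j < n)%N -> measurable_fun D (K j)) ->
  (forall j x, D x -> 0 <= K j x <= B) ->
  (forall j, (j < n)%N -> \int[mu]_(x in D) K j x <= 1) ->
  (forall x, D x -> h * (\sum_(j < n) K j x) <= C) ->
  h * (\sum_(j < n) (\int[mu]_(x in D) (f x * K j x)) ^+ 2) <=
  C * \int[mu]_(x in D) (f x ^+ 2).
Proof.
move=> h0 fi f2i Ki mK KB K1 KC.
have KB' j x : D x -> `|K j x| <= B.
  by move=> /(KB j) /andP[K0 ?]; rewrite ger0_norm.
have f2K j : (j < n)%N -> mu.-integrable D (fun x => (f x ^+ 2 * K j x)%:E).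
  by move=> jn; apply: integrable_bounded_mul f2i (mK j jn) (KB' j).
have [i1 e1] := Rintegral_sum f2K.
apply: (@le_trans _ _ (h * \sum_(j < n) \int[mu]_(x in D) (f x ^+ 2 * K j x))).
  rewrite ler_wpM2l//; apply: ler_sum => j _.
  by apply: (@sqr_average_le _ _ B) => //;
    [exact: Ki|exact: mK|move=> x; exact: KB|exact: K1].
rewrite -e1 -!RintegralZl//; apply: le_Rintegral => //.
- exact: integrable_scale.
- exact: integrable_scale.
- move=> x Dx; rewrite -mulr_sumr mulrCA mulrC ler_wpM2r ?sqr_ge0//; exact: KC.
Qed.

End integration_helpers.

Section cells.
Variable R : realType.
Local Notation leb := (@lebesgue_measure R).
Variables (N : nat) (h L : R).
Hypotheses (N0 : (0 < N)%N) (L0 : 0 < L) (hN : h * N%:R = L).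
Implicit Types (x : R) (c : nat -> R).
Local Notation D := (`]0, L[%classic : set R).

Let h0 : 0 < h.
Proof. by move: L0; rewrite -hN pmulr_lgt0// ltr0n. Qed.

Definition cell (N : nat) (h x : R) : nat := minn N.-1 (Num.truncn (x / h)).

Definition cell_itv (h : R) (j : nat) : set R := `[h * j%:R, h * j.+1%:R[%classic.

Lemma cell_lt x : (cell N h x < N)%N.
Proof. by rewrite /cell gtn_min ltn_predL N0. Qed.

Lemma cell_itvP x : 0 <= x < L -> cell_itv h (cell N h x) x.
Proof.
move=> /andP[x0 xL]; have xh : 0 <= x / h by rewrite divr_ge0// ltW.
have tN : (Num.truncn (x / h) < N)%N.
  rewrite -(ltr_nat R); apply: (@le_lt_trans _ _ (x / h)); first by rewrite truncn_le.
  by rewrite ltr_pdivrMr// mulrC hN.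
have -> : cell N h x = Num.truncn (x / h).
  by apply/minn_idPr; rewrite -ltnS prednK.
rewrite /cell_itv /= in_itv /=; apply/andP; split.
  by rewrite mulrC -ler_pdivlMr// truncn_le.
by rewrite mulrC -ltr_pdivrMr// truncnS_gt.
Qed.

Lemma cell_dist x : 0 <= x <= L -> 0 <= x - h * (cell N h x)%:R <= h.
Proof.
move=> /andP[x0]; rewrite le_eqVlt => /predU1P[xL|xL]; last first.
  have := cell_itvP (_ : 0 <= x < L); rewrite x0 xL => /(_ isT).
  rewrite /cell_itv /= in_itv /= -natr1 mulrDr mulr1 => /andP[? ?].
  by apply/andP; split; lra.
have -> : cell N h x = N.-1.
  apply/minn_idPl; rewrite xL -hN mulrAC divff ?gt_eqF// mul1r natrK leq_pred//.
rewrite xL -hN -mulrBr -natrB ?leq_pred// -subn1 subKn// mulr1.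
by rewrite lexx ltW.
Qed.

Lemma cell_itv_uniq x j : 0 <= x < L -> cell_itv h j x -> j = cell N h x.
Proof.
move=> x0L; have := cell_itvP x0L; set k := cell N h x.
have aux a b : cell_itv h a x -> cell_itv h b x -> (a <= b)%N.
  rewrite /cell_itv /= !in_itv /= => /andP[a1 _] /andP[_ b2].
  rewrite -ltnS -(ltr_nat R) -(ltr_pM2l h0); exact: le_lt_trans b2.
by move=> hk hj; apply/eqP; rewrite eqn_leq !aux.
Qed.

Lemma sum_cell c x : 0 <= x < L ->
  \sum_(j < N) c j * \1_(cell_itv h j) x = c (cell N h x).
Proof.
move=> x0L; rewrite -(@sum_delta R N (cell N h x) c (cell_lt x)).
apply: eq_bigr => j _; rewrite mulrC indicE; congr (_%:R * _); congr nat_of_bool.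
apply/idP/eqP; first by rewrite inE => /(cell_itv_uniq x0L).
by move=> ->; rewrite inE; exact: cell_itvP.
Qed.

Lemma measurable_cell_itv j : measurable (cell_itv h j).
Proof. exact: measurable_itv. Qed.

Lemma leb_domain_fin : (leb D < +oo)%E.
Proof. by rewrite /= lebesgue_measure_itv/= lte_fin L0 -EFinB ltry. Qed.

Lemma integral_cell_indic j : (j < N)%N ->
  \int[leb]_(x in D) (\1_(cell_itv h j) x : R) = h.
Proof.
move=> jN; rewrite /Rintegral integral_indic//=; last exact: measurable_cell_itv.
have jL : h * j.+1%:R <= L by rewrite -hN ler_pM2l// ler_nat.
have E : (cell_itv h j `&` D = if j is 0 then `]0, h[%classic else cell_itv h j).
  apply/seteqP; split => x; rewrite /cell_itv /= !in_itv/=.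
    case: j {jN jL} => [|j] [] /andP[h1 h2] /andP[h3 h4]; rewrite /= in_itv/=.
      by move: h2; rewrite mulr1 h3.
    by rewrite h1.
  case: j {jN} jL => [|j] jL; rewrite /= in_itv/= => /andP[h1 h2].
    by rewrite mulr0 mulr1 (ltW h1) h2 h1; split => //; move: jL; rewrite mulr1; lra.
  rewrite h1 h2; split => //; apply/andP; split; last lra.
  by apply: lt_le_trans h1; rewrite mulr_gt0.
rewrite E; case: j {jN jL E} => [|j].
  by rewrite lebesgue_measure_itv/= lte_fin h0 oppr0 adde0.
rewrite /cell_itv lebesgue_measure_itv/= lte_fin ltr_pM2l// ltr_nat ltnSn/=.
by rewrite -[j.+2%:R]natr1; ring.
Qed.

Lemma integrable_cell_mul (f : R -> R) j :
  leb.-integrable D (fun x => (f x)%:E) ->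
  leb.-integrable D (fun x => (f x * \1_(cell_itv h j) x)%:E).
Proof.
move=> fi.
apply: (@integrable_bounded_mul _ _ _ leb D (measurable_itv _) f
  (\1_(cell_itv h j)) 1) => //.
  by apply: measurable_indic; exact: measurable_cell_itv.
by move=> x _; rewrite indicE; case: (_ \in _); rewrite ?normr1 ?normr0.
Qed.

Lemma integral_step (f : R -> R) c : leb.-integrable D (fun x => (f x)%:E) ->
  leb.-integrable D (fun x => (f x * c (cell N h x))%:E) /\
  \int[leb]_(x in D) (f x * c (cell N h x)) =
  \sum_(j < N) c j * \int[leb]_(x in D) (f x * \1_(cell_itv h j) x).
Proof.
move=> fi.
have ij j : (j < N)%N ->
    leb.-integrable D (fun x => (c j * (f x * \1_(cell_itv h j) x))%:E).
  by move=> jN; apply: integrable_scale => //; exact: integrable_cell_mul.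
have E x : D x -> \sum_(j < N) c j * (f x * \1_(cell_itv h j) x) =
    f x * c (cell N h x).
  move=> Dx; rewrite -sum_cell ?mulr_sumr.
    by apply: eq_bigr => j _; rewrite mulrCA.
  by move: Dx; rewrite /= in_itv/= => /andP[/ltW -> ->].
have [i e] := @Rintegral_sum _ _ _ leb D (measurable_itv _) N _ ij.
split.
  by apply: eq_integrable i => // x; rewrite inE => Dx; rewrite E.
rewrite (_ : \int[leb]_(x in D) (f x * c (cell N h x)) =
    \int[leb]_(x in D) (\sum_(j < N) c j * (f x * \1_(cell_itv h j) x))).
  rewrite e; apply: eq_bigr => j _; rewrite RintegralZl//.
  exact: integrable_cell_mul.
by apply: eq_Rintegral => x; rewrite inE => Dx; rewrite E.
Qed.

Lemma integral_cell c :
  leb.-integrable D (fun x => (c (cell N h x))%:E) /\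
  \int[leb]_(x in D) (c (cell N h x)) = h * \sum_(j < N) c j.
Proof.
pose one : R -> R := fun=> 1.
have i1 : leb.-integrable D (fun x => (one x)%:E).
  apply: (@integrable_bounded _ _ _ leb D (measurable_itv _) one 1).
  - exact: leb_domain_fin.
  - exact: measurable_cst.
  - by move=> x _; rewrite normr1.
have [i e] := integral_step c i1; split.
  by apply: eq_integrable i => // x _; rewrite mul1r.
rewrite mulr_sumr; transitivity (\int[leb]_(x in D) (one x * c (cell N h x))).
  by apply: eq_Rintegral => x _; rewrite mul1r.
rewrite e; apply: eq_bigr => j _; rewrite mulrC; congr (_ * _).
by rewrite -[RHS](@integral_cell_indic j)//; apply: eq_Rintegral => x _; rewrite mul1r.
Qed.

End cells.

Section initial_data.
Variable R : realType.
Local Notation leb := (@lebesgue_measure R).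
Implicit Types (x y : R).

Lemma L2P L (f : R -> R) : 0 < L -> L2 L f ->
  [/\ measurable_fun (`]0, L[%classic : set R) f,
      leb.-integrable (`]0, L[%classic : set R) (fun x => (f x)%:E)
    & leb.-integrable (`]0, L[%classic : set R) (fun x => (f x ^+ 2)%:E)].
Proof.
move=> L0 f2; pose D : set R := `]0, L[%classic.
have mD : measurable D by exact: measurable_itv.
have mf : measurable_fun D f.
  apply/(measurable_restrictT _ mD).
  by move: f2; rewrite /L2 inE => /andP[]; rewrite inE.
have i2 : leb.-integrable D (fun x => (f x ^+ 2)%:E).
  have := Lfun2_integrable_sqr f2 => i.
  apply: (@integrable_mkcond _ _ R leb D (fun x => (f x ^+ 2)%:E) mD).2.
  apply: eq_integrable i => // x _ /=.
  by rewrite /patch; case: ifPn => // _; rewrite expr0n.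
split => //.
have one : leb.-integrable D (fun x => (cst 1 x : R)%:E).
  apply: (@integrable_bounded _ _ _ leb D mD (cst 1) 1).
  - exact: leb_domain_fin.
  - exact: measurable_cst.
  - by move=> x _; rewrite normr1.
have := @integrable_add _ _ R leb D mD _ _ i2 one; apply: le_integrable => //.
  exact: measurable_EFin_fun.
move=> x _ /=; rewrite lee_fin [leRHS]ger0_norm ?addr_ge0 ?sqr_ge0//.
rewrite -[f x ^+ 2]real_normK ?num_real//.
by have := sqr_ge0 (`|f x| - 1); rewrite sqrrB1; have := normr_ge0 (f x); nra.
Qed.

Lemma ftc_domain L (F f : R -> R) : 0 < L ->
  (forall x : R, is_derive x 1 F (f x)) -> continuous f ->
  \int[leb]_(x in (`]0, L[%classic : set R)) f x = F L - F 0.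
Proof.
move=> L0 dF cf.
rewrite -(@ftc_from0 R F f L L0 (fun x _ => dF x)); last exact: continuous_subspaceT.
rewrite /Rintegral; congr fine; apply/esym.
have mf : measurable_fun setT f by exact: continuous_measurable_fun.
rewrite integral_itv_bndoo//.
by apply: measurable_EFin_fun; exact: measurable_funTS.
Qed.

Section kernel.
Variables (th th1 th2 th3 : R -> R) (C : R).
Hypothesis hk : is_kernel th th1 th2 th3 C.

Let smooth_th : forall n, smooth_upto n th. Proof. by case: hk. Qed.
Let th_bound x : 0 <= th x <= C. Proof. by case: hk. Qed.
Let th_supp x : x <= 1/4 \/ 3/4 <= x -> th x = 0. Proof. by case: hk => _ _ + _ _; exact. Qed.
Let dth1 x : is_derive x 1 th1 (th x). Proof. by case: hk => _ _ _ [+ _ _] _. Qed.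
Let dth2 x : is_derive x 1 th2 (th1 x). Proof. by case: hk => _ _ _ [_ + _] _. Qed.
Let dth3 x : is_derive x 1 th3 (th2 x). Proof. by case: hk => _ _ _ [_ _ +] _. Qed.
Let th1_0 x : x <= 1/4 -> th1 x = 0.
Proof. by move=> hx; case: hk => _ _ _ _ [/(_ x hx)[]]. Qed.
Let th2_0 x : x <= 1/4 -> th2 x = 0.
Proof. by move=> hx; case: hk => _ _ _ _ [/(_ x hx)[]]. Qed.
Let th3_0 x : x <= 1/4 -> th3 x = 0.
Proof. by move=> hx; case: hk => _ _ _ _ [_ /(_ x hx)]. Qed.
Let th1_1 x : 3/4 <= x -> th1 x = 1.
Proof. by move=> hx; case: hk => _ _ _ _ [_ _ /(_ x hx)]. Qed.

Let th1_bound x : 0 <= th1 x <= 1.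
Proof.
have mono := nondecreasing_derive_ge0 dth1 (fun x => (andP (th_bound x)).1).
have [h|h] := leP x (1/4); first by rewrite th1_0// lexx ler01.
have [h'|h'] := leP (3/4) x; first by rewrite th1_1// ler01 lexx.
apply/andP; split; first by rewrite -(@th1_0 (1/4))// mono// ltW.
by rewrite -(@th1_1 (3/4))// mono// ltW.
Qed.

Let cth : continuous th := smooth_upto_continuous (smooth_th 1%N).

Definition hat_kernel (th2 : R -> R) y := th2 (y + 1) - 2 * th2 y + th2 (y - 1).

Let derive_hat (f f' : R -> R) : (forall x, is_derive x 1 f (f' x)) -> forall y,
  is_derive y 1 (hat_kernel f) (hat_kernel f' y).
Proof.
move=> df y.
exact: (deriveD (deriveB (derive_shift (df _)) (deriveZ 2 (df _)))
  (derive_shift (df _))).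
Qed.

Let smooth_hat n : smooth_upto n (hat_kernel th2).
Proof.
suff H : smooth_upto n.+2 (hat_kernel th2) by do 2 apply: smooth_upto_le.
exists (hat_kernel th1); first exact: derive_hat.
exists (hat_kernel th); first exact: derive_hat.
have sh (f : R -> R) b : smooth_upto n f -> smooth_upto n (fun x => f (x + b)).
  move=> sf; rewrite (_ : (fun x => _) = (fun x => f (1 * x + b))).
    exact: smooth_upto_affine.
  by apply/funext => x; rewrite mul1r.
have -> : hat_kernel th = (fun y => (th (y + 1) + (-2) * th y) + th (y - 1)).
  by apply/funext => y; rewrite /hat_kernel mulNr.
apply: smooth_uptoD; last exact: sh.
by apply: smooth_uptoD; [exact: sh|exact: smooth_uptoZ].
Qed.

Let r y := th2 (y + 1) - th2 y.

Let hat_r y : hat_kernel th2 y = r y - r (y - 1).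
Proof. by rewrite /hat_kernel /r subrK; ring. Qed.

Let r_bound y : 0 <= r y <= 1.
Proof.
have yy : y < y + 1 by lra.
have [|c _ E] := @mean_value R th2 th1 y (y + 1) yy (fun x _ => dth2 x).
  by apply: continuous_subspaceT => x; exact: is_derive_continuous (dth2 x).
by rewrite /r E addrAC subrr add0r mulr1.
Qed.

Let hat_ge0 y : 0 <= hat_kernel th2 y.
Proof.
rewrite hat_r subr_ge0.
apply: (@nondecreasing_derive_ge0 R r (fun y => th1 (y + 1) - th1 y)).
- by move=> x; apply: deriveB => //; exact: derive_shift.
- have mono := nondecreasing_derive_ge0 dth1 (fun x => (andP (th_bound x)).1).
  by move=> x; rewrite subr_ge0 mono//; lra.
- lra.
Qed.

Let hat_le1 y : hat_kernel th2 y <= 1.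
Proof. by rewrite hat_r; have := r_bound y; have := r_bound (y - 1); lra. Qed.

Let hat_supp y : y <= - (3/4) \/ 7/4 <= y -> hat_kernel th2 y = 0.
Proof.
move=> [h|h].
  by rewrite /hat_kernel !th2_0 ?mulr0 ?subrr ?addr0//; lra.
have r1 z : 3/4 <= z -> r z = 1.
  move=> hz; have zz : z < z + 1 by lra.
  have [|c /andP[c1 _] E] := @mean_value R th2 th1 z (z + 1) zz (fun x _ => dth2 x).
    by apply: continuous_subspaceT => x; exact: is_derive_continuous (dth2 x).
  by rewrite /r E addrAC subrr add0r mulr1 th1_1//; lra.
by rewrite hat_r !r1 ?subrr//; lra.
Qed.

Section grid.
Variables (N : nat) (h L : R).
Hypotheses (N0 : (0 < N)%N) (L0 : 0 < L) (hN : h * N%:R = L).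
Local Notation D := (`]0, L[%classic : set R).

Let h0 : 0 < h.
Proof. by move: L0; rewrite -hN pmulr_lgt0// ltr0n. Qed.
Let hV0 : 0 < h^-1. Proof. by rewrite invr_gt0. Qed.
Let mD : measurable D. Proof. exact: measurable_itv. Qed.
Let hV : h / h = 1. Proof. by rewrite divff ?gt_eqF. Qed.

Definition node_kernel (h : R) (j : nat) x := h^-1 * th (h^-1 * x - j%:R).
Definition bending_kernel (h : R) (i : nat) x :=
  h^-1 * hat_kernel th2 (h^-1 * x - i.+1%:R).
Definition cell_kernel (h : R) (j : nat) x := h^-1 * \1_(cell_itv h j) x.

Definition node_average (h L : R) (f : R -> R) j :=
  \int[leb]_(x in (`]0, L[%classic : set R)) (f x * node_kernel h j x).
Definition cell_average (h L : R) (f : R -> R) j :=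
  \int[leb]_(x in (`]0, L[%classic : set R)) (f x * cell_kernel h j x).

Let node_continuous j : continuous (node_kernel h j).
Proof.
have H := smooth_uptoZ h^-1 (smooth_upto_affine h^-1 (- j%:R) (smooth_th 1%N)).
exact: smooth_upto_continuous H.
Qed.

Let bending_continuous i : continuous (bending_kernel h i).
Proof.
have H := smooth_uptoZ h^-1 (smooth_upto_affine h^-1 (- i.+1%:R) (smooth_hat 1%N)).
exact: smooth_upto_continuous H.
Qed.

Let bounded_continuous_integrable (f : R -> R) B : continuous f ->
  (forall x, D x -> `|f x| <= B) ->
  measurable_fun D f /\ leb.-integrable D (fun x => (f x)%:E).
Proof.
move=> cf fB; have mf : measurable_fun D f.
  by apply: measurable_funTS; exact: continuous_measurable_fun.
split => //; apply: (@integrable_bounded _ _ _ leb D mD f B) => //.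
exact: leb_domain_fin.
Qed.

Let node_bound j x : 0 <= node_kernel h j x <= h^-1 * C.
Proof.
rewrite /node_kernel; have /andP[t0 tC] := th_bound (h^-1 * x - j%:R).
by rewrite mulr_ge0 ?(ltW hV0)//= ler_pM2l.
Qed.

Let bending_bound i x : 0 <= bending_kernel h i x <= h^-1 * 1.
Proof. by rewrite /bending_kernel mulr_ge0 ?(ltW hV0) ?hat_ge0//= ler_pM2l ?hat_le1. Qed.

Lemma node_average_l2 f : leb.-integrable D (fun x => (f x)%:E) ->
  leb.-integrable D (fun x => (f x ^+ 2)%:E) ->
  h * \sum_(j < N) node_average h L f j ^+ 2 <= C * \int[leb]_(x in D) (f x ^+ 2).
Proof.
move=> fi f2i.
have B j x : D x -> `|node_kernel h j x| <= h^-1 * C.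
  by move=> _; have /andP[k0 kC] := node_bound j x; rewrite ger0_norm.
have BI j := bounded_continuous_integrable (@node_continuous j) (B j).
apply: (@average_bound _ _ _ leb D mD N h C (h^-1 * C) f (node_kernel h)) => //.
- exact: ltW.
- by move=> j _; exact: (BI j).2.
- by move=> j _; exact: (BI j).1.
- move=> j _.
  have dF x : is_derive x 1 (fun x => th1 (h^-1 * x + - j%:R)) (node_kernel h j x).
    by rewrite /node_kernel mulrC; exact: derive_affine.
  rewrite (ftc_domain L0 dF (@node_continuous j)).
  have /andP[_ u1] := th1_bound (h^-1 * L - j%:R).
  have /andP[l0 _] := th1_bound (h^-1 * 0 - j%:R).
  lra.
- move=> x; rewrite /= in_itv /= => /andP[x0 xL].
  rewrite mulr_sumr (@le_trans _ _ (\sum_(j < N) ((j : nat) == cell N h x)%:R * C))//; last first.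
    by rewrite (@sum_delta _ _ _ (fun=> C))// cell_lt.
  apply: ler_sum => j _; rewrite /node_kernel mulrA hV mul1r.
  have [_|jc] := eqVneq (j : nat) (cell N h x).
    by rewrite /= mul1r; case/andP: (th_bound (h^-1 * x - j%:R)).
  rewrite /= mul0r th_supp//.
  have [|h1] := leP (h^-1 * x - j%:R) (1/4); first by left.
  have [|h2] := leP (3/4) (h^-1 * x - j%:R); first by right.
  exfalso; move/eqP : jc; apply; apply: (cell_itv_uniq N0 L0 hN).
    by rewrite (ltW x0) xL.
  rewrite /cell_itv /= in_itv /= -ler_pdivlMl// -ltr_pdivrMl// -natr1.
  by apply/andP; split; lra.
Qed.

Lemma cell_average_l2 f : leb.-integrable D (fun x => (f x)%:E) ->
  leb.-integrable D (fun x => (f x ^+ 2)%:E) ->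
  h * \sum_(j < N) cell_average h L f j ^+ 2 <= \int[leb]_(x in D) (f x ^+ 2).
Proof.
move=> fi f2i; rewrite -[leRHS]mul1r.
have B j x : 0 <= cell_kernel h j x <= h^-1.
  by rewrite /cell_kernel indicE; case: (_ \in _); rewrite ?mulr1 ?mulr0 ?lexx ?ltW.
have mK j : measurable_fun D (cell_kernel h j).
  apply: measurable_funM; first exact: measurable_cst.
  by apply: measurable_indic; exact: measurable_cell_itv.
have iI j : leb.-integrable D (fun x => (\1_(cell_itv h j) x : R)%:E).
  apply: (@integrable_bounded _ _ _ leb D mD (\1_(cell_itv h j)) 1).
  - exact: leb_domain_fin.
  - by apply: measurable_indic; exact: measurable_cell_itv.
  - by move=> x _; rewrite indicE; case: (_ \in _); rewrite ?normr1 ?normr0.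
apply: (@average_bound _ _ _ leb D mD N h 1 h^-1 f (cell_kernel h)) => //.
- exact: ltW.
- by move=> j _; exact: integrable_scale.
- by move=> j _; exact: mK.
- move=> j jN; rewrite (@RintegralZl _ _ _ leb D (\1_(cell_itv h j)) h^-1 mD (iI j)) (integral_cell_indic N0 L0 hN jN).
  by rewrite mulVf// gt_eqF.
- move=> x; rewrite /= in_itv/= => /andP[x0 xL].
  rewrite -mulr_sumr mulrA hV mul1r.
  have := @sum_cell R N h L N0 L0 hN (fun=> 1) x.
  rewrite (ltW x0) xL => /(_ isT) <-.
  by apply: ler_sum => j _; rewrite mul1r.
Qed.

Let bending_kernel_test i : (i.+2 < N)%N -> test_function1 D (bending_kernel h i).
Proof.
move=> iN; split.
  apply: smooth_upto_derivable => n; apply: smooth_uptoZ.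
  exact: (@smooth_upto_affine R n (hat_kernel th2)).
exists `[h * (i%:R + 1/4), h * (i%:R + 11/4)]%classic; split.
- exact: segment_compact.
- move=> x; rewrite /= !in_itv/= => /andP[h1 h2]; apply/andP; split.
    by apply: lt_le_trans h1; rewrite mulr_gt0//; have : 0 <= i%:R :> R by []; lra.
  apply: (le_lt_trans h2); rewrite -hN ltr_pM2l//.
  have : i.+3%:R <= N%:R :> R by rewrite ler_nat.
  by rewrite -addn3 natrD; lra.
- move=> x; rewrite /= in_itv/= => /negP; rewrite negb_and -!ltNge => H.
  rewrite /bending_kernel hat_supp ?mulr0//.
  case/orP: H => H; [left|right].
    have : h^-1 * x <= i%:R + 1/4 by rewrite ler_pdivrMl// ltW.
    by rewrite -[i.+1%:R]natr1; lra.
  have : i%:R + 11/4 <= h^-1 * x by rewrite ler_pdivlMl// ltW.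
  by rewrite -[i.+1%:R]natr1; lra.
Qed.

Let bending_kernel_derive2 i : derive1n 2 (bending_kernel h i) = fun x =>
  (node_kernel h i.+2 x - 2 * node_kernel h i.+1 x + node_kernel h i x) / h ^+ 2.
Proof.
have d1 (f f' : R -> R) c : (forall x, is_derive x 1 f (f' x)) ->
    derive1 (fun x => c * f (h^-1 * x - i.+1%:R)) =
    fun x => c * h^-1 * f' (h^-1 * x - i.+1%:R).
  move=> df; apply/funext => x; apply: is_derive_val.
  apply: (is_derive_eq (deriveZ _ (derive_affine (df _)))); ring.
rewrite /derive1n /= /bending_kernel (d1 _ _ _ (derive_hat dth2)).
rewrite (d1 _ _ _ (derive_hat dth1)).
apply/funext => x; rewrite /hat_kernel /node_kernel.
have -> : h^-1 * x - i.+1%:R + 1 = h^-1 * x - i%:R by rewrite -[i.+1%:R]natr1; ring.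
have -> : h^-1 * x - i.+1%:R - 1 = h^-1 * x - i.+2%:R by rewrite -[i.+2%:R]natr1; ring.
by field; rewrite gt_eqF.
Qed.

Lemma bending_average f w : leb.-integrable D (fun x => (f x)%:E) ->
  weak_derivative L 2 f w -> forall i, (i < N)%N ->
  bending N h (node_average h L f) i =
  if (i.+2 < N)%N then \int[leb]_(x in D) (w x * bending_kernel h i x) else 0.
Proof.
move=> fi fw i iN; rewrite /bending sum_second_diff; case: ifPn => // i2N.
have := fw _ (bending_kernel_test i2N).
rewrite sqrrN expr1n mul1r bending_kernel_derive2 => <-.
have B j x : D x -> `|node_kernel h j x| <= h^-1 * C.
  by move=> _; have /andP[k0 kC] := node_bound j x; rewrite ger0_norm.
have I j : leb.-integrable D (fun x => (f x * node_kernel h j x)%:E).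
  have [mk _] := bounded_continuous_integrable (@node_continuous j) (B j).
  exact: (@integrable_bounded_mul _ _ R leb D mD f _ _ fi mk (B j)).
pose F j x := f x * node_kernel h j x.
rewrite (_ : \int[leb]_(x in D) _ = \int[leb]_(x in D)
    ((h ^+ 2)^-1 * ((F i.+2 x - 2 * F i.+1 x) + F i x))); last first.
  by apply: eq_Rintegral => x _; rewrite /F; ring.
have J1 : leb.-integrable D (fun x => (2 * F i.+1 x)%:E).
  exact: (@integrable_scale _ _ R leb D mD 2 (F i.+1) (I i.+1)).
have J2 : leb.-integrable D (fun x => (F i.+2 x - 2 * F i.+1 x)%:E).
  exact: (@integrable_sub _ _ R leb D mD (F i.+2) _ (I i.+2) J1).
have J3 := @integrable_add _ _ R leb D mD _ (F i) J2 (I i).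
rewrite (@RintegralZl _ _ _ leb D _ (h ^+ 2)^-1 mD J3).
rewrite (@RintegralD _ _ _ leb D _ _ mD J2 (I i)).
rewrite (@RintegralB _ _ _ leb D _ _ mD (I i.+2) J1).
by rewrite (@RintegralZl _ _ _ leb D _ 2 mD (I i.+1)) mulrC.
Qed.

Lemma bending_average_l2 f w : leb.-integrable D (fun x => (f x)%:E) ->
  leb.-integrable D (fun x => (w x)%:E) ->
  leb.-integrable D (fun x => (w x ^+ 2)%:E) ->
  weak_derivative L 2 f w ->
  h * \sum_(i < N) bending N h (node_average h L f) i ^+ 2 <=
  \int[leb]_(x in D) (w x ^+ 2).
Proof.
move=> fi wi w2i fw.
have B i x : D x -> `|bending_kernel h i x| <= h^-1 * 1.
  by move=> _; have /andP[k0 kC] := bending_bound i x; rewrite ger0_norm.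
have BI i := bounded_continuous_integrable (@bending_continuous i) (B i).
apply: (@le_trans _ _ (h * \sum_(i < N)
    (\int[leb]_(x in D) (w x * bending_kernel h i x)) ^+ 2)).
  rewrite ler_pM2l//; apply: ler_sum => i _; rewrite (bending_average fi fw)//.
  by case: ifPn => // _; rewrite expr0n sqr_ge0.
rewrite -[leRHS]mul1r.
apply: (@average_bound _ _ _ leb D mD N h 1 (h^-1 * 1) w (bending_kernel h)) => //.
- exact: ltW.
- by move=> j _; exact: (BI j).2.
- by move=> j _; exact: (BI j).1.
- move=> i _.
  have dF x : is_derive x 1 (fun x => hat_kernel th3 (h^-1 * x + - i.+1%:R))
      (bending_kernel h i x).
    rewrite /bending_kernel mulrC; apply: derive_affine; exact: derive_hat.
  rewrite (ftc_domain L0 dF (@bending_continuous i)).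
  rewrite mulr0 add0r (_ : hat_kernel th3 (- i.+1%:R) = 0); last first.
    have i1 : 1 <= i.+1%:R :> R by rewrite ler1n.
    by rewrite /hat_kernel !th3_0 ?mulr0 ?subrr ?addr0//; lra.
  set y := h^-1 * L + - i.+1%:R; have [c _] := @second_diff_mean R th3 th2 th1 (y - 1) 1 ltr01 dth3 dth2.
  rewrite expr1n divr1 subrK mulr1 (_ : y - 1 + 2 = y + 1); last ring.
  move=> E; have -> : hat_kernel th3 y = th1 c by rewrite -E /hat_kernel.
  by rewrite subr0; case/andP: (th1_bound c).
- move=> x _; rewrite /bending_kernel -mulr_sumr mulrA hV mul1r.
  pose s k := - r (h^-1 * x - k.+1%:R).
  rewrite (_ : \sum_(i < N) _ = \sum_(0 <= i < N) (s i.+1 - s i)).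
    rewrite telescope_sumr// /s; have := r_bound (h^-1 * x - 1%:R).
    by have := r_bound (h^-1 * x - N.+1%:R); lra.
  rewrite big_mkord; apply: eq_bigr => i _; rewrite hat_r /s.
  rewrite (_ : h^-1 * x - i.+1%:R - 1 = h^-1 * x - i.+2%:R); first by ring.
  by rewrite -[i.+2%:R]natr1; ring.
Qed.

End grid.
End kernel.
End initial_data.

Section node_average_convergence.
Variable R : realType.
Local Notation leb := (@lebesgue_measure R).
Variables (th th1 th2 th3 : R -> R) (C L : R).
Hypothesis hk : is_kernel th th1 th2 th3 C.
Hypothesis L0 : 0 < L.
Local Notation D := (`]0, L[%classic : set R).

Let mD : measurable D. Proof. exact: measurable_itv. Qed.

Lemma kernel_bound_gt0 : 0 < C.
Proof.
case: hk => _ thC _ [dth1 _ _] [th1z _ th11].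
rewrite ltNge; apply/negP => C0.
have th0 x : th x = 0 by have := thC x; lra.
have z14 : 0 <= 1/4 :> R by lra.
have z34 : 3/4 <= 1 :> R by lra.
have E0 : th1 0 = 0 by exact: (th1z 0 z14).1.
have E1 : th1 1 = 1 by exact: th11.
have [|c _ E] := @mean_value R th1 th 0 1 ltr01 (fun x _ => dth1 x).
  by apply: continuous_subspaceT => x; exact: is_derive_continuous (dth1 x).
by move: E; rewrite E0 E1 th0 mul0r; lra.
Qed.

Lemma node_average_cvg (f : R -> R) : leb.-integrable D (fun x => (f x)%:E) ->
  {ae leb, forall x, D x -> forall e : R, 0 < e -> exists2 delta : R, 0 < delta &
    forall (N : nat) (h : R), (0 < N)%N -> h * N%:R = L -> h < delta ->
      `|node_average th h L f (cell N h x) - f x| <= e}.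
Proof.
move=> fi; pose g : R -> R := f \_ D.
have mf : measurable_fun D f.
  by apply/measurable_EFinP; exact: measurable_int fi.
have mg : measurable_fun setT g := (measurable_restrictT f mD).1 mf.
have := lebesgue_differentiation (integrable_locally_restrict mD fi).
apply: filterS; first exact: (ae_filter_ringOfSetsType leb).
move=> x lx Dx e e0.
have C0 := kernel_bound_gt0.
case: hk => sth thC thz [dth1 _ _] [th1z _ th11].
have gx : g x = f x by rewrite /g patchE mem_set.
have e2 : 0 < e / (2 * C) by rewrite divr_gt0// mulr_gt0.
have [delta /= d0 Hd] : exists2 delta : R, 0 < delta &
    forall r, 0 < r -> r < delta -> (davg g x r <= (e / (2 * C))%:E)%E.
  move: lx; rewrite /lebesgue_pt => /fine_cvgP[fd].
  move=> /cvgrPdist_le /(_ _ e2) H.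
  have [delta /= d0 H'] : 0^'+ [set r : R | davg g x r \is a fin_num /\
     `|0 - (fine \o davg g x) r| <= e / (2 * C)] by exact: filterI.
  exists delta => // r r0 rd; have [||h1 h2] := H' r.
  - by rewrite /ball_/= sub0r normrN gtr0_norm.
  - exact: r0.
  rewrite -(fineK h1) lee_fin; apply: le_trans h2.
  by rewrite sub0r normrN ler_norm.
exists delta => // N h N0 hN hd.
have h0 : 0 < h by move: L0; rewrite -hN pmulr_lgt0// ltr0n.
set j := cell N h x.
have jN : (j < N)%N by exact: cell_lt.
pose K := node_kernel th h j.
have cK : continuous K.
  have H := smooth_uptoZ h^-1 (smooth_upto_affine h^-1 (- j%:R) (sth 1%N)).
  exact: smooth_upto_continuous H.
have mK : measurable_fun D K.
  by apply: measurable_funTS; exact: continuous_measurable_fun.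
have K0 y : 0 <= K y <= C / h.
  rewrite /K /node_kernel; have /andP[t0 tC] := thC (h^-1 * y - j%:R).
  by rewrite mulr_ge0 ?invr_ge0 ?(ltW h0)//= mulrC ler_pM2r ?invr_gt0.
have KB y : D y -> `|K y| <= C / h.
  by move=> _; have /andP[? ?] := K0 y; rewrite ger0_norm.
have iK : leb.-integrable D (fun y => (K y)%:E).
  by apply: (@integrable_bounded _ _ _ leb D mD K (C / h)) => //; exact: leb_domain_fin.
have K1 : \int[leb]_(y in D) K y = 1.
  have dF (y : R) : is_derive y 1 (fun y => th1 (h^-1 * y + - j%:R)) (K y).
    by rewrite /K /node_kernel mulrC; exact: derive_affine.
  rewrite (ftc_domain L0 dF cK).
  have -> : th1 (h^-1 * 0 + - j%:R) = 0.
    by have [] := th1z (h^-1 * 0 + - j%:R) => //; have : 0 <= j%:R :> R by []; lra.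
  rewrite subr0 th11//.
  have -> : h^-1 * L = N%:R by rewrite -hN mulKf// gt_eqF.
  have : j.+1%:R <= N%:R :> R by rewrite ler_nat.
  by rewrite -[j.+1%:R]natr1; lra.
have Ksupp y : K y != 0 -> ball x h y.
  move=> Ky; have [h1 h2] : 1/4 < h^-1 * y - j%:R /\ h^-1 * y - j%:R < 3/4.
    split; rewrite ltNge; apply: contraNN Ky => hy.
      by rewrite /K /node_kernel thz ?mulr0//; left.
    by rewrite /K /node_kernel thz ?mulr0//; right.
  have : cell_itv h j x.
    apply: (cell_itvP N0 L0 hN).
    by move: Dx; rewrite /= in_itv/= => /andP[/ltW -> ->].
  rewrite /cell_itv /= in_itv /= -natr1 mulrDr mulr1 => /andP[x1 x2].
  have y1 : h * (1/4 + j%:R) < y.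
    by rewrite -ltr_pdivlMl//; lra.
  have y2 : y < h * (3/4 + j%:R).
    by rewrite -ltr_pdivrMl//; lra.
  rewrite /ball /= ltr_norml; move: y1 y2; rewrite !mulrDr => y1 y2.
  by apply/andP; split; lra.
have ifK := @integrable_bounded_mul _ _ R leb D mD f K _ fi mK KB.
have iK2 := @integrable_scale _ _ R leb D mD (f x) K iK.
pose F y := (f y - f x) * K y.
have iF : leb.-integrable D (fun y => (F y)%:E).
  have := @integrable_sub _ _ R leb D mD _ _ ifK iK2.
  by apply: eq_integrable => // y _; rewrite /F mulrBl.
have -> : node_average th h L f j - f x = \int[leb]_(y in D) F y.
  rewrite /node_average -/K -[X in _ - X]mulr1 -K1.
  rewrite -(@RintegralZl _ _ _ leb D _ (f x) mD iK).
  rewrite -(@RintegralB _ _ _ leb D _ _ mD ifK iK2).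
  by apply: eq_Rintegral => y _; rewrite /F mulrBl.
rewrite -lee_fin.
apply: (@le_trans _ _ (\int[leb]_(y in D) `|(F y)%:E|)%E).
  rewrite -abse_EFin /Rintegral fineK; last exact: integrable_fin_num iF.
  by apply: le_abse_integral => //; exact: measurable_int iF.
have mF : measurable_fun D (fun y => `|(F y)%:E|%E).
  by apply: measurableT_comp => //; exact: measurable_int iF.
have mc : measurable_fun setT (fun y => `|(center (g x) \o g) y|%:E).
  apply: measurable_EFin_fun; apply: measurableT_comp => //.
  by apply: measurable_funB => //; exact: measurable_cst.
apply: (@le_trans _ _
    (\int[leb]_(y in ball x h) ((C / h)%:E * `|((center (g x) \o g) y)%:E|))%E).
  rewrite integral_mkcond [leRHS]integral_mkcond.
  apply: ge0_le_integral => //.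
  - by move=> y _; rewrite patchE; case: ifPn => // _; exact: abse_ge0.
  - exact: (measurable_restrictT _ mD).1 mF.
  - apply: (measurable_restrictT _ (measurable_ball x h)).1.
    by apply: measurable_funTS; apply: measurable_funeM; exact: mc.
  - move=> y _; rewrite !patchE; case: ifPn => [|_]; last first.
      by case: ifPn => // _; rewrite mule_ge0// lee_fin divr_ge0 ?ltW.
    rewrite inE => Dy; have [Ky|Ky] := eqVneq (K y) 0.
      rewrite /F Ky mulr0 abse0; case: ifPn => // _.
      by rewrite mule_ge0// lee_fin divr_ge0 ?ltW.
    rewrite mem_set; last exact: Ksupp.
    rewrite /F /= -EFinM lee_fin normrM mulrC gx {1}/g patchE mem_set//.
    by rewrite ler_wpM2r// KB.
rewrite ge0_integralZl//; last 3 first.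
- exact: measurable_ball.
- by apply: measurable_funTS; exact: mc.
- by rewrite lee_fin divr_ge0 ?ltW.
have := Hd h h0 hd; rewrite /davg /iavg (lebesgue_measure_ball x (ltW h0)) inver.
rewrite mulrn_eq0/= gt_eqF//= => H.
set I := (\int[leb]_(y in ball x h) _)%E.
have I0 : (0 <= I)%E by apply: integral_ge0.
rewrite (_ : (C / h)%:E = (2 * C)%:E * ((h *+ 2)^-1)%:E)%E; last first.
  by rewrite -EFinM; congr EFin; field; rewrite gt_eqF.
rewrite -muleA; apply: (@le_trans _ _ ((2 * C)%:E * (e / (2 * C))%:E)%E).
  by rewrite lee_wpmul2l// lee_fin mulr_ge0// ltW.
by rewrite -EFinM lee_fin mulrC divfK// gt_eqF// mulr_gt0.
Qed.

End node_average_convergence.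

Section uniform_estimates.
Variable R : realType.
Implicit Types (t s x y T e delta eta h : R) (a b : R -> nat -> R).

Definition grid_bounds (N : nat) h a b (A2 : R -> R) (B2 W2 : R) : Prop :=
  [/\ forall j, (j < N)%N -> forall t : R, 0 <= t ->
        is_derive t 1 (fun s => a s j) (b t j),
      forall t, 0 <= t -> h * (\sum_(j < N) a t j ^+ 2) <= A2 t,
      forall t, 0 <= t -> h * (\sum_(j < N) b t j ^+ 2) <= B2
    & forall t, 0 <= t -> h * (\sum_(i < N) bending N h (a t) i ^+ 2) <= W2].

Definition step_function (N : nat) h (c : R -> nat -> R) (z : R * R) : R :=
  c z.1 (cell N h z.2).

Lemma cell_dist_le (N : nat) h L x y : (0 < N)%N -> 0 < L -> h * N%:R = L ->
  0 <= x <= L -> 0 <= y <= L ->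
  h * `|(cell N h x)%:R - (cell N h y)%:R| <= `|x - y| + h.
Proof.
move=> N0 L0 hN hx hy; have h0 : 0 < h by move: L0; rewrite -hN pmulr_lgt0// ltr0n.
have /andP[x1 x2] := cell_dist N0 L0 hN hx.
have /andP[y1 y2] := cell_dist N0 L0 hN hy.
rewrite -[X in X * _](ger0_norm (ltW h0)) -normrM mulrBr.
have := ler_norm (x - y); have := ler_norm (y - x); rewrite (distrC y).
by rewrite ler_norml => *; apply/andP; split; lra.
Qed.

Lemma grid_slope_mono L (A A' W2 : R) : 0 < L -> A <= A' ->
  grid_slope L A W2 <= grid_slope L A' W2.
Proof.
move=> L0 AA; rewrite /grid_slope lerD2l ler_pM2r ?invr_gt0 ?exprn_gt0//.
by rewrite ler_pM2l// lerD2l.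
Qed.

Lemma step_function_bound (m : nat) h L a b A2 B2 W2 : (0 < m)%N -> 0 < L ->
  h * (m + m)%N%:R = L -> grid_bounds (m + m) h a b A2 B2 W2 ->
  forall z, 0 <= z.1 -> 0 <= z.2 <= L ->
    `|step_function (m + m) h a z| <= grid_sup L (A2 z.1) W2.
Proof.
move=> m0 L0 hN [_ aA _ aW] [t x] /= t0 hx.
apply: (grid_sup_bound m0 L0 hN (aA t t0) (aW t t0)).
by apply: cell_lt; rewrite addn_gt0 m0.
Qed.

Lemma step_function_equicontinuous L (A2 : R -> R) (B2 W2 T e : R) :
  0 < L -> 0 <= T -> 0 < e -> (forall s t, 0 <= s -> s <= t -> A2 s <= A2 t) ->
  0 <= A2 0 -> 0 <= B2 -> 0 <= W2 ->
  exists (delta eta : R), [/\ 0 < delta, 0 < eta & forall m h a b, (0 < m)%N ->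
    h * (m + m)%N%:R = L -> h <= eta -> grid_bounds (m + m) h a b A2 B2 W2 ->
    forall z z', strip T L z -> strip T L z' ->
      `|z.1 - z'.1| <= delta -> `|z.2 - z'.2| <= delta ->
      `|step_function (m + m) h a z - step_function (m + m) h a z'| <= e].
Proof.
move=> L0 T0 e0 mA A0 B0 W0.
pose P := grid_slope L (A2 T) W2.
have P0 : 0 <= P.
  have AT : 0 <= A2 T by apply: le_trans A0 _; exact: mA.
  rewrite /P /grid_slope addr_ge0 ?divr_ge0 ?mulr_ge0 ?addr_ge0 ?exprn_ge0//;
    exact: ltW.
pose r0 := Num.min L (e / (16 * (P + 1))).
have r00 : 0 < r0 by rewrite lt_min L0/= divr_gt0// mulr_gt0//; lra.
have r0L : r0 <= L by rewrite ge_min lexx.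
have r0e : P * r0 <= e / 16.
  have : r0 <= e / (16 * (P + 1)) by rewrite ge_min lexx orbT.
  rewrite ler_pdivlMr; last by rewrite mulr_gt0//; lra.
  nra.
pose del := Num.min 1 (Num.min (e / (4 * (P + 1))) (e ^+ 2 * r0 / (32 * (B2 + 1)))).
have del0 : 0 < del.
  rewrite !lt_min ltr01 !divr_gt0 ?mulr_gt0 ?exprn_gt0//; lra.
have del1 : del <= 1 by rewrite ge_min lexx.
have delP : P * del <= e / 4.
  have : del <= e / (4 * (P + 1)) by rewrite !ge_min lexx !orbT.
  rewrite ler_pdivlMr; last by rewrite mulr_gt0//; lra.
  nra.
have delB : B2 * del ^+ 2 <= e ^+ 2 * r0 / 32.
  have : del <= e ^+ 2 * r0 / (32 * (B2 + 1)) by rewrite !ge_min lexx !orbT.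
  rewrite ler_pdivlMr; last by rewrite mulr_gt0//; lra.
  have d2 : del ^+ 2 <= del by rewrite expr2 ger_pMr.
  have : B2 * del ^+ 2 <= B2 * del by rewrite ler_wpM2l.
  have : 0 <= del by exact: ltW.
  rewrite ler_pdivlMr//; nra.
pose eta := Num.min (r0 / 2) (e / (4 * (P + 1))).
have eta0 : 0 < eta by rewrite lt_min !divr_gt0// mulr_gt0//; lra.
exists del, eta; split => // m h a b m0 hN heta [dab aA aB aW] [t x] [s y].
move=> [/= tT hx] [/= sT hy] ts xy.
have [t0 tleT] := andP tT; have [s0 sleT] := andP sT.
have N0 : (0 < m + m)%N by rewrite addn_gt0 m0.
have h0 : 0 < h := grid_h_gt0 m0 L0 hN.
rewrite /step_function /=; set i := cell _ _ x; set j := cell _ _ y.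
have iN : (i < m + m)%N by exact: cell_lt.
have jN : (j < m + m)%N by exact: cell_lt.
have lipT r : 0 <= r <= T -> forall k l, (k < m + m)%N -> (l < m + m)%N ->
    `|a r k - a r l| <= P * (h * `|k%:R - l%:R|).
  move=> /andP[r1 r2] k l kN lN.
  apply: (le_trans (grid_lipschitz m0 L0 hN (aA r r1) (aW r r1) kN lN)).
  by rewrite ler_wpM2r ?mulr_ge0 ?(ltW h0)// grid_slope_mono// mA.
have space : `|a s i - a s j| <= e / 2.
  apply: (le_trans (lipT s sT i j iN jN)).
  have h1 := cell_dist_le N0 L0 hN hx hy.
  have h2 : P * h <= e / 4.
    have : h <= e / (4 * (P + 1)).
      by apply: (le_trans heta); rewrite ge_min lexx orbT.
    rewrite ler_pdivlMr; last by rewrite mulr_gt0//; lra.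
    nra.
  have : P * (h * `|i%:R - j%:R|) <= P * (del + h).
    by rewrite ler_wpM2l// (le_trans h1)// lerD2r.
  rewrite mulrDr; lra.
have hr : h <= r0 / 2 by apply: (le_trans heta); rewrite ge_min lexx.
pose k := Num.truncn (r0 / h).
have rh0 : 0 <= r0 / h by rewrite divr_ge0// ltW.
have hk1 : h * k%:R <= r0 by rewrite mulrC -ler_pdivlMr// truncn_le.
have hk2 : r0 / 2 <= h * k%:R.
  have : r0 < h * k.+1%:R by rewrite mulrC -ltr_pdivrMr// truncnS_gt.
  rewrite -[k.+1%:R]natr1 mulrDr mulr1; lra.
have k0 : (0 < k)%N.
  rewrite lt0n; apply/eqP => k0; move: hk2; rewrite k0 mulr0; lra.
have kN : (k <= m + m)%N.
  rewrite -(ler_nat R) -(ler_pM2l h0) hN; exact: le_trans r0L.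
have time : `|a t i - a s i| <= e / 2.
  have D2 : h * (\sum_(j < m + m) (a t j - a s j) ^+ 2) <= B2 * del ^+ 2.
    have bB r : 0 <= r -> \sum_(j < m + m) b r j ^+ 2 <= B2 / h.
      by move=> r0'; rewrite ler_pdivlMr// mulrC; exact: aB.
    have sq u v : 0 <= v -> v < u -> u - v <= del ->
        h * (\sum_(j < m + m) (a u j - a v j) ^+ 2) <= B2 * del ^+ 2.
      move=> v0 vu uv; have := l2_time_lipschitz dab bB v0 vu.
      rewrite -(ler_pM2l h0) => /le_trans; apply.
      rewrite (_ : h * (B2 / h * _) = B2 * (u - v) ^+ 2); last by field; rewrite gt_eqF.
      have uv0 : 0 <= u - v by rewrite subr_ge0 ltW.
      by rewrite ler_wpM2l// lerXn2r// nnegrE// ltW.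
    have [st|ts'|->] := ltgtP s t.
    - by apply: sq => //; apply: le_trans ts; exact: ler_norm.
    - under eq_bigr do rewrite -sqrrN opprB.
      by apply: sq => //; apply: le_trans ts; rewrite distrC; exact: ler_norm.
    - under eq_bigr do rewrite subrr expr0n.
      by rewrite big1// mulr0 mulr_ge0// sqr_ge0.
  have e4 : 0 < e / 4 by rewrite divr_gt0.
  have P2 : 0 <= 2 * P by rewrite mulr_ge0.
  have kk : (0 < k <= m + m)%N by rewrite k0.
  have H := @grid_interpolation R (m + m) h (fun j => a t j - a s j) _
    (2 * P) (e / 4) k i h0 e4 P2 kk iN D2.
  have {H} : `|a t i - a s i| <= e / 4 / 2 +
      B2 * del ^+ 2 / (2 * (e / 4) * (h * k%:R)) + 2 * P * (h * k%:R).
    apply: H => k' l k'N lN.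
    rewrite (_ : a t k' - a s k' - (a t l - a s l) =
      (a t k' - a t l) - (a s k' - a s l)); last ring.
    apply: (le_trans (ler_normB _ _)).
    have := lipT t tT k' l k'N lN; have := lipT s sT k' l k'N lN; lra.
  move=> /le_trans; apply.
  have h3 : 2 * P * (h * k%:R) <= e / 8.
    have : P * (h * k%:R) <= P * r0 by rewrite ler_wpM2l.
    by rewrite -mulrA; lra.
  have hk0 : 0 < h * k%:R by apply: lt_le_trans hk2; lra.
  have h4 : B2 * del ^+ 2 / (2 * (e / 4) * (h * k%:R)) <= e / 8.
    rewrite ler_pdivrMr; last by rewrite mulr_gt0// mulr_gt0.
    have : e ^+ 2 * (r0 / 2) <= e ^+ 2 * (h * k%:R) by rewrite ler_wpM2l// sqr_ge0.
    rewrite (_ : e / 8 * (2 * (e / 4) * (h * k%:R)) = e ^+ 2 * (h * k%:R) / 16); last by field.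
    lra.
  lra.
rewrite (_ : a t i - a s j = (a t i - a s i) + (a s i - a s j)); last ring.
apply: (le_trans (ler_normD _ _)); lra.
Qed.

End uniform_estimates.

Section affine_limits.
Context d (T : measurableType d) (R : realType).
Variable mu : {measure set T -> \bar R}.

Lemma affine_functional_limit (p : nat) (y : nat -> nat -> T -> R)
    (g : nat -> nat -> T -> R) (G Psi : nat -> T -> R) (A : R) :
  (forall k i, (i < p)%N -> sqint mu (y k i)) ->
  (forall i, (i < p)%N -> sqint mu (Psi i)) ->
  (forall m, hull (tail y m) (g m)) ->
  (forall i, (i < p)%N -> sqint mu (G i) /\ forall m,
      sqint mu (fun z => g m i z - G i z) /\
      nrm2 mu (fun z => g m i z - G i z) <= 1 / 2 ^+ m) ->
  (forall e : R, 0 < e -> exists K, forall k, (K <= k)%N ->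
    `|A + \sum_(i < p) \int[mu]_z (y k i z * Psi i z)| <= e) ->
  A + \sum_(i < p) \int[mu]_z (G i z * Psi i z) = 0.
Proof.
move=> sy sP hg hG H.
pose Lam (x : nat -> T -> R) := A + \sum_(i < p) \int[mu]_z (x i z * Psi i z).
have hullL (e : R) K : (forall k, (K <= k)%N -> `|Lam (y k)| <= e) ->
    forall x, hull (tail y K) x -> `|Lam x| <= e.
  move=> He x hx; elim: hx => [_ [k /= Kk <-]|a b {}x x' a0 b0 ab hx IH hx' IH'].
    exact: He.
  have -> : Lam (fun i z => a * x i z + b * x' i z) = a * Lam x + b * Lam x'.
    rewrite /Lam !mulrDr addrACA -mulrDl ab mul1r; congr (_ + _).
    rewrite !mulr_sumr -big_split/=; apply: eq_bigr => i _.
    have i1 := sqint_mul (hull_sqint sy hx (ltn_ord i)) (sP i (ltn_ord i)).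
    have i2 := sqint_mul (hull_sqint sy hx' (ltn_ord i)) (sP i (ltn_ord i)).
    rewrite -(RintegralZl a measurableT i1) -(RintegralZl b measurableT i2).
    rewrite -RintegralD//; [|exact: integrable_scale..].
    by apply: eq_Rintegral => z _; ring.
  apply: (le_trans (ler_normD _ _)); rewrite !normrM (ger0_norm a0) (ger0_norm b0).
  have : a * `|Lam x| <= a * e by rewrite ler_wpM2l.
  have : b * `|Lam x'| <= b * e by rewrite ler_wpM2l.
  have : a * e + b * e = e by rewrite -mulrDl ab mul1r.
  lra.
pose M := 1 + \sum_(i < p) nrm2 mu (Psi i).
have M0 : 0 < M.
  have : 0 <= \sum_(i < p) nrm2 mu (Psi i) by apply: sumr_ge0 => i _; exact: nrm2_ge0.
  rewrite /M; lra.
have close m (lam : R) : 0 < lam ->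
    `|Lam (g m) - Lam G| <= p%:R * (1 / 2 ^+ m) / lam + lam * M.
  move=> lam0; rewrite /Lam opprD addrACA subrr add0r -sumrB.
  apply: (le_trans (ler_norm_sum _ _ _)).
  have -> : p%:R * (1 / 2 ^+ m) / lam + lam * M =
      \sum_(i < p) (1 / 2 ^+ m / lam + lam * nrm2 mu (Psi i)) + lam.
    rewrite big_split/= sumr_const card_ord -mulr_sumr /M.
    rewrite -[X in _ = X + _ + _]mulr_natl mulrDr mulr1 [lam + _]addrC addrA.
    by congr (_ + _ + _); rewrite -[LHS]mulrA.
  apply: ler_wpDr; first exact: ltW.
  apply: ler_sum => i _; have ip := ltn_ord i.
  have [sG /(_ m)[sgG ngG]] := hG i ip.
  have sg := hull_sqint sy (hg m) ip.
  rewrite -(RintegralB measurableT (sqint_mul sg (sP i ip)) (sqint_mul sG (sP i ip))).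
  have ii := sqint_mul sgG (sP i ip).
  rewrite (_ : \int[mu]_z _ = \int[mu]_z ((g m i z - G i z) * Psi i z)); last first.
    by apply: eq_Rintegral => z _; rewrite mulrBl.
  apply: (le_trans (le_normr_Rintegral measurableT ii)).
  apply: (@le_trans _ _ (\int[mu]_z (lam^-1 * (g m i z - G i z) ^+ 2 +
      lam * Psi i z ^+ 2))).
    have j1 := integrable_scale measurableT lam^-1 sgG.2.
    have j2 := integrable_scale measurableT lam (sP i ip).2.
    apply: le_Rintegral => //; first exact: integrable_norm.
      exact: integrable_add.
    move=> z _; rewrite normrM.
    set s := `|g m i z - G i z|; set q := `|Psi i z|.
    rewrite -[(g m i z - G i z) ^+ 2]real_normK ?num_real// -/s.
    rewrite -[Psi i z ^+ 2]real_normK ?num_real// -/q.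
    have s0 : 0 <= s := normr_ge0 _. have q0 : 0 <= q := normr_ge0 _.
    rewrite -subr_ge0 (_ : _ - _ = lam^-1 * ((s - lam * q) ^+ 2 + lam * s * q)).
      have l0 := ltW lam0; apply: mulr_ge0; first by rewrite invr_ge0.
      by rewrite addr_ge0 ?sqr_ge0// !mulr_ge0.
    by field; rewrite gt_eqF.
  have j1 := integrable_scale measurableT lam^-1 sgG.2.
  have j2 := integrable_scale measurableT lam (sP i ip).2.
  rewrite (RintegralD measurableT j1 j2) (RintegralZl _ measurableT sgG.2).
  rewrite (RintegralZl _ measurableT (sP i ip).2) lerD2r mulrC ler_pM2r ?invr_gt0//.
apply/eqP; rewrite -normr_le0 -[X in `|X|]/(Lam G); apply/ler_addgt0Pl => e e0.
rewrite addr0; have e3 : 0 < e / 3 by rewrite divr_gt0.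
pose lam := e / (3 * M).
have lam0 : 0 < lam by rewrite divr_gt0// mulr_gt0.
have lamM : lam * M = e / 3 by rewrite /lam; field; rewrite gt_eqF.
have [K HK] := H _ e3.
have [m0 Hm0] := small_geometric (p%:R / lam) e3.
pose m := maxn K m0.
have h1 : `|Lam (g m)| <= e / 3.
  apply: (hullL _ K) => //; apply: hull_tail_sub (hg m); exact: leq_maxl.
have h2 := close m lam lam0; rewrite lamM in h2.
have h3 : p%:R * (1 / 2 ^+ m) / lam <= e / 3.
  apply: le_trans Hm0; rewrite mul1r mulrAC. have pl : 0 <= p%:R / lam by rewrite divr_ge0// ltW.
  apply: ler_wpM2l => //; rewrite lef_pV2 ?posrE ?exprn_gt0//.
  by rewrite ler_weXn2l ?ler1n// leq_maxr.
rewrite (_ : Lam G = Lam (g m) - (Lam (g m) - Lam G)); last ring.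
apply: (le_trans (ler_normB _ _)); lra.
Qed.

Lemma weighted_integral_small (F f : T -> R) (S : set T) (e c C : R) :
  measurable S -> (mu S < +oo)%E -> 0 <= e -> 0 <= c ->
  measurable_fun setT F -> sqint mu f -> nrm2 mu f <= C ->
  (forall z, `|F z| <= e * (\1_S z + c * f z ^+ 2)) ->
  mu.-integrable setT (fun z => (F z)%:E) /\
  `|\int[mu]_z F z| <= e * (fine (mu S) + c * C).
Proof.
move=> mS Sfin e0 c0 mF sf fC FB.
have iS : mu.-integrable setT (fun z => (\1_S z : R)%:E).
  apply/integrableP; split.
    by apply: measurable_EFin_fun; exact: measurable_indic.
  under eq_integral do rewrite /= ger0_norm//.
  by rewrite integral_indic// setIT.
have i2 := integrable_scale measurableT c sf.2.
have i3 := integrable_add measurableT iS i2.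
have i4 := integrable_scale measurableT e i3.
have iF : mu.-integrable setT (fun z => (F z)%:E).
  apply: le_integrable i4 => //; first exact: measurable_EFin_fun.
  by move=> z _ /=; rewrite lee_fin (le_trans (FB z))// ler_norm.
split => //; apply: (le_trans (le_normr_Rintegral measurableT iF)).
apply: (@le_trans _ _ (\int[mu]_z (e * (\1_S z + c * f z ^+ 2)))).
  by apply: le_Rintegral => //; first exact: integrable_norm.
rewrite (RintegralZl e measurableT i3) (RintegralD measurableT iS i2).
rewrite (RintegralZl c measurableT sf.2) ler_wpM2l//.
rewrite {1}/Rintegral integral_indic// setIT lerD2l ler_wpM2l//.
Qed.

End affine_limits.

Section space_time_integrals.
Variable R : realType.
Local Notation leb := (@lebesgue_measure R).
Local Notation leb2 := (leb \x leb)%E.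
Variable L : R.
Hypothesis L0 : 0 < L.
Local Notation D := (`]0, L[%classic : set R).
Local Notation Time := (`]0, +oo[%classic : set R).
Implicit Types (F : R * R -> R) (t x B T : R).

Let mD : measurable D. Proof. exact: measurable_itv. Qed.
Let mT : measurable Time. Proof. exact: measurable_itv. Qed.

Lemma measurable_domain : measurable (domain L).
Proof. exact: measurableX. Qed.

Lemma iterated_integral F : leb2.-integrable setT (fun z => (F z)%:E) ->
  (forall z, ~ domain L z -> F z = 0) ->
  \int[leb]_(t in Time) \int[leb]_(x in D) F (t, x) = \int[leb2]_z F z.
Proof.
move=> iF F0.
have E (t : R) : Time t -> \int[leb]_(x in D) F (t, x) = \int[leb]_x F (t, x).
  move=> t0; rewrite Rintegral_mkcond; apply: eq_Rintegral => x _.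
  rewrite patchE; case: ifPn => // /negP; rewrite inE => xD.
  by rewrite F0// => -[].
rewrite (_ : \int[leb]_(t in Time) _ = \int[leb]_(t in Time) \int[leb]_x F (t, x)).
  rewrite Rintegral_mkcond (_ : _ \_ _ = fun t => \int[leb]_x F (t, x)).
  rewrite /Rintegral -integral12_prod_meas1//; congr fine.
  have mF : measurable_fun setT (fun z => (F z)%:E) by exact: measurable_int iF.
  have mFF := measurable_fubini_F iF.
  apply: ae_eq_integral => //.
    by apply/measurable_EFinP; apply: measurableT_comp.
  apply: filterS (ae_integrable1 iF) => t it _.
  by rewrite fineK// integrable_fin_num.
apply/funext => t; rewrite patchE; case: ifPn => // /negP; rewrite inE => tD.
  by rewrite /Rintegral integral0_eq// => x _; rewrite F0// => -[].
by apply: eq_Rintegral => t; rewrite inE; exact: E.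
Qed.

Lemma measurable_weight (a : R) : measurable_fun setT (fun z : R * R => expR (a * z.1)).
Proof.
by apply: (measurableT_comp (@measurable_expR R)); apply: measurable_funM.
Qed.

Variables (N : nat) (h : R).
Hypotheses (N0 : (0 < N)%N) (hN : h * N%:R = L).
Implicit Types c : R -> nat -> R.

Lemma step_functionE c t x : Time t -> D x ->
  (step_function N h c \_ (domain L)) (t, x) = c t (cell N h x).
Proof. by move=> tT xD; rewrite patchE mem_set. Qed.

Lemma measurable_step c : (forall j, (j < N)%N -> measurable_fun Time (c^~ j)) ->
  measurable_fun setT (step_function N h c \_ (domain L)).
Proof.
move=> mc; rewrite (_ : _ \_ _ = fun z => \sum_(j < N)
   ((c^~ j) \_ Time) z.1 * \1_(cell_itv h j `&` D) z.2).
  apply: measurable_sum => j; apply: measurable_funM.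
    apply: measurableT_comp; last exact: measurable_fst.
    have mcj := mc j (ltn_ord j); apply/(measurable_restrictT _ mT).
    exact: mcj.
  apply: measurableT_comp; last exact: measurable_snd.
  apply: measurable_indic; apply: measurableI => //; exact: measurable_cell_itv.
apply/funext => -[t x] /=; rewrite patchE.
case: ifPn => [|/negP]; rewrite inE.
  move=> [/= tT xD]; rewrite /step_function/=.
  have xL : 0 <= x < L by move: xD; rewrite /= in_itv/= => /andP[/ltW -> ->].
  rewrite -(@sum_cell _ _ _ _ N0 L0 hN (c t) x xL); apply: eq_bigr => j _.
  rewrite patchE mem_set//; congr (_ * _); rewrite !indicE; congr (_%:R).
  by congr nat_of_bool; rewrite in_setI [x \in D]mem_set// andbT.
move=> nD; rewrite big1// => j _; rewrite patchE indicE.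
case: ifPn; rewrite ?mul0r// inE => tT.
by rewrite in_setI [x \in D]memNset ?andbF ?mulr0// => xD; apply: nD.
Qed.

Lemma sqint_step c B : (forall j, (j < N)%N -> measurable_fun Time (c^~ j)) ->
  0 <= B -> (forall t, 0 < t -> h * (\sum_(j < N) c t j ^+ 2) <= B) ->
  let f z := expR (- z.1) * (step_function N h c \_ (domain L)) z in
  sqint leb2 f /\ nrm2 leb2 f <= B.
Proof.
move=> mc B0 cB f.
have mf : measurable_fun setT f.
  apply: measurable_funM; last exact: measurable_step.
  by under eq_fun do rewrite -mulN1r; exact: measurable_weight.
have mf2 : measurable_fun setT (fun z => (f z ^+ 2)%:E).
  by apply: measurable_EFin_fun; exact: measurable_funX.
have f20 z : (0 <= (f z ^+ 2)%:E)%E by rewrite lee_fin sqr_ge0.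
apply: sqint_bound => //; rewrite fubini_tonelli1//.
pose p (t : R) : R := exponential_pdf 2 t.
have mp : measurable_fun setT (fun t => (B * p t)%:E).
  apply: measurable_EFin_fun; apply: measurable_funM => //.
  exact: measurable_exponential_pdf.
have p0 t : 0 <= p t by apply: exponential_pdf_ge0.
have inner (t : R) : (\int[leb]_x (f (t, x) ^+ 2)%:E <= (B * p t)%:E)%E.
  have [t0|t0] := ltP 0 t; last first.
    rewrite integral0_eq ?lee_fin ?mulr_ge0// => x _.
    rewrite /f patchE memNset ?mulr0 ?expr0n// => -[/= + _].
    by rewrite in_itv/= andbT ltNge t0.
  have tT : Time t by rewrite /= in_itv/= andbT.
  have [i1 i2] := @integral_cell _ _ _ _ N0 L0 hN (fun j => expR (- t) ^+ 2 * c t j ^+ 2).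
  have -> : (\int[leb]_x (f (t, x) ^+ 2)%:E = \int[leb]_(x in D)
      (expR (- t) ^+ 2 * c t (cell N h x) ^+ 2)%:E)%E.
    rewrite [RHS]integral_mkcond; apply: eq_integral => x _; rewrite patchE.
    case: ifPn => [|/negP]; rewrite inE => xD; first by rewrite /f step_functionE// exprMn.
    by rewrite /f patchE memNset ?mulr0 ?expr0n// => -[].
  rewrite (@eq_ge0_integral_Rintegral _ _ R leb D mD _ i1) i2 lee_fin -mulr_sumr.
  rewrite /p exponential_pdfE ?(ltW t0)// mulrCA -expRM_natl mulrN mulNr.
  have := cB t t0; have := expR_ge0 (- (2 * t)).
  set E := expR _; set S := h * _ => E0 SB.
  apply: (@le_trans _ _ (E * B)); first exact: ler_wpM2l.
  by rewrite mulrC ler_wpM2l// ler_peMl// ler1n.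
apply: (@le_trans _ _ (\int[leb]_t (B * p t)%:E)%E).
  apply: ge0_le_integral => //.
  - by move=> t _; apply: integral_ge0.
  - by apply: measurable_fun_fubini_tonelli_F.
  - by move=> t _; exact: inner.
under eq_integral do rewrite EFinM.
rewrite ge0_integralZl_EFin//.
- by rewrite integral_exponential_pdf// mule1.
- by move=> t _; rewrite lee_fin.
- by apply: measurable_EFin_fun; exact: measurable_exponential_pdf.
Qed.

Lemma integral_step_function c T : 0 < T ->
  leb2.-integrable setT (fun z => ((step_function N h c \_ (domain L)) z)%:E) ->
  (forall t j, T <= t -> (j < N)%N -> c t j = 0) ->
  measurable_fun (`[0, T]%classic : set R) (fun t => \sum_(j < N) c t j) ->
  \int[leb2]_z (step_function N h c \_ (domain L)) z =
  \int[leb]_(t in `[0, T]) (h * \sum_(j < N) c t j).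
Proof.
move=> T0 ic cT mc; rewrite -iterated_integral//; last first.
  by move=> z zD; rewrite patchE memNset.
transitivity (\int[leb]_(t in Time) (h * \sum_(j < N) c t j)).
  apply: eq_Rintegral => t; rewrite inE => tT.
  have [_ <-] := @integral_cell _ _ _ _ N0 L0 hN (c t).
  by apply: eq_Rintegral => x; rewrite inE => xD; rewrite step_functionE.
have cT0 t : T <= t -> h * (\sum_(j < N) c t j) = 0.
  by move=> Tt; rewrite big1 ?mulr0// => j _; rewrite cT.
rewrite /Rintegral -[in RHS]integral_itv_obnd_cbnd; last first.
  apply: measurable_EFin_fun; apply: measurable_funM => //.
  apply: measurable_funS mc => // t; rewrite /= !in_itv/= => /andP[/ltW ->].
  exact.
congr fine; rewrite integral_mkcond [RHS]integral_mkcond.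
apply: eq_integral => t _; rewrite !patchE.
have [t0|t0] := ltP 0 t; last first.
  by rewrite !memNset//= in_itv/= ltNge t0.
rewrite mem_set; last by rewrite /= in_itv/= t0.
have [tT|Tt] := leP t T; first by rewrite mem_set//= in_itv/= t0 tT.
by rewrite cT0 ?(ltW Tt)//; case: ifP.
Qed.

End space_time_integrals.

Section test_functions.
Variable R : realType.
Implicit Types (phi : R * R -> R) (t s x y T M L h : R).

Lemma compact_image_bound (U : topologicalType) (f : U -> R) (K : set U) :
  compact K -> continuous f -> exists2 M, 0 < M & forall z, K z -> `|f z| <= M.
Proof.
move=> cK cf.
have /compact_bounded [M [_ HM]] :=
  continuous_compact (continuous_subspaceT cf : {within K, continuous f}) cK.
exists (`|M| + 1); first by rewrite ltr_wpDl.
move=> z Kz; apply: (HM (`|M| + 1)); last by exists z.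
by rewrite (le_lt_trans (ler_norm _))// ltrDl.
Qed.

Definition compact_smooth phi := (forall k, Ck k phi) /\
  exists2 T, 0 < T & forall z, T <= `|z.1| \/ T <= `|z.2| -> phi z = 0.

Lemma test_function_compact_smooth (D : set (R * R)) phi :
  test_function2 D phi -> compact_smooth phi.
Proof.
move=> [sphi [K [cK _ K0]]]; split => //.
have [M1 M10 H1] := compact_image_bound cK (fun z => cvg_fst : fst x @[x --> z] --> z.1).
have [M2 M20 H2] := compact_image_bound cK (fun z => cvg_snd : snd x @[x --> z] --> z.2).
exists (M1 + M2 + 1); first lra.
by move=> z Hz; apply: K0 => Kz; have := H1 z Kz; have := H2 z Kz; case: Hz; lra.
Qed.

Lemma derive1_local0 (f : R -> R) x d : 0 < d ->
  (forall y, `|y - x| < d -> f y = 0) -> derive1 f x = 0.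
Proof.
move=> d0 H; rewrite derive1E (@near_eq_derive _ _ _ f (cst 0)) ?derive_cst//.
apply/nbhs_ballP; exists d => // y; rewrite /ball/= distrC => xy.
by rewrite /cst/=; exact: H.
Qed.

Lemma compact_smooth_dt phi : compact_smooth phi -> compact_smooth (d_t phi).
Proof.
move=> [sphi [T T0 phi0]]; split; first by move=> k; have [_ []] := sphi k.+1.
exists (T + 1); first lra.
move=> [t x] /= H; apply: (@derive1_local0 _ _ 1) => // s /=.
rewrite ltr_norml => /andP[s1 s2]; apply: phi0 => /=.
case: H; [left|right; lra].
by have := ler_normD s (t - s); rewrite subrKC; have : `|t - s| <= 1; [rewrite ler_norml; lra|lra].
Qed.

Lemma compact_smooth_dx phi : compact_smooth phi -> compact_smooth (d_x phi).
Proof.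
move=> [sphi [T T0 phi0]]; split; first by move=> k; have [_ []] := sphi k.+1.
exists (T + 1); first lra.
move=> [t x] /= H; apply: (@derive1_local0 _ _ 1) => // s /=.
rewrite ltr_norml => /andP[s1 s2]; apply: phi0 => /=.
case: H; [left; lra|right].
by have := ler_normD s (x - s); rewrite subrKC; have : `|x - s| <= 1; [rewrite ler_norml; lra|lra].
Qed.

Lemma compact_smooth_continuous phi : compact_smooth phi -> continuous phi.
Proof. by case=> /(_ 0%N)[]. Qed.

Lemma compact_smooth_bound phi : compact_smooth phi ->
  exists2 M, 0 < M & forall z, `|phi z| <= M.
Proof.
move=> sphi; have [_ [T T0 phi0]] := sphi.
have cK : compact (`[- T, T]%classic `*` `[- T, T]%classic : set (R * R)).
  by apply: compact_setX; exact: segment_compact.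
have [M M0 HM] := compact_image_bound cK (compact_smooth_continuous sphi).
exists M => // -[t x]; have [tT|tT] := leP `|t| T; have [xT|xT] := leP `|x| T.
- by apply: HM; split; rewrite /= in_itv/= -ler_norml.
all: rewrite phi0 ?normr0 ?(ltW M0)//=; by [left; exact: ltW|right; exact: ltW].
Qed.

Lemma is_derive_dt phi t x : compact_smooth phi ->
  is_derive t 1 (fun s => phi (s, x)) (d_t phi (t, x)).
Proof.
case=> /(_ 1%N)[_ [H _ _ _]] _; rewrite /d_t derive1E/=.
exact: DeriveDef (H t x) erefl.
Qed.

Lemma is_derive_dx phi t x : compact_smooth phi ->
  is_derive x 1 (fun y => phi (t, y)) (d_x phi (t, x)).
Proof.
case=> /(_ 1%N)[_ [_ H _ _]] _; rewrite /d_x derive1E/=.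
exact: DeriveDef (H t x) erefl.
Qed.

Lemma compact_smooth_section phi x : compact_smooth phi ->
  continuous (fun t => phi (t, x)) /\ continuous (fun y => phi (x, y)).
Proof.
by move=> sphi; split => z; apply: is_derive_continuous; [exact: is_derive_dt|
  exact: is_derive_dx].
Qed.

Lemma compact_smooth_lipschitz phi : compact_smooth phi ->
  exists2 M, 0 < M & forall t x y, `|phi (t, x) - phi (t, y)| <= M * `|x - y|.
Proof.
move=> sphi; have [M M0 HM] := compact_smooth_bound (compact_smooth_dx sphi).
exists M => // t x y; wlog xy : x y / y < x => [H|].
  have [xy|yx|->] := ltgtP x y; last by rewrite !subrr normr0 mulr0.
    by rewrite distrC [`|x - y|]distrC; exact: H.
  exact: H.
have [|c _ ->] := @mean_value R (fun y => phi (t, y)) (fun y => d_x phi (t, y))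
  y x xy (fun z _ => is_derive_dx t z sphi).
  by apply: continuous_subspaceT; have [] := compact_smooth_section t sphi.
by rewrite normrM ler_wpM2r.
Qed.

Lemma second_diff_error phi : compact_smooth phi -> exists2 M, 0 < M &
  forall t x y h, 0 < h ->
    `|(phi (t, y + 2 * h) - 2 * phi (t, y + h) + phi (t, y)) / h ^+ 2 -
      d_x (d_x phi) (t, x)| <= M * (`|y - x| + 2 * h).
Proof.
move=> sphi; have sx := compact_smooth_dx sphi.
have [M M0 HM] := compact_smooth_lipschitz (compact_smooth_dx sx).
exists M => // t x y h h0.
have [c /andP[c1 c2] ->] := @second_diff_mean _ (fun y => phi (t, y))
  (fun y => d_x phi (t, y)) (fun y => d_x (d_x phi) (t, y)) y h h0
  (fun z => is_derive_dx t z sphi) (fun z => is_derive_dx t z sx).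
apply: (le_trans (HM _ _ _)); rewrite ler_wpM2l ?(ltW M0)//.
have -> : c - x = (y - x) + (c - y) by ring.
by apply: (le_trans (ler_normD _ _)); rewrite lerD2l ger0_norm; lra.
Qed.

Lemma test_function_domain_margin L phi : 0 < L -> test_function2 (domain L) phi ->
  (forall t x, t <= 0 -> phi (t, x) = 0) /\
  exists2 eta, 0 < eta & forall t x, x <= 0 \/ L - eta <= x -> phi (t, x) = 0.
Proof.
move=> L0 [_ [K [cK KD K0]]]; split.
  by move=> t x t0; apply: K0 => /KD[] /=; rewrite in_itv/= andbT ltNge t0.
have [[z0 Kz0]|K00] := pselect (K !=set0); last first.
  by exists 1 => // t x _; apply: K0 => Kz; apply: K00; exists (t, x).
have cf : {within K, continuous (fun z : R * R => z.2)}.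
  by apply: continuous_subspaceT => z; exact: cvg_snd.
have [c] := compact_EVT_max (ex_intro _ z0 Kz0) cK cf.
rewrite inE => Kc cmax; have [_] := KD _ Kc; rewrite /= in_itv/= => /andP[_ cL].
exists ((L - c.2) / 2); first by rewrite divr_gt0// subr_gt0.
move=> t x H; apply: K0 => Kz; have := cmax (t, x); rewrite inE => /(_ Kz)/=.
have [_] := KD _ Kz; rewrite /= in_itv/= => /andP[? ?].
by case: H; lra.
Qed.

End test_functions.

Section supported_functions.
Variable R : realType.
Local Notation leb := (@lebesgue_measure R).
Local Notation leb2 := (leb \x leb)%E.
Local Notation Time := (`]0, +oo[%classic : set R).
Implicit Types (F f phi u : R * R -> R) (t x B T L h C e : R).

Lemma continuous_at_measurable (A : set R) (f : R -> R) : measurable A ->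
  (forall t, A t -> {for t, continuous f}) -> measurable_fun A f.
Proof.
move=> mA cf; apply: subspace_continuous_measurable_fun => //.
by apply: continuous_in_subspaceT => t; rewrite inE; exact: cf.
Qed.

Definition box L T : set (R * R) := `]0, T[ `*` `]0, L[.

Lemma measurable_box L T : measurable (box L T).
Proof. exact: measurableX. Qed.

Lemma box_measure L T : 0 < L -> 0 < T -> leb2 (box L T) = (T * L)%:E.
Proof.
move=> L0 T0.
have E (a : R) : 0 < a -> leb `]0, a[%classic = a%:E.
  by move=> a0; rewrite lebesgue_measure_itv/= lte_fin a0 -EFinB subr0.
transitivity (leb `]0%R, T[%classic * leb `]0%R, L[%classic)%E.
  by apply: product_measure1E; exact: measurable_itv.
by rewrite !E// -EFinM.
Qed.

Lemma integrable_box_bounded f L T B : 0 < L -> 0 < T -> 0 <= B -> measurable_fun setT f ->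
  (forall z, `|f z| <= B * \1_(box L T) z) ->
  leb2.-integrable setT (fun z => (f z)%:E).
Proof.
move=> L0 T0 B0 mf fB.
have iB : leb2.-integrable setT (fun z => (B * \1_(box L T) z)%:E).
  apply/integrableP; split.
    apply: measurable_EFin_fun; apply: measurable_funM => //.
    by apply: measurable_indic; exact: measurable_box.
  under eq_integral do rewrite /= normrM [X in _ * X]ger0_norm// EFinM.
  rewrite ge0_integralZl_EFin//.
    rewrite integral_indic ?setIT//; last exact: measurable_box.
    by rewrite [X in (_ * X)%E](box_measure L0 T0) -EFinM ltry.
  by apply: measurable_EFin_fun; apply: measurable_indic; exact: measurable_box.
apply: le_integrable iB => //; first exact: measurable_EFin_fun.
by move=> z _; rewrite lee_fin (le_trans (fB z))// ler_norm.
Qed.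

Lemma sqint_box_bounded f L T B : 0 < L -> 0 < T -> 0 <= B -> measurable_fun setT f ->
  (forall z, `|f z| <= B * \1_(box L T) z) -> sqint leb2 f.
Proof.
move=> L0 T0 B0 mf fB; split => //.
apply: (@integrable_box_bounded _ L T (B ^+ 2)) => //; first exact: sqr_ge0.
  exact: measurable_funX.
move=> z; rewrite normrX; have := fB z; rewrite indicE.
case: (_ \in _); rewrite ?mulr1 ?mulr0 => H.
  by rewrite ler_pXn2r// nnegrE//; exact: le_trans H.
by rewrite (_ : `|f z| = 0) ?expr0n//; apply/eqP; rewrite -normr_le0 normr_id.
Qed.

Lemma measurable_compact_smooth phi L : 0 < L -> compact_smooth phi ->
  measurable_fun setT (phi \_ (domain L)).
Proof.
move=> L0 sphi; pose h (k : nat) : R := L / k.+1%:R.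
have hN k : h k * k.+1%:R = L by rewrite /h divfK.
have [M M0 HM] := compact_smooth_lipschitz sphi.
apply: (@measurable_fun_cvg _ _ _ _ (fun k =>
  step_function k.+1 (h k) (fun t j => phi (t, h k * j%:R)) \_ (domain L))).
  move=> k; apply: (measurable_step L0 _ (hN k)) => // j _.
  apply: continuous_at_measurable; first exact: measurable_itv.
  by move=> t _; have [+ _] := compact_smooth_section (h k * j%:R) sphi; apply.
move=> [t x] _; have [[tT xD]|nD] := pselect (domain L (t, x)); last first.
  by rewrite patchE memNset//; under eq_cvg do rewrite patchE memNset//; exact: cvg_cst.
rewrite patchE mem_set//; apply/cvgrPdist_le => e e0.
near=> k; rewrite step_functionE//.
apply: (le_trans (HM _ _ _)).
have x0 : 0 <= x <= L by move: xD; rewrite /= in_itv/= => /andP[/ltW -> /ltW ->].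
have := @cell_dist _ _ _ _ (ltn0Sn k) L0 (hN k) x x0.
set q := x - _ => /andP[q0 qh]; rewrite ger0_norm// -ler_pdivlMl//.
apply: (le_trans qh); rewrite /h ler_pdivrMr// -ler_pdivrMl ?mulr_gt0 ?invr_gt0//.
apply: (@le_trans _ _ k%:R); last by rewrite ler_nat.
near: k; exact: nbhs_infty_ger.
Unshelve. all: by end_near. Qed.

Variables (L : R).
Hypothesis L0 : 0 < L.

Lemma weighted_test phi : compact_smooth phi ->
  sqint leb2 ((fun z => expR z.1 * phi z) \_ (domain L)).
Proof.
move=> sphi; have [_ [T T0 phi0]] := sphi.
have [M M0 HM] := compact_smooth_bound sphi.
apply: (@sqint_box_bounded _ L T (expR T * M)) => //; first by rewrite mulr_ge0 ?expR_ge0// ltW.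
  rewrite (_ : _ \_ _ = fun z => expR (1 * z.1) * (phi \_ (domain L)) z).
    apply: measurable_funM; last exact: measurable_compact_smooth.
    exact: measurable_weight.
  by apply/funext => z; rewrite !patchE mul1r; case: ifP; rewrite ?mulr0.
move=> [t x]; rewrite patchE; case: ifPn => [|_]; rewrite ?inE.
  move=> [/= tT xD]; move: (tT); rewrite /= in_itv/= andbT => t0.
  have [Tt|tT'] := leP T t.
    rewrite phi0 ?mulr0 ?normr0 ?mulr_ge0 ?expR_ge0 ?(ltW M0)//=.
    by left; rewrite ger0_norm// ltW.
  rewrite indicE mem_set; last by split => //=; rewrite in_itv/= t0.
  rewrite mulr1 normrM ger0_norm ?expR_ge0// ler_pM ?expR_ge0// ler_expR.
  exact: ltW.
by rewrite normr0 mulr_ge0// mulr_ge0 ?expR_ge0// ltW.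
Qed.

(* The time weight is compensated on the support of the test function:
   [|q| <= 1 + q ^ 2] and [q = expR t * f] with [t <= T]. *)
Lemma residual_bound (N : nat) h (c : R -> nat -> R) F f C T e :
  (0 < N)%N -> h * N%:R = L -> 0 < T -> 0 <= e ->
  leb2.-integrable setT (fun z => (F z)%:E) ->
  sqint leb2 f -> nrm2 leb2 f <= C ->
  (forall j, (j < N)%N -> forall t, 0 <= t -> {for t, continuous (c^~ j)}) ->
  (forall t j, T <= t -> (j < N)%N -> c t j = 0) ->
  (forall z, ~ box L T z -> F z = 0) ->
  (forall t x, box L T (t, x) ->
     `|F (t, x) - c t (cell N h x)| <= e * (1 + `|expR t * f (t, x)|)) ->
  `|\int[leb2]_z F z - \int[leb]_(t in `[0, T]) (h * \sum_(j < N) c t j)| <=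
    2 * e * (T * L + expR T ^+ 2 / 2 * C).
Proof.
move=> N0 hN T0 e0 iF sf fC cc cT F0 Fc.
pose S := step_function N h c \_ (domain L).
have mS : measurable_fun setT S.
  apply: (measurable_step L0 N0 hN) => j jN.
  apply: continuous_at_measurable; first exact: measurable_itv.
  by move=> t; rewrite /= in_itv/= andbT => /ltW; exact: cc.
have S0 z : ~ box L T z -> S z = 0.
  case: z => t x nz; rewrite /S patchE; case: ifPn => //; rewrite inE => -[/= tT xD].
  rewrite /step_function/= cT//; last exact: cell_lt.
  rewrite leNgt; apply/negP => tT'; apply: nz; split => //.
  move: tT; rewrite /= !in_itv/= andbT tT'. by move=> ->.
have mF : measurable_fun setT F by apply/measurable_EFinP; exact: measurable_int iF.
have bS : (leb2 (box L T) < +oo)%E by rewrite box_measure// ltry.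
have e20 : 0 <= 2 * e by rewrite mulr_ge0.
have T20 : 0 <= expR T ^+ 2 / 2 by rewrite divr_ge0// sqr_ge0.
have [|z|iFS FS] := @weighted_integral_small _ _ _ leb2 (fun z => F z - S z) f
  (box L T) _ _ C (measurable_box L T) bS e20 T20 _ sf fC.
- exact: measurable_funB.
- have [bz|nbz] := pselect (box L T z); last first.
    rewrite F0// S0// subrr normr0; apply: mulr_ge0 => //; apply: addr_ge0 => //.
    by apply: mulr_ge0 => //; exact: sqr_ge0.
  case: z bz => t x bz; have [/= tT xD] := bz; have := Fc _ _ bz.
  have tT0 : Time t by move: tT; rewrite /= !in_itv/= andbT => /andP[].
  rewrite /S step_functionE// indicE mem_set// mulr1n => H; apply: (le_trans H).
  rewrite -mulrA mulrCA ler_wpM2l//.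
  have tT1 : expR t <= expR T.
    by rewrite ler_expR; move: tT; rewrite /= in_itv/= => /andP[_ /ltW].
  have : `|expR t * f (t, x)| <= expR T * `|f (t, x)|.
    by rewrite normrM ger0_norm ?expR_ge0// ler_wpM2r.
  rewrite -[f (t, x) ^+ 2]real_normK ?num_real//.
  set q := `|f (t, x)|; set a := expR T.
  set X := `|_ * _|; have := sqr_ge0 (a * q); have := sqr_ge0 (a * q - 1).
  rewrite sqrrB1 exprMn; lra.
have iS : leb2.-integrable setT (fun z => (S z)%:E).
  have := integrable_sub measurableT iF iFS; apply: eq_integrable => // z _.
  by rewrite /= subKr.
have -> : \int[leb]_(t in `[0, T]) (h * \sum_(j < N) c t j) = \int[leb2]_z S z.
  rewrite (integral_step_function L0 N0 hN T0 iS)//.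
  apply: continuous_at_measurable; first exact: measurable_itv.
  move=> t; rewrite /= in_itv/= => /andP[t0 _].
  by apply: (@continuous_sum_at _ _ (fun j t => c t j)) => j jN; exact: cc.
rewrite -(RintegralB measurableT iF iS); apply: (le_trans FS).
have E : fine (leb2 (box L T)) = T * L by rewrite box_measure.
by rewrite -E.
Qed.

End supported_functions.

Section residuals.
Variable R : realType.
Local Notation leb := (@lebesgue_measure R).
Local Notation leb2 := (leb \x leb)%E.
Local Notation Time := (`]0, +oo[%classic : set R).
Implicit Types (F f phi theta : R * R -> R) (t x T e : R).
Record scheme_limit (L rho mu : R) (g : nat -> R -> R) (B B2 W2 : R) (N : nat -> nat)
    (h : nat -> R) (a b : nat -> R -> nat -> R) (u : R * R -> R) : Prop := SchemeLimit {
  sl_lipschitz : exists Kg : nat -> R, forall k x y,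
    `|g k x - g k y| <= Kg k * `|x - y| ;
  sl_force_bound : forall k x, `|g k x| <= B ;
  sl_size : forall k, (0 < N k)%N ;
  sl_mesh : forall k, h k * (N k)%:R = L ;
  sl_solution : forall k, scheme_solution (N k) (h k) rho mu (g k) (a k) (b k) ;
  sl_velocity : forall k t, 0 <= t -> h k * (\sum_(j < N k) b k t j ^+ 2) <= B2 ;
  sl_bending : forall k t, 0 <= t ->
    h k * (\sum_(j < N k) bending (N k) (h k) (a k t) j ^+ 2) <= W2 ;
  sl_mesh_cvg : forall e, 0 < e -> exists K, forall k, (K <= k)%N -> h k <= e ;
  sl_cvg : forall T e, 0 < e -> exists K, forall k, (K <= k)%N -> forall z,
    strip T L z -> `|step_function (N k) (h k) (a k) z - u z| <= e ;
  sl_bound : forall T, exists2 M, 0 < M & forall k z, strip T L z ->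
    `|step_function (N k) (h k) (a k) z| <= M }.

Variables (L rho mu : R).
Hypotheses (L0 : 0 < L) (rho0 : 0 < rho) (mu0 : 0 < mu).
Local Notation D := (`]0, L[%classic : set R).
Variables (g : nat -> R -> R) (B B2 W2 : R) (N : nat -> nat) (h : nat -> R).
Variables (a b : nat -> R -> nat -> R) (u : R * R -> R).
Hypothesis lim_u : scheme_limit L rho mu g B B2 W2 N h a b u.
Let gK := sl_lipschitz lim_u.
Let gB := sl_force_bound lim_u.
Let N0 := sl_size lim_u.
Let hN := sl_mesh lim_u.
Let sol := sl_solution lim_u.
Let bB := sl_velocity lim_u.
Let wB := sl_bending lim_u.
Let hcvg := sl_mesh_cvg lim_u.
Let ucvg := sl_cvg lim_u.
Let abound := sl_bound lim_u.

Let h0 k : 0 < h k.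
Proof. by rewrite -(@pmulr_lgt0 _ (N k)%:R) ?ltr0n// hN. Qed.

Lemma domain_strip T t x : domain L (t, x) -> t <= T -> strip T L (t, x).
Proof.
move=> [/= + +] tT; rewrite !in_itv/= andbT => t0 /andP[x0 xL].
by split; apply/andP; split => //=; exact: ltW.
Qed.

Let B20 : 0 <= B2.
Proof.
apply: le_trans (@bB 0 0 (lexx 0)); rewrite mulr_ge0 ?(ltW (h0 0))// sumr_ge0// => j _.
exact: sqr_ge0.
Qed.

Let W20 : 0 <= W2.
Proof.
apply: le_trans (@wB 0 0 (lexx 0)); rewrite mulr_ge0 ?(ltW (h0 0))// sumr_ge0// => j _.
exact: sqr_ge0.
Qed.

Definition state_coef (N : nat) h (g : R -> R) (a b : R -> nat -> R) (i : nat) t j :=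
  if i is i'.+1 then if i' is 0 then bending N h (a t) j else g (a t j) else b t j.

Let q k i := state_coef (N k) (h k) (g k) (a k) (b k) i.

Definition weighted_step L (N : nat) h (c : R -> nat -> R) (z : R * R) :=
  expR (- z.1) * (step_function N h c \_ (domain L)) z.

Let y k i := weighted_step L (N k) (h k) (q k i).

Lemma bending_continuous_at k j t : 0 <= t ->
  {for t, continuous (fun s => bending (N k) (h k) (a k s) j)}.
Proof.
by move=> t0; have /is_derive_continuous := bending_derive (@sol k) j t0.
Qed.

Lemma state_coef_continuous k i j t : (j < N k)%N -> 0 <= t ->
  {for t, continuous (fun s => q k i s j)}.
Proof.
move=> jN t0; have [ca cb] := scheme_continuous (@sol k) jN t0.
case: i => [|[|i]] //=; first exact: bending_continuous_at.
have [Kg gK'] := gK.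
by apply: continuous_comp => //; exact: lipschitz_continuous (gK' k) _.
Qed.

Let qB k i t : 0 <= t -> h k * (\sum_(j < N k) q k i t j ^+ 2) <= B2 + W2 + L * B ^+ 2.
Proof.
move=> t0; have LB : 0 <= L * B ^+ 2 by rewrite mulr_ge0 ?sqr_ge0// ltW.
case: i => [|[|i]] /=.
- by apply: (le_trans (@bB k t t0)); have := W20; lra.
- by apply: (le_trans (@wB k t t0)); have := B20; lra.
- apply: (@le_trans _ _ (h k * \sum_(j < N k) B ^+ 2)).
    rewrite ler_wpM2l ?(ltW (h0 k))// ler_sum// => j _.
    rewrite -[leLHS]real_normK ?num_real// ler_pXn2r ?nnegrE//.
    exact: le_trans (gB k 0).
  rewrite sumr_const card_ord -[B ^+ 2 *+ _]mulr_natl mulrA hN; have := B20; have := W20; lra.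
Qed.

Lemma state_sqint k i : sqint leb2 (y k i) /\ nrm2 leb2 (y k i) <= B2 + W2 + L * B ^+ 2.
Proof.
apply: (sqint_step L0 (N0 k) (hN k)) => [j jN||t t0].
- apply: continuous_at_measurable; first exact: measurable_itv.
  move=> t; rewrite /= in_itv/= andbT => /ltW; exact: state_coef_continuous.
- by rewrite !addr_ge0// mulr_ge0 ?sqr_ge0// ltW.
- exact: qB (ltW t0).
Qed.

Lemma ubound T : exists2 M, 0 < M & forall z, strip T L z -> `|u z| <= M /\
  forall k, `|step_function (N k) (h k) (a k) z| <= M.
Proof.
have [M M0 HM] := abound T; have [K HK] := ucvg T ltr01.
exists (M + 1); first lra.
move=> z zT; split => [|k]; last by have := HM k z zT; lra.
have := HM K z zT; have := HK K (leqnn K) z zT; set s := step_function _ _ _ z.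
have := ler_normD s (u z - s); rewrite subrKC [`|u z - s|]distrC; lra.
Qed.

Lemma measurable_limit : measurable_fun setT (u \_ (domain L)).
Proof.
apply: (@measurable_fun_cvg _ _ _ _ (fun k =>
  step_function (N k) (h k) (a k) \_ (domain L))).
  move=> k; apply: (measurable_step L0 (N0 k) (hN k)) => // j jN.
  apply: continuous_at_measurable; first exact: measurable_itv.
  move=> t; rewrite /= in_itv/= andbT => /ltW t0.
  by have [] := scheme_continuous (@sol k) jN t0.
move=> [t x] _; have [[tT xD]|nD] := pselect (domain L (t, x)); last first.
  by rewrite patchE memNset//; under eq_cvg do rewrite patchE memNset//; exact: cvg_cst.
rewrite patchE mem_set//; apply/cvgrPdist_le => e e0.
have [K HK] := ucvg t e0; exists K => // k /= Kk.
rewrite step_functionE// distrC; apply: (HK k Kk (t, x)).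
exact: domain_strip.
Qed.

Lemma sqint_scale (c : R) f : sqint leb2 f -> sqint leb2 (fun z => c * f z).
Proof.
move=> [mf f2]; split; first exact: measurable_funM.
have := integrable_scale measurableT (c ^+ 2) f2; apply: eq_integrable => // z _.
by rewrite exprMn.
Qed.

Definition weighted_test_function (c : R) theta (z : R * R) :=
  c * ((fun z => expR z.1 * theta z) \_ (domain L)) z.

Lemma integrable_limit_test theta : compact_smooth theta ->
  leb2.-integrable setT (fun z => (((fun z => u z * theta z) \_ (domain L)) z)%:E).
Proof.
move=> sth; have [_ [T T0 th0]] := sth.
have [M M0 HM] := compact_smooth_bound sth; have [Mu Mu0 HMu] := ubound T.
apply: (@integrable_box_bounded _ _ L T (Mu * M)) => //.
- by rewrite mulr_ge0// ltW.
- rewrite (_ : _ \_ _ = fun z => (u \_ (domain L)) z * (theta \_ (domain L)) z).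
    by apply: measurable_funM; [exact: measurable_limit|exact: measurable_compact_smooth].
  by apply/funext => z; rewrite !patchE; case: ifP; rewrite ?mulr0.
move=> [t x]; rewrite patchE; case: ifPn => [|_]; rewrite ?inE; last first.
  by rewrite normr0 mulr_ge0// mulr_ge0// ltW.
move=> [/= tT xD]; move: (tT); rewrite /= in_itv/= andbT => t0.
have [Tt|tT'] := leP T t.
  rewrite th0 ?mulr0 ?normr0 ?mulr_ge0 ?(ltW M0) ?(ltW Mu0)//=.
  by left; rewrite ger0_norm// ltW.
rewrite indicE mem_set; last by split => //=; rewrite in_itv/= t0.
rewrite mulr1 normrM ler_pM//; apply: (HMu (t, x) _).1.
exact: domain_strip (ltW tT').
Qed.

(* [V] collects the contributions of the initial data to the time integral of the
   discrete identity [c]. *)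
Lemma residual_cvg thetau (theta : nat -> R * R -> R) (al : nat -> R) (i0 : nat) T V
    (c : nat -> R -> nat -> R) :
  0 < T -> (i0 < 3)%N -> compact_smooth thetau ->
  (forall i, (i < 3)%N -> compact_smooth (theta i)) ->
  (forall t x, T <= t -> thetau (t, x) = 0 /\ forall i, (i < 3)%N -> theta i (t, x) = 0) ->
  (forall k j, (j < N k)%N -> forall t, 0 <= t -> {for t, continuous ((c k)^~ j)}) ->
  (forall k t j, T <= t -> (j < N k)%N -> c k t j = 0) ->
  (forall e, 0 < e -> exists K, forall k, (K <= k)%N -> forall t x, box L T (t, x) ->
    `|u (t, x) * thetau (t, x) +
      \sum_(i < 3) al i * q k i t (cell (N k) (h k) x) * theta i (t, x) -
      c k t (cell (N k) (h k) x)| <= e * (1 + `|q k i0 t (cell (N k) (h k) x)|)) ->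
  (forall e, 0 < e -> exists K, forall k, (K <= k)%N ->
    `|V + \int[leb]_(t in `[0, T]) (h k * \sum_(j < N k) c k t j)| <= e) ->
  forall e, 0 < e -> exists K, forall k, (K <= k)%N ->
    `|(V + \int[leb2]_z ((fun z => u z * thetau z) \_ (domain L)) z) +
      \sum_(i < 3) \int[leb2]_z (y k i z * weighted_test_function (al i) (theta i) z)|
      <= e.
Proof.
move=> T0 i03 su sth th0 cc cT Hc HV e e0.
have iy k i : (i < 3)%N ->
    leb2.-integrable setT (fun z => (y k i z * weighted_test_function (al i) (theta i) z)%:E).
  move=> i3; apply: sqint_mul; first exact: (state_sqint k i).1.
  by apply: sqint_scale; apply: weighted_test => //; exact: sth.
have iu := integrable_limit_test su.
pose C := B2 + W2 + L * B ^+ 2.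
have C0 : 0 <= C by rewrite !addr_ge0// mulr_ge0 ?sqr_ge0// ltW.
pose M := 2 * (T * L + expR T ^+ 2 / 2 * C) + 1.
have M0 : 0 < M.
  have ? : 0 <= T * L by rewrite mulr_ge0// ltW.
  have ? : 0 <= expR T ^+ 2 / 2 * C by rewrite mulr_ge0// divr_ge0// sqr_ge0.
  rewrite /M; lra.
have e2 : 0 < e / 2 by rewrite divr_gt0.
have [K1 HK1] := HV _ e2.
have eM : 0 < e / 2 / M by rewrite divr_gt0.
have [K2 HK2] := Hc _ eM.
exists (maxn K1 K2) => k; rewrite geq_max => /andP[/HK1 H1 /HK2 H2].
pose F z := ((fun z => u z * thetau z) \_ (domain L)) z +
  \sum_(i < 3) y k i z * weighted_test_function (al i) (theta i) z.
have [isum Esum] := @Rintegral_sum _ _ _ leb2 setT measurableT 3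
  (fun i z => y k i z * weighted_test_function (al i) (theta i) z) (iy k).
have iF : leb2.-integrable setT (fun z => (F z)%:E).
  exact: (integrable_add measurableT iu isum).
have -> : V + \int[leb2]_z ((fun z => u z * thetau z) \_ (domain L)) z +
    \sum_(i < 3) \int[leb2]_z (y k i z * weighted_test_function (al i) (theta i) z) =
    V + \int[leb2]_z F z.
  by rewrite -Esum -addrA -(RintegralD measurableT iu isum).
have FE t x : domain L (t, x) -> F (t, x) = u (t, x) * thetau (t, x) +
    \sum_(i < 3) al i * q k i t (cell (N k) (h k) x) * theta i (t, x).
  move=> [/= tT xD]; rewrite /F patchE mem_set//; congr (_ + _); apply: eq_bigr => i _.
  rewrite /y /weighted_step /weighted_test_function step_functionE// patchE mem_set//=.
  have := expRxMexpNx_1 t; set p := expR t; set p' := expR (- t) => pp.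
  transitivity (p * p' * (al i * q k i t (cell (N k) (h k) x) * theta i (t, x))).
    by ring.
  by rewrite pp mul1r.
have F0 z : ~ box L T z -> F z = 0.
  move=> nz; have [dz|nD] := pselect (domain L z); last first.
    rewrite /F /weighted_test_function patchE memNset// add0r big1// => i _.
    by rewrite patchE memNset// !mulr0.
  case: z nz dz => t x nz dz; have [tT xD] := dz; have [tT'|Tt] := ltP t T.
    exfalso; apply: nz; split => //; move: tT; rewrite /= !in_itv/= tT' andbT.
    by move=> ->.
  have [thu thi] := th0 t x Tt; rewrite FE// thu mulr0 add0r big1// => i _.
  by rewrite thi// mulr0.
have [sy yC] := state_sqint k i0.
have := @residual_bound R L L0 (N k) (h k) (c k) F (y k i0) _ T (e / 2 / M) (N0 k)
  (hN k) T0 (ltW eM) iF sy yC (cc k) (cT k) F0.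
have Hp t x : box L T (t, x) -> `|F (t, x) - c k t (cell (N k) (h k) x)| <=
    e / 2 / M * (1 + `|expR t * y k i0 (t, x)|).
  move=> bz; have dz : domain L (t, x).
    case: bz => /= tT xD; split => //; move: tT; rewrite /= !in_itv/= andbT.
    by move=> /andP[].
  have [tT xD] := dz; rewrite FE// /y /weighted_step step_functionE//= mulrA.
  by rewrite expRxMexpNx_1 mul1r; exact: H2.
move=> /(_ Hp); rewrite -/C => H3.
set I := \int[leb2]_z F z in H3 *; set J := \int[leb]_(t in _) _ in H1 H3.
have -> : V + I = (V + J) + (I - J) by ring.
apply: (le_trans (ler_normD _ _)).
apply: (le_trans (lerD H1 H3)).
have : 2 * (e / 2 / M) * (T * L + expR T ^+ 2 / 2 * C) <= e / 2.
  have -> : 2 * (e / 2 / M) * (T * L + expR T ^+ 2 / 2 * C) = e / 2 / M * (M - 1).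
    by rewrite /M; ring.
  by rewrite -[leRHS](divfK (lt0r_neq0 M0)) ler_wpM2l ?(ltW eM)// gerBl.
by rewrite [X in _ -> _ <= X]splitr lerD2l.
Qed.

Let hsmall M e : 0 < e -> exists K, forall k, (K <= k)%N -> h k * M <= e.
Proof.
move=> e0; have M0 : 0 < `|M| + 1 by rewrite ltr_wpDl.
have [K HK] := hcvg (divr_gt0 e0 M0); exists K => k /HK.
rewrite ler_pdivlMr//; apply: le_trans; rewrite ler_wpM2l ?(ltW (h0 k))//.
by rewrite (le_trans (ler_norm _))// lerDl.
Qed.

Let usmall T M e : 0 < e -> exists K, forall k, (K <= k)%N -> forall t x,
  box L T (t, x) -> `|u (t, x) - a k t (cell (N k) (h k) x)| * M <= e.
Proof.
move=> e0; have M0 : 0 < `|M| + 1 by rewrite ltr_wpDl.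
have [K HK] := ucvg T (divr_gt0 e0 M0); exists K => k Kk t x [/= tT xD].
have := HK k Kk (t, x); rewrite distrC ler_pdivlMr// => H.
apply: le_trans (H _); first by rewrite ler_wpM2l// (le_trans (ler_norm _))// lerDl.
move: tT; rewrite /= in_itv/= => /andP[t0 tT]; apply: domain_strip (ltW tT).
by split => //=; rewrite in_itv/= t0.
Qed.

Let node_close k x : D x -> `|h k * (cell (N k) (h k) x)%:R - x| <= h k.
Proof.
rewrite /= in_itv/= => /andP[/ltW x0 /ltW xL].
have := @cell_dist _ _ _ _ (N0 k) L0 (hN k) x; rewrite x0 xL => /(_ isT).
by rewrite distrC => /andP[? ?]; rewrite ger0_norm.
Qed.

Let limit_bound T : exists2 M, 0 < M & forall k t x, box L T (t, x) ->
  `|a k t (cell (N k) (h k) x)| <= M.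
Proof.
have [M M0 HM] := ubound T; exists M => // k t x [/= tT xD].
apply: (HM (t, x) _).2; move: tT; rewrite /= in_itv/= => /andP[t0 tT].
by apply: domain_strip (ltW tT); split => //=; rewrite in_itv/= t0.
Qed.

Let time_scale c T (f : R -> R) : (forall t, 0 <= t -> {for t, continuous f}) ->
  \int[leb]_(t in `[0, T]) (c * f t) = c * \int[leb]_(t in `[0, T]) f t.
Proof.
move=> cf; have iF : leb.-integrable (`[0, T]%classic : set R) (fun t => (f t)%:E).
  apply: continuous_compact_integrable; first exact: segment_compact.
  apply: continuous_in_subspaceT => t; rewrite inE /= in_itv/= => /andP[t0 _].
  exact: cf.
by rewrite (@RintegralZl _ _ R leb `[0, T]%classic f c (measurable_itv _) iF).
Qed.

Lemma velocity_residual phi : test_function2 (domain L) phi ->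
  forall e, 0 < e -> exists K, forall k, (K <= k)%N ->
    `|(0 + \int[leb2]_z ((fun z => u z * d_t phi z) \_ (domain L)) z) +
      \sum_(i < 3) \int[leb2]_z (y k i z *
        weighted_test_function (i == 0%N :> nat)%:R phi z)| <= e.
Proof.
move=> tphi; have sphi := test_function_compact_smooth tphi.
have [phi0 _] := test_function_domain_margin L0 tphi.
have st := compact_smooth_dt sphi.
have [_ [T1 T10 HT1]] := sphi; have [_ [T2 T20 HT2]] := st.
pose T := T1 + T2; have T0 : 0 < T by rewrite addr_gt0.
have phiT t x : T <= t -> phi (t, x) = 0 /\ d_t phi (t, x) = 0.
  move=> Tt; have tn : t <= `|t| := ler_norm t; rewrite /T in Tt.
  by rewrite HT1 ?HT2//=; left; lra.
pose c k t j := a k t j * d_t phi (t, h k * j%:R) + b k t j * phi (t, h k * j%:R).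
have [Mt Mt0 HMt] := compact_smooth_bound st.
have [Lt Lt0 HLt] := compact_smooth_lipschitz st.
have [Lp Lp0 HLp] := compact_smooth_lipschitz sphi.
have [Ma Ma0 HMa] := limit_bound T.
have cc k j : (j < N k)%N -> forall t, 0 <= t -> {for t, continuous ((c k)^~ j)}.
  move=> jN t t0; have [ca cb] := scheme_continuous (@sol k) jN t0.
  have [c1 _] := compact_smooth_section (h k * j%:R) sphi.
  have [c2 _] := compact_smooth_section (h k * j%:R) st.
  by apply: continuousD; apply: continuousM => //; [exact: c2|exact: c1].
apply: (@residual_cvg (d_t phi) (fun=> phi) (fun i => (i == 0%N)%:R) 0 T 0 c) => //.
- by move=> t x Tt; have [? ?] := phiT t x Tt.
- by move=> k t j Tt _; rewrite /c; have [-> ->] := phiT t (h k * j%:R) Tt; rewrite !mulr0 addr0.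
- move=> e e0; have e2 : 0 < e / 2 by rewrite divr_gt0.
  have [K1 HK1] := usmall T Mt e2; have [K2 HK2] := hsmall (Lt * Ma) e2.
  have [K3 HK3] := hsmall Lp e0.
  exists (maxn K1 (maxn K2 K3)) => k; rewrite !geq_max => /and3P[/HK1 H1 /HK2 H2 /HK3 H3].
  move=> t x bz; have := H1 t x bz; have := HMa k t x bz; have [_ /= xD] := bz.
  have := node_close k xD; rewrite !big_ord_recr big_ord0/= /c.
  set xj := h k * _; set ua := a k t _; set ub := b k t _ => xh uaM uM.
  have -> : u (t, x) * d_t phi (t, x) + (0 + 1 * ub * phi (t, x) +
      0 * state_coef (N k) (h k) (g k) (a k) (b k) 1 t (cell (N k) (h k) x) * phi (t, x) +
      0 * g k ua * phi (t, x)) - (ua * d_t phi (t, xj) + ub * phi (t, xj)) =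
    (u (t, x) - ua) * d_t phi (t, x) + ua * (d_t phi (t, x) - d_t phi (t, xj)) +
    ub * (phi (t, x) - phi (t, xj)) by ring.
  have n1 : `|(u (t, x) - ua) * d_t phi (t, x)| <= e / 2.
    by rewrite normrM; apply: le_trans uM; rewrite ler_wpM2l.
  have n2 : `|ua * (d_t phi (t, x) - d_t phi (t, xj))| <= e / 2.
    rewrite normrM; apply: le_trans H2.
    rewrite (_ : h k * (Lt * Ma) = Ma * (Lt * h k)); last by ring.
    apply: ler_pM => //; apply: (le_trans (HLt _ _ _)).
    by rewrite ler_wpM2l ?(ltW Lt0)// distrC.
  have n3 : `|ub * (phi (t, x) - phi (t, xj))| <= `|ub| * e.
    rewrite normrM ler_wpM2l//; apply: (le_trans (HLp _ _ _)); apply: le_trans H3.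
    by rewrite mulrC ler_wpM2r ?(ltW Lp0)// distrC.
  apply: (le_trans (ler_normD _ _)).
  rewrite [leRHS](_ : _ = (e / 2 + e / 2) + `|ub| * e); last by rewrite -splitr; ring.
  by rewrite lerD//; apply: (le_trans (ler_normD _ _)); rewrite lerD.
move=> e e0; exists 0%N => k _; rewrite add0r time_scale; last first.
  by move=> t t0; apply: (@continuous_sum_at _ _ (fun j t => c k t j)) => j jN; exact: cc.
have dpsi (j : nat) (t : R) :
    is_derive t 1 (fun s => phi (s, h k * j%:R)) (d_t phi (t, h k * j%:R)).
  exact: is_derive_dt.
have -> := @scheme_velocity_identity R (N k) (h k) rho mu (g k) (a k) (b k) (@sol k) T
  (fun t j => phi (t, h k * j%:R)) (fun t j => d_t phi (t, h k * j%:R)) T0 dpsi.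
- by rewrite mulr0 normr0 ltW.
- by move=> j; have [] := compact_smooth_section (h k * j%:R) st.
- by move=> j; exact: phi0.
- by move=> j; have [] := phiT T (h k * j%:R) (lexx T).
Qed.

Lemma bending_residual phi : test_function2 (domain L) phi ->
  forall e, 0 < e -> exists K, forall k, (K <= k)%N ->
    `|(0 + \int[leb2]_z ((fun z => u z * d_x (d_x phi) z) \_ (domain L)) z) +
      \sum_(i < 3) \int[leb2]_z (y k i z *
        weighted_test_function (- (i == 1%N :> nat)%:R) phi z)| <= e.
Proof.
move=> tphi; have sphi := test_function_compact_smooth tphi.
have [_ [eta eta0 phi_eta]] := test_function_domain_margin L0 tphi.
have sx := compact_smooth_dx (compact_smooth_dx sphi).
have [_ [T1 T10 HT1]] := sphi; have [_ [T2 T20 HT2]] := sx.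
pose T := T1 + T2; have T0 : 0 < T by rewrite addr_gt0.
have phiT t x : T <= t -> phi (t, x) = 0 /\ d_x (d_x phi) (t, x) = 0.
  move=> Tt; have tn : t <= `|t| := ler_norm t; rewrite /T in Tt.
  by rewrite HT1 ?HT2//=; left; lra.
pose S k t j := \sum_(i < N k) second_diff (N k) (h k) i j * phi (t, h k * i%:R).
pose c k t j := a k t j * S k t j - bending (N k) (h k) (a k t) j * phi (t, h k * j%:R).
have [Mx Mx0 HMx] := compact_smooth_bound sx.
have [Md Md0 HMd] := second_diff_error sphi.
have [Lp Lp0 HLp] := compact_smooth_lipschitz sphi.
have [Ma Ma0 HMa] := limit_bound T.
have cc k j : (j < N k)%N -> forall t, 0 <= t -> {for t, continuous ((c k)^~ j)}.
  move=> jN t t0; have [ca _] := scheme_continuous (@sol k) jN t0.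
  have cphi i : {for t, continuous (fun s => phi (s, h k * i%:R))}.
    by have [+ _] := compact_smooth_section (h k * i%:R) sphi; apply.
  apply: continuousB; apply: continuousM => //; last exact: bending_continuous_at.
  apply: (@continuous_sum_at _ _ (fun i t => second_diff (N k) (h k) i j *
    phi (t, h k * i%:R))) => i iN.
  by apply: continuousM; [exact: cvg_cst|exact: cphi].
apply: (@residual_cvg (d_x (d_x phi)) (fun=> phi) (fun i => - (i == 1%N)%:R) 1 T 0 c) => //.
- by move=> t x Tt; have [? ?] := phiT t x Tt.
- move=> k t j Tt _; rewrite /c; have [-> _] := phiT t (h k * j%:R) Tt.
  rewrite mulr0 subr0 /S big1 ?mulr0// => i _.
  by have [-> _] := phiT t (h k * i%:R) Tt; rewrite mulr0.
- move=> e e0; have e2 : 0 < e / 2 by rewrite divr_gt0.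
  have [K1 HK1] := usmall T Mx e2; have [K2 HK2] := hsmall (Md * 5 * Ma) e2.
  have [K3 HK3] := hsmall Lp e0; have [K4 HK4] := hsmall 2 eta0.
  exists (maxn K1 (maxn K2 (maxn K3 K4))) => k.
  rewrite !geq_max => /and4P[/HK1 H1 /HK2 H2 /HK3 H3 /HK4 H4].
  move=> t x bz; have := H1 t x bz; have := HMa k t x bz; have [_ /= xD] := bz.
  have := node_close k xD; have jN := @cell_lt _ _ (h k) (N0 k) x.
  rewrite !big_ord_recr big_ord0/= /c.
  set j := cell _ _ _ in jN *.
  have SE : `|S k t j - d_x (d_x phi) (t, x)| <= Md * (`|(h k * j%:R - 2 * h k) - x| + 2 * h k).
    rewrite /S (@sum_second_diff_tr R (N k) (h k) j (fun y => phi (t, y)) jN (h0 k)).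
    - have := HMd t x (h k * j%:R - 2 * h k) (h k) (h0 k).
      rewrite subrK (_ : h k * j%:R - 2 * h k + h k = h k * j%:R - h k)//; ring.
    - by move=> z z0; rewrite phi_eta//; left; exact: ltW.
    - move=> i iN Ni; rewrite phi_eta//; right; rewrite -(hN k).
      have : (N k)%:R <= i.+2%:R :> R by rewrite ler_nat.
      rewrite -(ler_pM2l (h0 k)) -addn2 natrD mulrDr; lra.
  set xj := h k * _ in SE *; set ua := a k t _; set w := bending _ _ _ _ => xh uaM uM.
  have -> : u (t, x) * d_x (d_x phi) (t, x) + (0 + - 0 * b k t j * phi (t, x) +
      - 1 * w * phi (t, x) + - 0 * g k ua * phi (t, x)) - (ua * S k t j - w * phi (t, xj)) =
    (u (t, x) - ua) * d_x (d_x phi) (t, x) - ua * (S k t j - d_x (d_x phi) (t, x)) -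
    w * (phi (t, x) - phi (t, xj)) by ring.
  have n1 : `|(u (t, x) - ua) * d_x (d_x phi) (t, x)| <= e / 2.
    by rewrite normrM; apply: le_trans uM; rewrite ler_wpM2l.
  have n2 : `|ua * (S k t j - d_x (d_x phi) (t, x))| <= e / 2.
    rewrite normrM; apply: le_trans H2.
    rewrite (_ : h k * (Md * 5 * Ma) = Ma * (Md * (5 * h k))); last by ring.
    apply: ler_pM => //; apply: (le_trans SE); rewrite ler_wpM2l ?(ltW Md0)//.
    rewrite (_ : xj - 2 * h k - x = (xj - x) - 2 * h k); last by ring.
    have := ler_normB (xj - x) (2 * h k); rewrite [`|2 * _|]ger0_norm ?mulr_ge0 ?(ltW (h0 k))//.
    by lra.
  have n3 : `|w * (phi (t, x) - phi (t, xj))| <= `|w| * e.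
    rewrite normrM ler_wpM2l//; apply: (le_trans (HLp _ _ _)); apply: le_trans H3.
    by rewrite mulrC ler_wpM2r ?(ltW Lp0)// distrC.
  apply: (le_trans (ler_normB _ _)).
  rewrite [leRHS](_ : _ = (e / 2 + e / 2) + `|w| * e); last by rewrite -splitr; ring.
  by rewrite lerD//; apply: (le_trans (ler_normB _ _)); rewrite lerD.
move=> e e0; exists 0%N => k _; rewrite add0r (_ : (fun t : R => _) = fun=> 0).
  by rewrite /Rintegral integral0 normr0 ltW.
apply/funext => t; rewrite /c sumrB (_ : _ - _ = 0) ?mulr0//; apply/eqP.
rewrite subr_eq0; apply/eqP; rewrite /S; under eq_bigr do rewrite mulr_sumr.
rewrite exchange_big/=; apply: eq_bigr => i _; rewrite /bending mulr_suml.
by apply: eq_bigr => j _; rewrite mulrCA mulrA.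
Qed.

Let split_error (v va f fj w X Bp G p pj r : R) :
  v * f + (0 + 0 * r * p + mu / rho * w * X + rho^-1 * G * p) -
  rho^-1 * (rho * va * fj + mu * w * Bp + G * pj) =
  (v - va) * f + va * (f - fj) + rho^-1 * (G * (p - pj)) + w * (mu / rho * (X - Bp)).
Proof. by field; exact: lt0r_neq0. Qed.

Lemma weak_equation_residual phi V : test_function2 setT phi ->
  (forall e, 0 < e -> exists K, forall k, (K <= k)%N ->
    `|V + h k * (\sum_(j < N k) b k 0 j * phi (0, h k * j%:R)) -
      h k * (\sum_(j < N k) a k 0 j * d_t phi (0, h k * j%:R))| <= e) ->
  forall e, 0 < e -> exists K, forall k, (K <= k)%N ->
    `|(V + \int[leb2]_z ((fun z => u z * d_t (d_t phi) z) \_ (domain L)) z) +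
      \sum_(i < 3) \int[leb2]_z (y k i z *
        weighted_test_function ([:: 0; mu / rho; rho^-1]`_i)
          (if i == 1%N :> nat then d_x (d_x phi) else phi) z)| <= e.
Proof.
move=> tphi HV; have sphi := test_function_compact_smooth tphi.
have sx := compact_smooth_dx (compact_smooth_dx sphi).
have st := compact_smooth_dt sphi; have stt := compact_smooth_dt st.
have [_ [T1 T10 HT1]] := sphi; have [_ [T2 T20 HT2]] := sx.
have [_ [T3 T30 HT3]] := st; have [_ [T4 T40 HT4]] := stt.
pose T := T1 + T2 + T3 + T4; have T0 : 0 < T by rewrite !addr_gt0.
have phiT t x : T <= t -> [/\ phi (t, x) = 0, d_x (d_x phi) (t, x) = 0,
    d_t phi (t, x) = 0 & d_t (d_t phi) (t, x) = 0].
  move=> Tt; have tn : t <= `|t| := ler_norm t; rewrite /T in Tt.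
  by rewrite HT1 ?HT2 ?HT3 ?HT4//=; left; lra.
pose psi k t j := phi (t, h k * j%:R).
pose d k t j := rho * a k t j * d_t (d_t phi) (t, h k * j%:R) +
  mu * bending (N k) (h k) (a k t) j * bending (N k) (h k) (psi k t) j +
  g k (a k t j) * psi k t j.
pose c k t j := rho^-1 * d k t j.
have [Mt Mt0 HMt] := compact_smooth_bound stt.
have [Lt Lt0 HLt] := compact_smooth_lipschitz stt.
have [Md Md0 HMd] := second_diff_error sphi.
have [Lp Lp0 HLp] := compact_smooth_lipschitz sphi.
have [Ma Ma0 HMa] := limit_bound T.
have cphi k j t : {for t, continuous (fun s => psi k s j)}.
  by have [+ _] := compact_smooth_section (h k * j%:R) sphi; apply.
have cd k j : (j < N k)%N -> forall t, 0 <= t -> {for t, continuous ((d k)^~ j)}.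
  move=> jN t t0; have [ca _] := scheme_continuous (@sol k) jN t0.
  apply: continuousD; first apply: continuousD.
  - apply: continuousM; first by apply: continuousM => //; exact: cvg_cst.
    by have [+ _] := compact_smooth_section (h k * j%:R) stt; apply.
  - apply: continuousM.
      by apply: continuousM; [exact: cvg_cst|exact: bending_continuous_at].
    apply: (@continuous_sum_at _ _ (fun i t => second_diff (N k) (h k) j i * psi k t i)).
    by move=> i iN; apply: continuousM; [exact: cvg_cst|exact: cphi].
  - by apply: continuousM => //; exact: (@state_coef_continuous k 2).
have cc k j : (j < N k)%N -> forall t, 0 <= t -> {for t, continuous ((c k)^~ j)}.
  by move=> jN t t0; apply: continuousM; [exact: cvg_cst|exact: cd].
have bending_psi k t i : bending (N k) (h k) (psi k t) i = if (i.+2 < N k)%N then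
    (psi k t i.+2 - 2 * psi k t i.+1 + psi k t i) / h k ^+ 2 else 0.
  exact: sum_second_diff.
apply: (@residual_cvg (d_t (d_t phi)) (fun i => if i == 1%N then d_x (d_x phi) else phi)
  (fun i => [:: 0; mu / rho; rho^-1]`_i) 1 T V c) => //.
- by move=> i _; case: ifP.
- by move=> t x Tt; have [? ? ? ?] := phiT t x Tt; split => // i _; case: ifP.
- move=> k t j Tt _; have psi0 i : psi k t i = 0.
    by rewrite /psi; have [-> _ _ _] := phiT t (h k * i%:R) Tt.
  have B0 : bending (N k) (h k) (psi k t) j = 0.
    by rewrite bending_psi !psi0 mulr0 subr0 addr0 mul0r if_same.
  rewrite /c /d; have [_ _ _ ->] := phiT t (h k * j%:R) Tt.
  by rewrite B0 psi0 !mulr0 !addr0 mulr0.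
- move=> e e0; have e3 : 0 < e / 3 by rewrite divr_gt0.
  have r0 : 0 < rho^-1 by rewrite invr_gt0.
  have [K1 HK1] := usmall T Mt e3; have [K2 HK2] := hsmall (Lt * Ma) e3.
  have [K3 HK3] := hsmall (mu / rho * (Md * 3)) e0.
  have [K4 HK4] := hsmall (rho^-1 * (B * Lp)) e3.
  exists (maxn K1 (maxn K2 (maxn K3 K4))) => k.
  rewrite !geq_max => /and4P[/HK1 H1 /HK2 H2 /HK3 H3 /HK4 H4].
  move=> t x bz; have := H1 t x bz; have := HMa k t x bz; have [_ /= xD] := bz.
  have := node_close k xD; have jN := @cell_lt _ _ (h k) (N0 k) x.
  rewrite !big_ord_recr big_ord0/= /c /d.
  set j := cell _ _ _ in jN *.
  set w := bending _ _ (a k t) j; set xj := h k * _; set ua := a k t j => xh uaM uM.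
  rewrite split_error.
  have n1 : `|(u (t, x) - ua) * d_t (d_t phi) (t, x)| <= e / 3.
    by rewrite normrM; apply: le_trans uM; rewrite ler_wpM2l.
  have n2 : `|ua * (d_t (d_t phi) (t, x) - d_t (d_t phi) (t, xj))| <= e / 3.
    rewrite normrM; apply: le_trans H2.
    rewrite (_ : h k * (Lt * Ma) = Ma * (Lt * h k)); last by ring.
    apply: ler_pM => //; apply: (le_trans (HLt _ _ _)).
    by rewrite ler_wpM2l ?(ltW Lt0)// distrC.
  have n3 : `|rho^-1 * (g k ua * (phi (t, x) - psi k t j))| <= e / 3.
    rewrite normrM ger0_norm ?(ltW r0)//; apply: le_trans H4.
    rewrite (_ : h k * (rho^-1 * (B * Lp)) = rho^-1 * (B * (Lp * h k))); last by ring.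
    rewrite ler_wpM2l ?(ltW r0)// normrM ler_pM//; apply: (le_trans (HLp _ _ _)).
    by rewrite ler_wpM2l ?(ltW Lp0)// distrC.
  have n4 : `|w * (mu / rho * (d_x (d_x phi) (t, x) - bending (N k) (h k) (psi k t) j))|
      <= `|w| * e.
    have [jN2|jN2] := ltnP j.+2 (N k); last first.
      by rewrite /w /bending sum_second_diff ltnNge jN2/= !mul0r normr0 mul0r.
    rewrite normrM ler_wpM2l// normrM (ger0_norm (ltW (divr_gt0 mu0 rho0))).
    apply: le_trans H3; rewrite mulrCA ler_wpM2l ?(ltW (divr_gt0 mu0 rho0))//.
    rewrite bending_psi jN2 distrC /psi.
    have -> : h k * j.+2%:R = xj + 2 * h k by rewrite /xj -addn2 natrD; ring.
    have -> : h k * j.+1%:R = xj + h k by rewrite /xj -addn1 natrD; ring.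
    apply: (le_trans (HMd t x xj (h k) (h0 k))).
    by rewrite mulrCA ler_wpM2l ?(ltW Md0)//; move: xh; rewrite -/xj; lra.
  apply: (le_trans (ler_normD _ _)).
  rewrite [leRHS](_ : _ = (e / 3 + e / 3 + e / 3) + `|w| * e); last by field.
  rewrite lerD//; apply: (le_trans (ler_normD _ _)); rewrite lerD//.
  by apply: (le_trans (ler_normD _ _)); rewrite lerD.
move=> e e0; have [K HK] := HV _ e0; exists K => k /HK.
have dpsi (j : nat) (t : R) :
    is_derive t 1 (fun s => psi k s j) (d_t phi (t, h k * j%:R)).
  exact: is_derive_dt.
have dpsi1 (j : nat) (t : R) :
    is_derive t 1 (fun s => d_t phi (s, h k * j%:R)) (d_t (d_t phi) (t, h k * j%:R)).
  exact: is_derive_dt.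
have c2 (j : nat) : continuous (fun t => d_t (d_t phi) (t, h k * j%:R)).
  exact: (compact_smooth_section (h k * j%:R) stt).1.
have p0 (j : nat) : psi k T j = 0 by have [] := phiT T (h k * j%:R) (lexx T).
have p1 (j : nat) : d_t phi (T, h k * j%:R) = 0.
  by have [] := phiT T (h k * j%:R) (lexx T).
have [Kg gK'] := gK.
have I0 := @scheme_weak_identity R (N k) (h k) rho mu (g k) (Kg k) rho0 (gK' k) (a k) (b k)
  (@sol k) T (psi k) (fun t j => d_t phi (t, h k * j%:R))
  (fun t j => d_t (d_t phi) (t, h k * j%:R)) T0 dpsi dpsi1 c2 p0 p1.
set P := \sum_(j < N k) b k 0 j * _ in I0 *.
set Q := \sum_(j < N k) a k 0 j * _ in I0 *.
have -> : \int[leb]_(t in `[0, T]) (h k * \sum_(j < N k) c k t j) =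
    (h k / rho) * \int[leb]_(t in `[0, T]) (\sum_(j < N k) d k t j).
  rewrite -time_scale; last first.
    by move=> t t0; apply: (@continuous_sum_at _ _ (fun j t => d k t j)) => j jN; exact: cd.
  by apply: eq_Rintegral => t _; rewrite -mulr_sumr mulrA.
move: I0; rewrite -[\int[leb]_(t in _) _]/(\int[leb]_(t in `[0, T]) (\sum_(j < N k) d k t j)).
set I := \int[leb]_(t in _) _ => I0.
suff -> : h k / rho * I = h k * P - h k * Q by rewrite addrA.
have /eqP : I - rho * (P - Q) = 0 by rewrite -I0; ring.
rewrite subr_eq0 => /eqP ->; rewrite mulrA divfK ?lt0r_neq0//; ring.
Qed.

End residuals.

Section limit_sections.
Variable R : realType.
Local Notation leb := (@lebesgue_measure R).
Local Notation leb2 := (leb \x leb)%E.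
Implicit Types (t x T e : R).
Variables (L rho mu : R).
Hypotheses (L0 : 0 < L) (rho0 : 0 < rho) (mu0 : 0 < mu).
Local Notation D := (`]0, L[%classic : set R).
Variables (g : nat -> R -> R) (B B2 W2 : R) (N : nat -> nat) (h : nat -> R).
Variables (a b : nat -> R -> nat -> R) (u : R * R -> R).
Hypothesis lim_u : scheme_limit L rho mu g B B2 W2 N h a b u.
Let N0 := sl_size lim_u.
Let hN := sl_mesh lim_u.
Let mD : measurable D. Proof. exact: measurable_itv. Qed.
Let Dfin : (leb D < +oo)%E. Proof. exact: leb_domain_fin. Qed.

Let h0 k : 0 < h k.
Proof. by rewrite -(@pmulr_lgt0 _ (N k)%:R) ?ltr0n// hN. Qed.

Lemma limit_section_cvg t e : 0 <= t -> 0 < e -> exists K, forall k, (K <= k)%N ->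
  forall x, D x -> `|a k t (cell (N k) (h k) x) - u (t, x)| <= e.
Proof.
move=> t0 e0; have [K HK] := sl_cvg lim_u t e0; exists K => k Kk x.
rewrite /= in_itv/= => /andP[x0 xL]; apply: (HK k Kk (t, x)).
by split; apply/andP; split => //=; exact: ltW.
Qed.

Let measurable_cell_fun (k : nat) (c : nat -> R) :
  measurable_fun D (fun x => c (cell (N k) (h k) x)).
Proof.
have [i1 _] := @integral_cell _ _ _ _ (N0 k) L0 (hN k) c.
by apply/measurable_EFinP; exact: measurable_int i1.
Qed.

Lemma limit_section_measurable t : 0 <= t -> measurable_fun D (fun x => u (t, x)).
Proof.
move=> t0; apply: (@measurable_fun_cvg _ _ _ _
  (fun k x => a k t (cell (N k) (h k) x))) => // x xD.
apply/cvgrPdist_le => e e0; have [K HK] := limit_section_cvg t0 e0.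
by exists K => // k /= Kk; rewrite distrC; exact: HK.
Qed.

Lemma Rintegral_dist_le (f f' G : R -> R) :
  leb.-integrable D (fun x => (f x)%:E) -> leb.-integrable D (fun x => (f' x)%:E) ->
  leb.-integrable D (fun x => (G x)%:E) ->
  (forall x, D x -> `|f x - f' x| <= G x) ->
  `|\int[leb]_(x in D) f x - \int[leb]_(x in D) f' x| <= \int[leb]_(x in D) G x.
Proof.
move=> i1 i2 i3 H.
have i12 := @integrable_sub _ _ R leb D mD _ _ i1 i2.
rewrite -(@RintegralB _ _ R leb D f f' mD i1 i2).
have le1 := @le_normr_Rintegral _ _ R leb D (fun x => f x - f' x) mD i12.
apply: (le_trans le1).
apply: le_Rintegral => //.
exact: (@integrable_norm _ _ R leb D _ i12).
Qed.

Let integral_cst (c : R) : leb.-integrable D (fun=> c%:E) /\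
  \int[leb]_(x in D) c = c * L.
Proof.
have i1 : leb.-integrable D (fun=> c%:E).
  by apply: (@integrable_bounded _ _ R leb D mD (fun=> c) `|c|).
have DL : leb D = L%:E by rewrite lebesgue_measure_itv/= lte_fin L0 -EFinB subr0.
split => //; rewrite (@Rintegral_cst _ _ R leb D mD) -[RHS]/(c * fine L%:E) -DL//.
Qed.

Variable Phi : R -> R.
Hypothesis hPhi : potential Phi.

Let cPhi : continuous Phi := Phi_continuous hPhi.

Lemma potential_section_integrable (f : R -> R) : measurable_fun D f ->
  leb.-integrable D (fun x => (Phi (f x))%:E).
Proof.
move=> mf; have [M M0 HM] := potential_bounded hPhi.
apply: (@integrable_bounded _ _ R leb D mD (fun x => Phi (f x)) M) => //.
  exact: (measurableT_comp (continuous_measurable_fun cPhi)).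
by move=> x _; have /andP[? ?] := HM (f x); rewrite ger0_norm.
Qed.

Variables (G : nat -> R -> R) (eps : nat -> R).
Hypothesis GPhi : forall k x, `|G k x - Phi x| <= eps k.
Hypothesis eps_cvg : forall e, 0 < e -> exists K, forall k, (K <= k)%N -> eps k <= e.

Lemma potential_energy_cvg t e : 0 <= t -> 0 < e -> exists K, forall k, (K <= k)%N ->
  `|h k * (\sum_(j < N k) G k (a k t j)) - \int[leb]_(x in D) Phi (u (t, x))| <= e.
Proof.
move=> t0 e0; have lip0 := potential_lip_gt0 hPhi.
have d0 : 0 < e / (2 * L) by rewrite divr_gt0// mulr_gt0.
have d1 : 0 < e / (2 * L) / potential_lip Phi by rewrite divr_gt0.
have [K1 HK1] := limit_section_cvg t0 d1; have [K2 HK2] := eps_cvg d0.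
exists (maxn K1 K2) => k; rewrite geq_max => /andP[/HK1 H1 /HK2 H2].
have [i1 <-] := @integral_cell _ _ _ _ (N0 k) L0 (hN k) (fun j => G k (a k t j)).
have [i3 E3] := integral_cst (e / L).
rewrite (_ : e = \int[leb]_(x in D) (e / L)); last by rewrite E3 divfK ?gt_eqF.
apply: Rintegral_dist_le => //.
  by apply: potential_section_integrable; exact: limit_section_measurable.
move=> x xD; set s := a k t _.
have -> : G k s - Phi (u (t, x)) = (G k s - Phi s) + (Phi s - Phi (u (t, x))) by ring.
have -> : e / L = e / (2 * L) + potential_lip Phi * (e / (2 * L) / potential_lip Phi).
  by field; rewrite !gt_eqF.
apply: (le_trans (ler_normD _ _)); rewrite lerD//.
  exact: le_trans (GPhi k s) H2.
apply: (le_trans (potential_lipschitz hPhi _ _)); rewrite ler_wpM2l ?(ltW lip0)//.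
exact: H1.
Qed.

Variable E1 : R.
Hypothesis energy_bound : forall k t, 0 <= t ->
  h k * (\sum_(j < N k) (rho / 2 * b k t j ^+ 2 +
    mu / 2 * bending (N k) (h k) (a k t) j ^+ 2)) + h k * (\sum_(j < N k) G k (a k t j))
  <= E1 + h k * (\sum_(j < N k) G k (a k 0 j)).

Lemma kinetic_bound t e : 0 <= t -> 0 < e -> exists K, forall k, (K <= k)%N ->
  h k * (\sum_(j < N k) (rho / 2 * b k t j ^+ 2 +
    mu / 2 * bending (N k) (h k) (a k t) j ^+ 2)) <=
  E1 + \int[leb]_(x in D) Phi (u (0, x)) - \int[leb]_(x in D) Phi (u (t, x)) + e.
Proof.
move=> t0 e0; have e2 : 0 < e / 2 by rewrite divr_gt0.
have [K1 HK1] := potential_energy_cvg t0 e2.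
have [K2 HK2] := potential_energy_cvg (lexx 0) e2.
exists (maxn K1 K2) => k; rewrite geq_max => /andP[/HK1 H1 /HK2 H2].
move: H1 H2; rewrite !ler_norml => /andP[H1 _] /andP[_ H2].
have := energy_bound k t0; lra.
Qed.

Variables (u0 u1 : R -> R).
Hypothesis u0i : leb.-integrable D (fun x => (u0 x)%:E).
Hypothesis u1i : leb.-integrable D (fun x => (u1 x)%:E).
Hypothesis b_init : forall k j, (j < N k)%N -> b k 0 j = cell_average (h k) L u1 j.
Hypothesis u_init : {ae leb, forall x, D x -> u (0, x) = u0 x}.

Let measurable_section (phi : R * R -> R) : compact_smooth phi ->
  measurable_fun D (fun x => phi (0, x)).
Proof.
move=> sphi; apply: continuous_at_measurable => // x _.
exact: (compact_smooth_section 0 sphi).2.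
Qed.

Lemma initial_limit_ae (psi : R -> R) : measurable_fun D psi ->
  \int[leb]_(x in D) (u0 x * psi x) = \int[leb]_(x in D) (u (0, x) * psi x).
Proof.
move=> mpsi; congr fine; apply: ae_eq_integral => //.
- apply: measurable_EFin_fun; apply: measurable_funM => //.
  by apply/measurable_EFinP; exact: measurable_int u0i.
- apply: measurable_EFin_fun; apply: measurable_funM => //.
  exact: limit_section_measurable.
- move: u_init; apply: filterS; first exact: (ae_filter_ringOfSetsType leb).
  by move=> x H xD; rewrite H.
Qed.

Lemma initial_residual phi : compact_smooth phi ->
  forall e, 0 < e -> exists K, forall k, (K <= k)%N ->
    `|(\int[leb]_(x in D) (u0 x * d_t phi (0, x)) -
        \int[leb]_(x in D) (u1 x * phi (0, x))) +
      h k * (\sum_(j < N k) b k 0 j * phi (0, h k * j%:R)) -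
      h k * (\sum_(j < N k) a k 0 j * d_t phi (0, h k * j%:R))| <= e.
Proof.
move=> sphi e e0; have st := compact_smooth_dt sphi.
have [Mt Mt0 HMt] := compact_smooth_bound st.
have [Mp Mp0 HMp] := compact_smooth_bound sphi.
have [Lt Lt0 HLt] := compact_smooth_lipschitz st.
have [Lp Lp0 HLp] := compact_smooth_lipschitz sphi.
have [Mu Mu0 HMu] := ubound lim_u 0.
pose I1 := \int[leb]_(x in D) `|u1 x|.
have iu1n := @integrable_norm _ _ R leb D _ u1i.
have I10 : 0 <= I1 by apply: Rintegral_ge0.
have node x k : D x -> `|h k * (cell (N k) (h k) x)%:R - x| <= h k.
  rewrite /= in_itv/= => /andP[/ltW x0 /ltW xL].
  have := @cell_dist _ _ _ _ (N0 k) L0 (hN k) x; rewrite x0 xL => /(_ isT).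
  by rewrite distrC => /andP[? ?]; rewrite ger0_norm.
have e2 : 0 < e / 2 by rewrite divr_gt0.
pose d := e / (4 * L).
have d0 : 0 < d by rewrite divr_gt0// mulr_gt0.
have [K1 HK1] := limit_section_cvg (lexx 0) (divr_gt0 d0 Mt0).
have [K2 HK2] := sl_mesh_cvg lim_u (divr_gt0 d0 (mulr_gt0 Mu0 Lt0)).
have LI : 0 < Lp * I1 + 1 by rewrite ltr_wpDl// mulr_ge0// ltW.
have [K3 HK3] := sl_mesh_cvg lim_u (divr_gt0 e2 LI).
exists (maxn K1 (maxn K2 K3)) => k; rewrite !geq_max => /and3P[/HK1 H1 /HK2 H2 /HK3 H3].
have [i1 E1'] := @integral_step _ _ _ _ (N0 k) L0 (hN k) u1 (fun j => phi (0, h k * j%:R)) u1i.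
have EP : h k * (\sum_(j < N k) b k 0 j * phi (0, h k * j%:R)) =
    \int[leb]_(x in D) (u1 x * phi (0, h k * (cell (N k) (h k) x)%:R)).
  rewrite E1' mulr_sumr; apply: eq_bigr => j _; rewrite b_init// /cell_average.
  have i2 := integrable_cell_mul (h k) j u1i.
  have -> : \int[leb]_(x in D) (u1 x * cell_kernel (h k) j x) =
      \int[leb]_(x in D) ((h k)^-1 * (u1 x * \1_(cell_itv (h k) j) x)).
    by apply: eq_Rintegral => x _; rewrite /cell_kernel mulrCA.
  rewrite (@RintegralZl _ _ R leb D (fun x => u1 x * \1_(cell_itv (h k) j) x) _ mD i2).
  by rewrite mulrA mulrA divff ?gt_eqF// mul1r mulrC.
have [i3 EQ] := @integral_cell _ _ _ _ (N0 k) L0 (hN k)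
  (fun j => a k 0 j * d_t phi (0, h k * j%:R)).
rewrite EP -EQ (@initial_limit_ae (fun x => d_t phi (0, x))); last exact: measurable_section.
set X1 := \int[leb]_(x in D) (u (0, x) * _); set X2 := \int[leb]_(x in D) (u1 x * _).
set X3 := \int[leb]_(x in D) (u1 x * _); set X4 := \int[leb]_(x in D) _.
have -> : X1 - X2 + X3 - X4 = (X1 - X4) + (X3 - X2) by ring.
have strip0 x : D x -> strip 0 L (0, x).
  by rewrite /= in_itv/= => /andP[x0 xL]; split; apply/andP; split => //=; exact: ltW.
have ub x : D x -> `|u (0, x)| <= Mu by move=> xD; have [] := HMu _ (strip0 x xD).
have n1 : `|X1 - X4| <= e / 2.
  have [i4 E4] := integral_cst (d + d).
  rewrite (_ : e / 2 = \int[leb]_(x in D) (d + d)); last first.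
    by rewrite E4 /d; field; exact: lt0r_neq0.
  apply: Rintegral_dist_le => //.
    apply: (@integrable_bounded _ _ R leb D mD (fun x => u (0, x) * d_t phi (0, x)) (Mu * Mt)) => //.
      apply: measurable_funM; last exact: measurable_section.
      exact: limit_section_measurable.
    by move=> x xD; rewrite normrM ler_pM// ub.
  move=> x xD; set xj := h k * _; set ua := a k 0 _.
  have -> : u (0, x) * d_t phi (0, x) - ua * d_t phi (0, xj) =
    (u (0, x) - ua) * d_t phi (0, x) + ua * (d_t phi (0, x) - d_t phi (0, xj)) by ring.
  apply: (le_trans (ler_normD _ _)); rewrite lerD// normrM.
    rewrite -[leRHS](divfK (lt0r_neq0 Mt0)) ler_pM// distrC; exact: H1.
  have -> : d = Mu * (Lt * (d / (Mu * Lt))) by field; rewrite !lt0r_neq0.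
  apply: ler_pM => //; first by have [_ /(_ k)] := HMu _ (strip0 x xD).
  apply: (le_trans (HLt _ _ _)); rewrite ler_wpM2l ?(ltW Lt0)//.
  by apply: le_trans H2; rewrite distrC; exact: node.
have n2 : `|X3 - X2| <= e / 2.
  apply: (@le_trans _ _ (\int[leb]_(x in D) ((Lp * h k) * `|u1 x|))).
    apply: Rintegral_dist_le => //.
    - apply: (@integrable_bounded_mul _ _ R leb D mD u1 (fun x => phi (0, x)) Mp) => //.
      exact: measurable_section.
    - exact: (@integrable_scale _ _ R leb D mD _ _ iu1n).
    - move=> x xD; rewrite -mulrBr normrM mulrC ler_wpM2r//.
      by apply: (le_trans (HLp _ _ _)); rewrite ler_wpM2l ?(ltW Lp0)//; exact: node.
  rewrite (@RintegralZl _ _ R leb D (fun x => `|u1 x|) _ mD iu1n) -/I1.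
  move: H3; rewrite ler_pdivlMr//; apply: le_trans.
  rewrite mulrDr mulr1 mulrAC mulrC; have := h0 k; lra.
apply: (le_trans (ler_normD _ _)); rewrite [leRHS]splitr; exact: lerD.
Qed.

End limit_sections.

Section limit_passage.
Variable R : realType.
Local Notation leb := (@lebesgue_measure R).
Local Notation leb2 := (leb \x leb)%E.
Implicit Types (t x T e C : R).
Variables (L rho mu : R).
Hypotheses (L0 : 0 < L) (rho0 : 0 < rho) (mu0 : 0 < mu).
Local Notation D := (`]0, L[%classic : set R).
Variables (g : nat -> R -> R) (B B2 W2 : R) (N : nat -> nat) (h : nat -> R).
Variables (a b : nat -> R -> nat -> R) (u : R * R -> R).
Hypothesis lim_u : scheme_limit L rho mu g B B2 W2 N h a b u.
Let N0 := sl_size lim_u.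
Let hN := sl_mesh lim_u.
Let mD : measurable D. Proof. exact: measurable_itv. Qed.

Let y k i := weighted_step L (N k) (h k)
  (state_coef (N k) (h k) (g k) (a k) (b k) i).

Let y_sqint k i : (i < 3)%N -> sqint leb2 (y k i).
Proof. by move=> _; have [] := state_sqint L0 lim_u k i. Qed.

Definition kinetic_density (rho mu : R) (s : nat -> R * R -> R) t x :=
  rho / 2 * (expR t * s 0%N (t, x)) ^+ 2 + mu / 2 * (expR t * s 1%N (t, x)) ^+ 2.

Lemma hull_outside m s : hull (tail y m) s -> forall i z, ~ domain L z -> s i z = 0.
Proof.
elim => [_ [k _ <-] i z nz|c d {}s s' _ _ _ _ IH _ IH' i z nz].
  by rewrite /y /weighted_step patchE memNset// mulr0.
by rewrite IH// IH'// !mulr0 addr0.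
Qed.

Lemma measurable_kinetic_density s t : (forall i, (i < 2)%N -> measurable_fun setT (s i)) ->
  measurable_fun setT (kinetic_density rho mu s t).
Proof.
move=> ms; have sec i : (i < 2)%N -> measurable_fun setT (fun x => expR t * s i (t, x)).
  move=> i2; apply: measurable_funM => //.
  exact: (measurableT_comp (ms i i2) (pair1_measurable t)).
apply: measurable_funD; (apply: measurable_funM; first by []).
- by apply: measurable_funX; exact: sec.
- by apply: measurable_funX; exact: sec.
Qed.

Lemma kinetic_density_ge0 s t x : 0 <= kinetic_density rho mu s t x.
Proof.
by apply: addr_ge0; apply: mulr_ge0; rewrite ?sqr_ge0// divr_ge0// ltW.
Qed.

Let hull_measurable m s : hull (tail y m) s ->
  forall i, (i < 3)%N -> measurable_fun setT (s i).
Proof. by move=> hs i i3; have [] := hull_sqint y_sqint hs i3. Qed.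

Lemma hull_kinetic m s t C : hull (tail y m) s -> 0 < t ->
  (forall k, (m <= k)%N -> h k * (\sum_(j < N k) (rho / 2 * b k t j ^+ 2 +
    mu / 2 * bending (N k) (h k) (a k t) j ^+ 2)) <= C) ->
  leb.-integrable setT (fun x => (kinetic_density rho mu s t x)%:E) /\
  \int[leb]_x (kinetic_density rho mu s t x) <= C.
Proof.
move=> hs t0 HC; have tT : (`]0, +oo[%classic : set R) t by rewrite /= in_itv/= t0.
elim: hs => [_ [k /= mk <-]|c d {}s s' c0 d0 cd hs [i1 B1] hs' [i2 B2']].
  have [i1 E1] := @integral_cell _ _ _ _ (N0 k) L0 (hN k) (fun j =>
    rho / 2 * b k t j ^+ 2 + mu / 2 * bending (N k) (h k) (a k t) j ^+ 2).
  have yE : kinetic_density rho mu (y k) t = (fun x =>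
      rho / 2 * b k t (cell (N k) (h k) x) ^+ 2 +
      mu / 2 * bending (N k) (h k) (a k t) (cell (N k) (h k) x) ^+ 2) \_ D.
    apply/funext => x; rewrite patchE; case: ifPn => [|/negP]; rewrite inE => xD.
      rewrite /kinetic_density /y /weighted_step !step_functionE//=.
      by rewrite !(mulrA (expR t)) expRxMexpNx_1 !mul1r.
    have nd : ~ domain L (t, x) by case.
    rewrite /kinetic_density /y /weighted_step !patchE memNset//.
    by rewrite !mulr0 expr0n/= !mulr0 addr0.
  rewrite yE; split; last by rewrite -Rintegral_mkcond E1; exact: HC.
  have := (@integrable_mkcond _ _ R leb D (fun x => (rho / 2 * b k t (cell (N k) (h k) x) ^+ 2 +
      mu / 2 * bending (N k) (h k) (a k t) (cell (N k) (h k) x) ^+ 2)%:E) mD).1 i1.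
  apply: eq_integrable => // x _; rewrite !patchE; by case: ifP.
have j1 := @integrable_scale _ _ R leb setT measurableT c _ i1.
have j2 := @integrable_scale _ _ R leb setT measurableT d _ i2.
have j3 := @integrable_add _ _ R leb setT measurableT _ _ j1 j2.
have le x : kinetic_density rho mu (fun i z => c * s i z + d * s' i z) t x <=
    c * kinetic_density rho mu s t x + d * kinetic_density rho mu s' t x.
  have sq (p q : R) : (c * p + d * q) ^+ 2 <= c * p ^+ 2 + d * q ^+ 2.
    rewrite -subr_ge0 (_ : _ - _ = c * d * (p - q) ^+ 2).
      by rewrite mulr_ge0 ?sqr_ge0// mulr_ge0.
    have -> : d = 1 - c by rewrite -cd addrAC subrr add0r.
    ring.
  have E (p q : R) : expR t * (c * p + d * q) = c * (expR t * p) + d * (expR t * q) by ring.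
  rewrite /kinetic_density !E.
  have r2 : 0 <= rho / 2 by rewrite divr_ge0// ltW.
  have m2 : 0 <= mu / 2 by rewrite divr_ge0// ltW.
  apply: (le_trans (lerD (ler_wpM2l r2 (sq _ _)) (ler_wpM2l m2 (sq _ _)))).
  rewrite le_eqVlt; apply/orP; left; apply/eqP; ring.
have i3 : leb.-integrable setT
    (fun x => (kinetic_density rho mu (fun i z => c * s i z + d * s' i z) t x)%:E).
  apply: le_integrable j3 => //.
    apply: measurable_EFin_fun; apply: measurable_kinetic_density => i i2'.
    by apply: measurable_funD; apply: measurable_funM => //;
      [apply: (hull_measurable hs)|apply: (hull_measurable hs')]; exact: ltnW.
  move=> x _ /=; rewrite lee_fin ger0_norm ?kinetic_density_ge0//.
  exact: le_trans (le x) (ler_norm _).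
split => //.
apply: (@le_trans _ _ (\int[leb]_x (c * kinetic_density rho mu s t x +
    d * kinetic_density rho mu s' t x))); first exact: le_Rintegral.
rewrite (RintegralD measurableT j1 j2) !RintegralZl//.
have := ler_wpM2l c0 B1; have := ler_wpM2l d0 B2'.
have : c * C + d * C = C by rewrite -mulrDl cd mul1r.
lra.
Qed.

Variables (gs : nat -> nat -> R * R -> R) (Gl : nat -> R * R -> R) (A : set (R * R)).
Hypothesis gs_hull : forall m, hull (tail y m) (gs m).
Hypotheses (mA : measurable A) (A0 : leb2 (~` A) = 0%E).
Hypothesis gs_cvg : forall i z, (i < 3)%N -> A z -> gs n i z @[n --> \oo] --> Gl i z.
Hypothesis mGl : forall i, (i < 3)%N -> measurable_fun setT (Gl i).

Lemma section_null : {ae leb, forall t, leb (xsection (~` A) t) = 0%E}.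
Proof.
have := (@ae_eq_integral_abs _ _ R leb setT measurableT (leb \o xsection (~` A)) _).1.
move=> H; apply: filterS (H _ _).
- by move=> t /(_ I).
- by apply: measurable_fun_xsection; exact: measurableC.
- rewrite -[RHS]A0; apply: eq_integral => t _.
  by rewrite gee0_abs.
Qed.

Variable C : R -> R.
Hypothesis kinetic_bound : forall t e, 0 < t -> 0 < e -> exists K, forall k, (K <= k)%N ->
  h k * (\sum_(j < N k) (rho / 2 * b k t j ^+ 2 +
    mu / 2 * bending (N k) (h k) (a k t) j ^+ 2)) <= C t + e.

Lemma kinetic_limit : {ae leb, forall t, 0 < t ->
  (\int[leb]_x (kinetic_density rho mu Gl t x)%:E <= (C t)%:E)%E}.
Proof.
move: section_null; apply: filterS; first exact: (ae_filter_ringOfSetsType leb).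
move=> t At t0; apply/lee_addgt0Pr => e e0; rewrite -EFinD.
have [K HK] := kinetic_bound t0 e0.
apply: (@fatou_bound _ _ R leb (fun n => kinetic_density rho mu (gs n) t)
  _ (xsection A t)).
- move=> n; apply: measurable_kinetic_density => i i2.
  by apply: (hull_measurable (gs_hull n)); exact: ltnW.
- by apply: measurable_kinetic_density => i i2; apply: mGl; exact: ltnW.
- by move=> n x; exact: kinetic_density_ge0.
- by move=> x; exact: kinetic_density_ge0.
- exact: measurable_xsection.
- by rewrite -At; congr (leb _); apply/seteqP; split => x; rewrite /xsection/= !inE.
- move=> x; rewrite /xsection/= inE => Ax.
  have c0 : gs n 0%N (t, x) @[n --> \oo] --> Gl 0%N (t, x) by exact: gs_cvg.
  have c1 : gs n 1%N (t, x) @[n --> \oo] --> Gl 1%N (t, x) by exact: gs_cvg.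
  rewrite /kinetic_density; under eq_cvg do rewrite !expr2.
  by rewrite !expr2; apply: cvgD; apply: cvgM; try (exact: cvg_cst);
    apply: cvgM; apply: cvgM => //; exact: cvg_cst.
- exists K => // n /= Kn.
  have [i1 i2] := @hull_kinetic n (gs n) t (C t + e) (gs_hull n) t0
    (fun k nk => HK k (leq_trans Kn nk)).
  by rewrite (@eq_ge0_integral_Rintegral _ _ R leb setT measurableT _ i1) lee_fin.
Qed.

Variable Phi : R -> R.
Hypothesis hPhi : potential Phi.
Variable eps : nat -> R.
Hypothesis eps0 : forall k, 0 < eps k.
Hypothesis eps_cvg : forall e, 0 < e -> exists K, forall k, (K <= k)%N -> eps k <= e.
Hypothesis gE : forall k, g k = potential_slope Phi (eps k).

Lemma limit_subdifferential z : A z -> domain L z ->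
  subdiff_lo Phi (u z) <= expR z.1 * Gl 2%N z <= subdiff_hi Phi (u z).
Proof.
move=> Az dz.
suff H eta : 0 < eta -> subdiff_lo Phi (u z) - eta <= expR z.1 * Gl 2%N z <=
    subdiff_hi Phi (u z) + eta.
  apply/andP; split; apply/ler_addgt0Pl => eta /H /andP[]; lra.
move=> eta0; have [delta d0 Hd] := potential_slope_cvg hPhi (u z) eta0.
have d2 : 0 < delta / 2 by rewrite divr_gt0.
have dd : delta / 2 < delta by lra.
have [K1 HK1] := eps_cvg d2; have [K2 HK2] := sl_cvg lim_u z.1 d2.
have in_itv_hull m s : (maxn K1 K2 <= m)%N -> hull (tail y m) s ->
    subdiff_lo Phi (u z) - eta <= expR z.1 * s 2%N z <= subdiff_hi Phi (u z) + eta.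
  rewrite geq_max => /andP[K1m K2m]; elim => [_ [k /= mk <-]|c d {}s s' c0 d0' cd _ IH _ IH'].
    case: z Az dz Hd HK2 => t x Az dz Hd HK2; have [tT xD] := dz.
    rewrite /y /weighted_step step_functionE//= mulrA expRxMexpNx_1 mul1r gE.
    apply: Hd.
      apply: le_lt_trans dd; apply: (HK2 k (leq_trans K2m mk) (t, x)).
      exact: domain_strip dz (lexx t).
    by rewrite eps0/=; apply: le_lt_trans dd; exact: HK1 (leq_trans K1m mk).
  move: IH IH' => /andP[l1 r1] /andP[l2 r2].
  have d1 : d = 1 - c by lra.
  have -> : expR z.1 * (c * s 2%N z + d * s' 2%N z) =
    c * (expR z.1 * s 2%N z) + d * (expR z.1 * s' 2%N z) by ring.
  have := ler_wpM2l c0 l1; have := ler_wpM2l d0' l2.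
  have := ler_wpM2l c0 r1; have := ler_wpM2l d0' r2.
  set lo := subdiff_lo _ _ - _; set hi := subdiff_hi _ _ + _.
  have E1 : c * lo + d * lo = lo by rewrite -mulrDl cd mul1r.
  have E2 : c * hi + d * hi = hi by rewrite -mulrDl cd mul1r.
  by move=> ? ? ? ?; apply/andP; split; lra.
have := @closed_cvg _ _ \oo _ (fun n => expR z.1 * gs n 2%N z)
  `[subdiff_lo Phi (u z) - eta, subdiff_hi Phi (u z) + eta]%classic _ _
  (expR z.1 * Gl 2%N z).
rewrite /= in_itv/=; apply.
- exact: interval_closed.
- exists (maxn K1 K2) => // n /= Kn; rewrite in_itv/=.
  exact: (in_itv_hull n _ Kn (gs_hull n)).
- by apply: cvgM; [exact: cvg_cst|exact: gs_cvg].
Qed.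

End limit_passage.

Section approximations.
Variable R : realType.
Local Notation leb := (@lebesgue_measure R).
Implicit Types (t x e : R).
Variables (L rho mu : R) (Phi : R -> R).
Hypotheses (L0 : 0 < L) (rho0 : 0 < rho) (mu0 : 0 < mu) (hPhi : potential Phi).
Local Notation D := (`]0, L[%classic : set R).
Variables (th th1 th2 th3 : R -> R) (Ck : R).
Hypothesis hk : is_kernel th th1 th2 th3 Ck.
Variables (u0 u1 w0 : R -> R).
Hypotheses (i0 : leb.-integrable D (fun x => (u0 x)%:E))
  (i02 : leb.-integrable D (fun x => (u0 x ^+ 2)%:E))
  (i1 : leb.-integrable D (fun x => (u1 x)%:E))
  (i12 : leb.-integrable D (fun x => (u1 x ^+ 2)%:E))
  (iw : leb.-integrable D (fun x => (w0 x)%:E))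
  (iw2 : leb.-integrable D (fun x => (w0 x ^+ 2)%:E))
  (w0E : weak_derivative L 2 u0 w0).
Local Notation lip := (potential_lip Phi).

Definition data_energy (L rho mu : R) (u1 w0 : R -> R) : R :=
  rho / 2 * \int[leb]_(x in `]0, L[) (u1 x ^+ 2) +
  mu / 2 * \int[leb]_(x in `]0, L[) (w0 x ^+ 2).
Local Notation E1 := (data_energy L rho mu u1 w0).

Lemma approximation_exists BPhi (m : nat) (h e : R) :
  (forall x, 0 <= Phi x <= BPhi) -> (0 < m)%N -> h * (m + m)%:R = L -> 0 < e <= 1 ->
  let B2 := 2 * (E1 + L * (BPhi + lip)) / rho in
  let W2 := 2 * (E1 + L * (BPhi + lip)) / mu in
  let A2 t := 2 * (Ck * \int[leb]_(x in D) (u0 x ^+ 2)) + 2 * B2 * t ^+ 2 in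
  exists (a b : R -> nat -> R) (G : R -> R),
    [/\ scheme_solution (m + m) h rho mu (potential_slope Phi e) a b,
        forall j, (j < m + m)%N -> a 0 j = node_average th h L u0 j /\
          b 0 j = cell_average h L u1 j,
        forall x, `|G x - Phi x| <= lip * e,
        forall t, 0 <= t ->
          h * (\sum_(j < m + m) (rho / 2 * b t j ^+ 2 +
            mu / 2 * bending (m + m) h (a t) j ^+ 2)) + h * (\sum_(j < m + m) G (a t j))
          <= E1 + h * (\sum_(j < m + m) G (a 0 j))
      & grid_bounds (m + m) h a b A2 B2 W2].
Proof.
move=> HB m0 hN /andP[e0 e1] B2 W2 A2; set N := (m + m)%N in hN *.
have N0 : (0 < N)%N by rewrite addn_gt0 m0.
have h0 : 0 < h by rewrite -(@pmulr_lgt0 _ N%:R) ?ltr0n// hN.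
have hN' : h * N%:R = L by [].
have lip0 := potential_lip_gt0 hPhi.
have gK x y : `|potential_slope Phi e x - potential_slope Phi e y| <=
    2 * lip / e * `|x - y| by exact: potential_slope_lipschitz.
have [G dG HG] := potential_smoothing hPhi e0.
have [a [b [sol init]]] := scheme_exists N h rho0 mu0 gK
  (node_average th h L u0) (cell_average h L u1).
have Eb0 : h * (\sum_(j < N) (rho / 2 * b 0 j ^+ 2 +
    mu / 2 * bending N h (a 0) j ^+ 2)) <= E1.
  rewrite big_split/= -!mulr_sumr mulrDr; apply: lerD; rewrite mulrCA ler_wpM2l//.
  - by rewrite divr_ge0// ltW.
  - rewrite (eq_bigr (fun j : 'I_N => cell_average h L u1 j ^+ 2)).
      exact: cell_average_l2.
    by move=> j _; have [_ ->] := init j (ltn_ord j).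
  - by rewrite divr_ge0// ltW.
  - rewrite (eq_bigr (fun j : 'I_N => bending N h (node_average th h L u0) j ^+ 2)).
      exact: (bending_average_l2 hk N0 L0 hN' i0 iw iw2 w0E).
    move=> j _; congr (_ ^+ 2); apply: eq_bigr => k _.
    by have [-> _] := init k (ltn_ord k).
have Et t : 0 <= t -> h * (\sum_(j < N) (rho / 2 * b t j ^+ 2 +
    mu / 2 * bending N h (a t) j ^+ 2)) + h * (\sum_(j < N) G (a t j)) <=
    E1 + h * (\sum_(j < N) G (a 0 j)).
  move=> t0; have EE s : h * (\sum_(j < N) (rho / 2 * b s j ^+ 2 +
      mu / 2 * bending N h (a s) j ^+ 2)) + h * (\sum_(j < N) G (a s j)) =
      h * scheme_energy N h rho mu G a b s.
    rewrite /scheme_energy -mulrDr -!big_split/=; congr (_ * _).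
    by apply: eq_bigr => j _; ring.
  by rewrite EE (scheme_energy_cst rho0 dG sol t0) -EE lerD2r.
have G0 t : 0 <= h * (\sum_(j < N) G (a t j)).
  rewrite mulr_ge0 ?(ltW h0)// sumr_ge0// => j _.
  by have [] := HG (a t j).
have GB : h * (\sum_(j < N) G (a 0 j)) <= L * (BPhi + lip).
  rewrite -hN -mulrA ler_wpM2l ?(ltW h0)// mulr_natl -[X in _ *+ X]card_ord -sumr_const.
  apply: ler_sum => j _; have [_] := HG (a 0 j); have /andP[_] := HB (a 0 j).
  have : lip * e <= lip by rewrite ler_piMr// ltW.
  rewrite ler_norml => ? ? /andP[_ ?]; lra.
have r2 : 0 < rho / 2 by rewrite divr_gt0.
have m2 : 0 < mu / 2 by rewrite divr_gt0.
have sb t : 0 <= h * (\sum_(j < N) b t j ^+ 2).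
  by rewrite mulr_ge0 ?(ltW h0)// sumr_ge0// => j _; exact: sqr_ge0.
have sw t : 0 <= h * (\sum_(j < N) bending N h (a t) j ^+ 2).
  by rewrite mulr_ge0 ?(ltW h0)// sumr_ge0// => j _; exact: sqr_ge0.
have Ek t : 0 <= t -> rho / 2 * (h * (\sum_(j < N) b t j ^+ 2)) +
    mu / 2 * (h * (\sum_(j < N) bending N h (a t) j ^+ 2)) <= E1 + L * (BPhi + lip).
  move=> t0; have := Et t t0; have := G0 t.
  rewrite big_split/= -!mulr_sumr mulrDr !(mulrCA h); move: GB.
  set X1 := rho / 2 * _; set X2 := mu / 2 * _; lra.
have Bb t : 0 <= t -> h * (\sum_(j < N) b t j ^+ 2) <= B2.
  move=> t0; have := Ek t t0; have := mulr_ge0 (ltW m2) (sw t) => H1 H2.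
  rewrite /B2 ler_pdivlMr//; lra.
have Bw t : 0 <= t -> h * (\sum_(j < N) bending N h (a t) j ^+ 2) <= W2.
  move=> t0; have := Ek t t0; have := mulr_ge0 (ltW r2) (sb t) => H1 H2.
  rewrite /W2 ler_pdivlMr//; lra.
have B20 : 0 <= B2 := le_trans (sb 0) (Bb 0 (lexx 0)).
exists a, b, G; split => //; first by move=> x; have [] := HG x.
split => //; first by move=> j jN t t0; have [] := sol j jN t t0.
move=> t t0.
have a00 : h * (\sum_(j < N) a 0 j ^+ 2) <= Ck * \int[leb]_(x in D) (u0 x ^+ 2).
  rewrite (eq_bigr (fun j : 'I_N => node_average th h L u0 j ^+ 2)).
    exact: (node_average_l2 hk).
  by move=> j _; have [->] := init j (ltn_ord j).
have diff : h * (\sum_(j < N) (a t j - a 0 j) ^+ 2) <= B2 * t ^+ 2.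
  have [->|tn0] := eqVneq t 0.
    rewrite big1 ?mulr0 ?expr0n ?mulr0// => j _; by rewrite subrr expr0n.
  have t00 : 0 < t by rewrite lt_neqAle eq_sym tn0.
  rewrite mulrC -ler_pdivlMr// mulrAC -[X in _ * X ^+ 2]subr0.
  apply: (@l2_time_lipschitz R N a b (B2 / h) 0 t) => //.
    by move=> j jN r r0; have [] := sol j jN r r0.
  by move=> r r0; rewrite ler_pdivlMr// mulrC; exact: Bb.
apply: (@le_trans _ _ (2 * (h * (\sum_(j < N) a 0 j ^+ 2)) +
    2 * (h * (\sum_(j < N) (a t j - a 0 j) ^+ 2)))).
  rewrite !(mulrCA 2) -mulrDr ler_wpM2l ?(ltW h0)// !mulr_sumr -big_split/=.
  apply: ler_sum => j _; rewrite -subr_ge0.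
  rewrite (_ : _ - _ = (a t j - 2 * a 0 j) ^+ 2) ?sqr_ge0//; ring.
rewrite /A2; move: a00 diff; rewrite -mulrA; lra.
Qed.

Lemma approximations_exist : exists B B2 W2 (N : nat -> nat) (h : nat -> R)
    (a b : nat -> R -> nat -> R) (u : R * R -> R) (eps delta : nat -> R)
    (G : nat -> R -> R),
  [/\ scheme_limit L rho mu (fun k => potential_slope Phi (eps k)) B B2 W2 N h a b u,
      unif_equicontinuous L [set u],
      [/\ forall k, 0 < eps k,
        forall e, 0 < e -> exists K, forall k, (K <= k)%N -> eps k <= e,
        forall e, 0 < e -> exists K, forall k, (K <= k)%N -> delta k <= e
      & forall k x, `|G k x - Phi x| <= delta k],
      forall k t, 0 <= t ->
        h k * (\sum_(j < N k) (rho / 2 * b k t j ^+ 2 +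
          mu / 2 * bending (N k) (h k) (a k t) j ^+ 2)) +
          h k * (\sum_(j < N k) G k (a k t j))
        <= E1 + h k * (\sum_(j < N k) G k (a k 0 j))
    & (forall k j, (j < N k)%N -> b k 0 j = cell_average (h k) L u1 j) /\
      {ae leb, forall x, D x -> u (0, x) = u0 x}].
Proof.
have [BPhi BPhi0 HB] := potential_bounded hPhi.
pose m (n : nat) := n.+1.
pose h n : R := L / (m n + m n)%:R.
pose eps n : R := n.+1%:R^-1.
have hN n : h n * (m n + m n)%:R = L by rewrite /h divfK// pnatr_eq0.
have eps0 n : 0 < eps n by rewrite invr_gt0.
have eps1 n : 0 < eps n <= 1 by rewrite eps0/= invf_le1// ler1n.
have lip0 := potential_lip_gt0 hPhi.
set B2 := 2 * (E1 + L * (BPhi + lip)) / rho.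
set W2 := 2 * (E1 + L * (BPhi + lip)) / mu.
set A2 := fun t : R => 2 * (Ck * \int[leb]_(x in D) (u0 x ^+ 2)) + 2 * B2 * t ^+ 2.
have [a /choice [b /choice [G HabG]]] := choice (fun n =>
  approximation_exists HB (ltn0Sn n) (hN n) (eps1 n)).
have epsc e : 0 < e -> exists K, forall n, (K <= n)%N -> eps n <= e.
  move=> e_gt0; exists (Num.truncn e^-1) => n Kn; rewrite /eps invf_ple ?posrE//.
  apply: (le_trans (ltW (truncnS_gt _))); rewrite ler_nat ltnS//.
have heps n : h n <= L * eps n.
  rewrite /h /eps ler_pM2l// lef_pV2 ?posrE ?ltr0n// ler_nat /m; lia.
have hc e : 0 < e -> exists K, forall n, (K <= n)%N -> h n <= e.
  move=> e_gt0; have [K HK] := epsc _ (divr_gt0 e_gt0 L0); exists K => n /HK.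
  by rewrite ler_pdivlMr// mulrC; exact: le_trans (heps n).
have hgt0 n : 0 < h n by rewrite /h divr_gt0// ltr0n.
have gb n : grid_bounds (m n + m n) (h n) (a n) (b n) A2 B2 W2 by have [] := HabG n.
have sq0 n (c : nat -> R) : 0 <= h n * (\sum_(j < m n + m n) c j ^+ 2).
  by rewrite mulr_ge0 ?(ltW (hgt0 n))// sumr_ge0// => j _; exact: sqr_ge0.
have [_ gA gB gW] := gb 0%N.
have B20 : 0 <= B2 := le_trans (sq0 _ _) (gB 0 (lexx 0)).
have W20 : 0 <= W2 := le_trans (sq0 _ _) (gW 0 (lexx 0)).
have A20 : 0 <= A2 0 := le_trans (sq0 _ _) (gA 0 (lexx 0)).
have A2mono s t : 0 <= s -> s <= t -> A2 s <= A2 t.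
  move=> s0 st; have sq : s ^+ 2 <= t ^+ 2.
    by rewrite ler_pXn2r// nnegrE//; exact: le_trans st.
  have BB : 0 <= 2 * B2 by rewrite mulr_ge0.
  by have := ler_wpM2l BB sq; rewrite /A2/=; lra.
pose f n := step_function (m n + m n) (h n) (a n).
have fM n z : 0 <= z.1 -> 0 <= z.2 <= L -> `|f n z| <= grid_sup L (A2 z.1) W2.
  exact: (step_function_bound (ltn0Sn n) L0 (hN n) (gb n)).
have fe T e : 0 < e -> exists (d : R) (K : nat), 0 < d /\
    forall n, (K <= n)%N -> forall z z', strip T L z -> strip T L z' ->
      `|z.1 - z'.1| <= d -> `|z.2 - z'.2| <= d -> `|f n z - f n z'| <= e.
  move=> e_gt0; have [d [eta [d0 eta0 H]]] :=
    @step_function_equicontinuous R L A2 B2 W2 `|T| e L0 (normr_ge0 T) e_gt0 A2mono A20 B20 W20.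
  have [K HK] := hc _ eta0; exists d, K; split => // n Kn z z' sz sz' z1 z2.
  have sT z0 : strip T L z0 -> strip `|T| L z0.
    by move=> [/andP[p q] ?]; split => //; rewrite p (le_trans q)// ler_norm.
  exact: (H (m n) (h n) (a n) (b n) (ltn0Sn n) (hN n) (HK n Kn) (gb n) z z' (sT z sz) (sT z' sz')).
have [u [s [sk ueq ucvg]]] :=
  @asymptotic_ascoli R L f (fun t => grid_sup L (A2 t) W2) fM fe.
pose N k := (m (s k) + m (s k))%N.
exists lip, B2, W2, N, (h \o s), (a \o s), (b \o s), u, (eps \o s),
  (fun k => lip * eps (s k)), (G \o s).
have sub (P : nat -> Prop) : (exists K, forall n, (K <= n)%N -> P n) ->
    exists K, forall k, (K <= k)%N -> P (s k).
  by move=> [K HK]; exists K => k Kk; apply: HK; exact: leq_trans Kk (sk k).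
have Hs k := HabG (s k).
split.
- split.
  + exists (fun k => 2 * lip / eps (s k)) => k x y.
    exact: (potential_slope_lipschitz hPhi _ _ (eps0 (s k))).
  + by move=> k x; exact: (potential_slope_bound hPhi _ (eps0 (s k))).
  + by move=> k.
  + by move=> k; exact: hN.
  + by move=> k; have [] := Hs k.
  + by move=> k; have [_ _ + _] := gb (s k); exact.
  + by move=> k; have [_ _ _ +] := gb (s k); exact.
  + by move=> e e0; exact: (sub (fun n => h n <= e) (hc e e0)).
  + exact: ucvg.
  + move=> T; exists (`|grid_sup L (A2 `|T|) W2| + 1); first by rewrite ltr_wpDl.
    move=> k z [/andP[z10 z1T] z2]; apply: (le_trans (fM (s k) z z10 z2)).
    have AT : A2 z.1 <= A2 `|T| by rewrite A2mono// (le_trans z1T)// ler_norm.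
    apply: (@le_trans _ _ (grid_sup L (A2 `|T|) W2)); last first.
      by rewrite (le_trans (ler_norm _))// lerDl.
    rewrite /grid_sup lerD//.
      by rewrite ler_wpM2r ?invr_ge0 ?mulr_ge0 ?(ltW L0)// lerD2l.
    by rewrite ler_wpM2l ?(ltW L0)//; exact: grid_slope_mono.
- exact: ueq.
- split.
  + by move=> k; exact: eps0.
  + by move=> e e0; exact: (sub (fun n => eps n <= e) (epsc e e0)).
  + move=> e e0; have [K HK] := sub (fun n => eps n <= e / lip) (epsc _ (divr_gt0 e0 lip0)).
    by exists K => k /HK; rewrite ler_pdivlMr// mulrC.
  + by move=> k x; have [_ _ + _ _] := Hs k; exact.
- by move=> k; have [_ _ _ + _] := Hs k; exact.
split; first by move=> k j jN; have [_ + _ _ _] := Hs k; move=> /(_ j jN)[].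
move: (node_average_cvg hk L0 i0); apply: filterS; first exact: (ae_filter_ringOfSetsType leb).
move=> x H xD; apply/eqP; rewrite -subr_eq0 -normr_le0; apply/ler_addgt0Pl => e e0.
have e2 : 0 < e / 2 by rewrite divr_gt0.
have [d d0 Hd] := H xD _ e2.
have [K1 HK1] := hc _ (divr_gt0 d0 (ltr0n R 2)).
have [K2 HK2] := ucvg 0 _ e2.
pose k := maxn K1 K2.
have hd : h (s k) < d.
  apply: (@le_lt_trans _ _ (d / 2)); last by lra.
  by apply: HK1; exact: leq_trans (leq_maxl _ _) (sk k).
have := Hd (N k) (h (s k)) isT (hN (s k)) hd.
have := HK2 k (leq_maxr _ _) (0, x); rewrite /f /step_function/= -/(N k).
have cN : (cell (N k) (h (s k)) x < N k)%N by exact: cell_lt.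
have [_ + _ _ _] := Hs k; move=> /(_ _ cN)[-> _].
set v := node_average _ _ _ _ _ => H1 H2.
have sx : strip 0 L (0, x).
  by move: xD; rewrite /= in_itv/= => /andP[x0 xL]; split; apply/andP; split => //=; exact: ltW.
have := H1 sx; rewrite addr0.
have -> : u (0, x) - u0 x = (v - u0 x) - (v - u (0, x)) by ring.
move=> H3; apply: (le_trans (ler_normB _ _)); lra.
Qed.

End approximations.

Section conclusion.
Variable R : realType.
Local Notation leb := (@lebesgue_measure R).
Local Notation leb2 := (leb \x leb)%E.
Implicit Types (t x T e L M : R) (F v u : R * R -> R).

Lemma iterated_domain_integral L F :
  leb2.-integrable setT (fun z => ((F \_ (domain L)) z)%:E) ->
  \int[leb]_(t in `]0, +oo[) \int[leb]_(x in `]0, L[) F (t, x) =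
  \int[leb2]_z (F \_ (domain L)) z.
Proof.
move=> iF; rewrite -(@iterated_integral R L)//; last first.
  by move=> z nz; rewrite patchE memNset.
apply: eq_Rintegral => t; rewrite inE => tT; apply: eq_Rintegral => x; rewrite inE => xD.
by rewrite patchE mem_set.
Qed.

Lemma Linfty_L2_bound L v M : 0 < L -> 0 <= M -> measurable_fun setT v ->
  {ae leb, forall t, 0 < t -> (\int[leb]_(x in `]0%R, L[) (v (t, x) ^+ 2)%:E <= M%:E)%E} ->
  Linfty_L2 L v.
Proof.
move=> L0 M0 mv vM; split; first exact: measurable_funTS.
apply: (@le_lt_trans _ _ (M `^ 2^-1)%:E); last exact: ltry.
rewrite Lnorm.unlock /=; case: ifP => _; last by rewrite lee_fin powR_ge0.
apply/ess_supP; move: vM; apply: filterS; first exact: (ae_filter_ringOfSetsType leb).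
move=> t Ht /=; rewrite patchE; case: ifPn => [|_]; last first.
  by rewrite abse0 lee_fin powR_ge0.
rewrite inE /= in_itv/= andbT => t0.
rewrite gee0_abs; last exact: poweR_ge0.
rewrite -poweR_EFin; apply: gt0_ler_poweR.
- by rewrite invr_ge0.
- rewrite in_itv/= leey andbT; by apply: integral_ge0 => x _; rewrite lee_fin powR_ge0.
- rewrite -[is_true _]/(is_true (0 <= M%:E <= +oo)%E) leey andbT lee_fin. exact: M0.
apply: le_trans (Ht t0); rewrite [leRHS]integral_mkcond le_eqVlt; apply/orP; left.
apply/eqP; apply: eq_integral => x _; rewrite /= !patchE.
case: ifP => _.
  by rewrite powR_mulrn ?real_normK ?num_real.
by rewrite normr0 powR0.
Qed.

Lemma continuous_closed_measurable L u : 0 < L ->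
  measurable_fun setT (u \_ (domain L)) -> unif_equicontinuous L [set u] ->
  measurable_fun (closed_domain L) u.
Proof.
move=> L0 mu ueq.
pose r (n : nat) : R := n.+1%:R^-1.
pose S n (z : R * R) := (z.1 + r n, (1 - r n / 2) * z.2 + r n / 2 * (L / 2)).
have mC : measurable (closed_domain L) by apply: measurableX; exact: measurable_itv.
have r0 n : 0 < r n by rewrite invr_gt0.
have r1 n : r n <= 1 by rewrite invf_le1// ler1n.
apply: (@measurable_fun_cvg _ _ _ _ (fun n => (u \_ (domain L)) \o S n)).
  move=> n; apply: measurable_funTS; apply: measurableT_comp => //.
  apply/measurable_fun_pairP; split.
    by apply: measurable_funD => //; exact: measurable_fst.
  apply: measurable_funD => //; apply: measurable_funM => //; exact: measurable_snd.
move=> [t x] [/= + +]; rewrite !in_itv/= andbT => t0 /andP[x0 xL].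
apply/cvgrPdist_le => e e0.
have [d d0 Hd] := ueq (t + 1) e e0.
have [K HK] : exists K, forall n, (K <= n)%N -> r n * (1 + L) <= d.
  exists (Num.truncn ((1 + L) / d)) => n Kn; rewrite /r mulrC ler_pdivrMr//.
  rewrite -ler_pdivrMl// mulrC; apply: (le_trans (ltW (truncnS_gt _))).
  by rewrite ler_nat ltnS.
exists K => // n /= Kn; have := HK n Kn; have rn0 := r0 n; have rn1 := r1 n.
have xr : 0 <= r n * x by rewrite mulr_ge0// ltW.
have xr2 : r n * x <= r n * L by rewrite ler_wpM2l// ltW.
have Lr : 0 < r n * L by rewrite mulr_gt0.
have Lr2 : r n * L <= L by rewrite ler_piMl// ltW.
have xr3 : r n * x <= x by rewrite ler_piMl.
have E : (1 - r n / 2) * x + r n / 2 * (L / 2) = x - r n * x / 2 + r n * L / 4 by field.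
rewrite mulrDr mulr1 => rd.
have dS : domain L (S n (t, x)).
  split; rewrite /= in_itv/= ?andbT; first by lra.
  have LX : r n * (L - x) <= L - x by rewrite ler_piMl// subr_ge0.
  by rewrite E; apply/andP; split; lra.
rewrite /= patchE mem_set//; apply: Hd => //=.
- by split => /=; apply/andP; split; lra.
- by move: dS => [/= _]; rewrite in_itv/= => /andP[? ?]; split => /=; apply/andP; split; lra.
- by rewrite ler_norml; apply/andP; split; lra.
- by rewrite E ler_norml; apply/andP; split; lra.
Qed.

End conclusion.

Section null_set_modification.
Context d (T : measurableType d) (R : realType).
Variable mu : {measure set T -> \bar R}.

Lemma eq_off_null_integral (f f' : T -> R) (A : set T) :
  measurable A -> mu (~` A) = 0%E -> measurable_fun setT f ->
  (forall z, A z -> f z = f' z) -> mu.-integrable setT (fun z => (f' z)%:E) ->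
  mu.-integrable setT (fun z => (f z)%:E) /\ \int[mu]_z f z = \int[mu]_z f' z.
Proof.
move=> mA A0 mf ff' /integrableP[mf' if'].
have mEf : measurable_fun setT (fun z => (f z)%:E) by exact: measurable_EFin_fun.
have null (P : T -> Prop) : (forall z, A z -> P z) -> {ae mu, forall z, P z}.
  move=> HP; exists (~` A); split => //; first exact: measurableC.
  by move=> z /= nP Az; apply: nP; exact: HP.
split; last first.
  congr fine; apply: ae_eq_integral => //.
  by apply: null => z Az _; rewrite ff'.
apply/integrableP; split => //; rewrite (@ae_eq_integral _ _ _ mu setT
  (fun z => `|(f' z)%:E|%E) (fun z => `|(f z)%:E|%E))//.
- exact: measurableT_comp.
- exact: measurableT_comp.
- by apply: null => z Az _; rewrite ff'.
Qed.

End null_set_modification.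

Section existence.
Variable R : realType.
Local Notation leb := (@lebesgue_measure R).
Local Notation leb2 := (leb \x leb)%E.
Implicit Types (t x T e : R) (phi : R * R -> R).
Variables (L rho mu : R) (Phi : R -> R).
Hypotheses (L0 : 0 < L) (rho0 : 0 < rho) (mu0 : 0 < mu) (hPhi : potential Phi).
Local Notation D := (`]0, L[%classic : set R).
Variables (u0 u1 w0 : R -> R).
Hypotheses (i0 : leb.-integrable D (fun x => (u0 x)%:E))
  (i1 : leb.-integrable D (fun x => (u1 x)%:E))
  (i12 : leb.-integrable D (fun x => (u1 x ^+ 2)%:E))
  (iw2 : leb.-integrable D (fun x => (w0 x ^+ 2)%:E)).
Local Notation E1 := (data_energy L rho mu u1 w0).
Variables (eps : nat -> R) (B B2 W2 : R) (N : nat -> nat) (h : nat -> R).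
Variables (a b : nat -> R -> nat -> R) (u : R * R -> R).
Hypothesis lim_u : scheme_limit L rho mu (fun k => potential_slope Phi (eps k))
  B B2 W2 N h a b u.
Hypothesis ueq : unif_equicontinuous L [set u].
Hypothesis eps0 : forall k, 0 < eps k.
Hypothesis eps_cvg : forall e, 0 < e -> exists K, forall k, (K <= k)%N -> eps k <= e.
Hypothesis b_init : forall k j, (j < N k)%N -> b k 0 j = cell_average (h k) L u1 j.
Hypothesis u_init : {ae leb, forall x, D x -> u (0, x) = u0 x}.
Hypothesis kin : forall t e, 0 <= t -> 0 < e -> exists K, forall k, (K <= k)%N ->
  h k * (\sum_(j < N k) (rho / 2 * b k t j ^+ 2 +
    mu / 2 * bending (N k) (h k) (a k t) j ^+ 2)) <=
  E1 + \int[leb]_(x in D) Phi (u (0, x)) - \int[leb]_(x in D) Phi (u (t, x)) + e.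

Let mD : measurable D. Proof. exact: measurable_itv. Qed.

Let y k i := weighted_step L (N k) (h k)
  (state_coef (N k) (h k) (potential_slope Phi (eps k)) (a k) (b k) i).

Variables (gs : nat -> nat -> R * R -> R) (Gl : nat -> R * R -> R) (A : set (R * R)).
Hypothesis gs_hull : forall m, hull (tail y m) (gs m).
Hypotheses (mA : measurable A) (A0 : leb2 (~` A) = 0%E).
Hypothesis gs_cvg : forall i z, (i < 3)%N -> A z -> gs n i z @[n --> \oo] --> Gl i z.
Hypothesis Gl_sqint : forall i, (i < 3)%N -> sqint leb2 (Gl i) /\ forall m,
  sqint leb2 (fun z => gs m i z - Gl i z) /\
  nrm2 leb2 (fun z => gs m i z - Gl i z) <= 1 / 2 ^+ m.

Let Gl_measurable i : (i < 3)%N -> measurable_fun setT (Gl i).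
Proof. by move=> i3; have [[]] := Gl_sqint i3. Qed.

Definition unweighted (G : nat -> R * R -> R) i (z : R * R) := expR z.1 * G i z.

Let unweighted_measurable i : (i < 3)%N -> measurable_fun setT (unweighted Gl i).
Proof.
move=> i3; apply: measurable_funM; last exact: Gl_measurable.
by under eq_fun do rewrite -[X in expR X]mul1r; exact: measurable_weight.
Qed.

Lemma limit_identity V thetau (theta : nat -> R * R -> R) (al : nat -> R) :
  (forall i, (i < 3)%N -> compact_smooth (theta i)) ->
  (forall e, 0 < e -> exists K, forall k, (K <= k)%N ->
    `|(V + \int[leb2]_z ((fun z => u z * thetau z) \_ (domain L)) z) +
      \sum_(i < 3) \int[leb2]_z (y k i z * weighted_test_function L (al i) (theta i) z)|
      <= e) ->
  (V + \int[leb2]_z ((fun z => u z * thetau z) \_ (domain L)) z) +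
    \sum_(i < 3) \int[leb2]_z (Gl i z * weighted_test_function L (al i) (theta i) z) = 0.
Proof.
move=> sth H.
have sy k i : (i < 3)%N -> sqint leb2 (y k i).
  by move=> _; have [] := state_sqint L0 lim_u k i.
have sP i : (i < 3)%N -> sqint leb2 (weighted_test_function L (al i) (theta i)).
  by move=> i3; apply: sqint_scale; apply: weighted_test => //; exact: sth.
exact: (@affine_functional_limit _ _ R leb2 3 y gs Gl _ _ sy sP gs_hull Gl_sqint H).
Qed.

Lemma test_integral i theta : (i < 3)%N -> compact_smooth theta ->
  leb2.-integrable setT
    (fun z => (((fun z => unweighted Gl i z * theta z) \_ (domain L)) z)%:E) /\
  forall c, \int[leb2]_z (Gl i z * weighted_test_function L c theta z) =
    c * \int[leb2]_z ((fun z => unweighted Gl i z * theta z) \_ (domain L)) z.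
Proof.
move=> i3 sth; have [sG _] := Gl_sqint i3.
have E z : ((fun z => unweighted Gl i z * theta z) \_ (domain L)) z =
    Gl i z * ((fun z => expR z.1 * theta z) \_ (domain L)) z.
  rewrite !patchE; case: ifP => _; last by rewrite mulr0.
  by rewrite /unweighted mulrAC mulrC mulrA.
have iE := sqint_mul sG (weighted_test L0 sth).
have iE' : leb2.-integrable setT
    (fun z => (((fun z => unweighted Gl i z * theta z) \_ (domain L)) z)%:E).
  by apply: eq_integrable iE => // z _; rewrite E.
split => // c; rewrite -(RintegralZl _ measurableT iE').
by apply: eq_Rintegral => z _; rewrite E /weighted_test_function mulrCA.
Qed.

Lemma limit_velocity : weak_d_t L u (unweighted Gl 0).
Proof.
move=> phi tphi; have sphi := test_function_compact_smooth tphi.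
have := @limit_identity 0 (d_t phi) (fun=> phi) (fun i => (i == 0%N)%:R) (fun _ _ => sphi)
  (velocity_residual L0 lim_u tphi).
have T i (i3 : (i < 3)%N) := (test_integral i3 sphi).2.
rewrite !big_ord_recr big_ord0/= (T 0%N isT) (T 1%N isT) (T 2%N isT).
rewrite !mul0r mul1r !add0r !addr0 => E.
rewrite (iterated_domain_integral (F := fun z => u z * d_t phi z)); last first.
  exact: (integrable_limit_test L0 lim_u (compact_smooth_dt sphi)).
rewrite (iterated_domain_integral (F := fun z => unweighted Gl 0 z * phi z)).
  by apply/eqP; rewrite -addr_eq0 E.
exact: (test_integral _ sphi).1.
Qed.

Lemma limit_bending : weak_d_xx L u (unweighted Gl 1).
Proof.
move=> phi tphi; have sphi := test_function_compact_smooth tphi.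
have := @limit_identity 0 (d_x (d_x phi)) (fun=> phi) (fun i => - (i == 1%N)%:R)
  (fun _ _ => sphi) (bending_residual L0 lim_u tphi).
have T i (i3 : (i < 3)%N) := (test_integral i3 sphi).2.
rewrite !big_ord_recr big_ord0/= (T 0%N isT) (T 1%N isT) (T 2%N isT).
rewrite !oppr0 !mul0r mulN1r !add0r !addr0 => /eqP; rewrite subr_eq0 => /eqP E.
rewrite (iterated_domain_integral (F := fun z => u z * d_x (d_x phi) z)); last first.
  exact: (integrable_limit_test L0 lim_u (compact_smooth_dx (compact_smooth_dx sphi))).
rewrite (iterated_domain_integral (F := fun z => unweighted Gl 1 z * phi z))//.
exact: (test_integral _ sphi).1.
Qed.

Definition interior_slope (Phi : R -> R) : R -> R := derive1 Phi \_ `]-1, 1[.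

(* Off the set where the convex combinations converge, any measurable selection of
   the subdifferential will do. *)
Definition subdiff_selection (z : R * R) : R :=
  \1_(A `&` domain L) z * unweighted Gl 2 z +
  (1 - \1_(A `&` domain L) z) * interior_slope Phi (u z).

Let mS : measurable (A `&` domain L).
Proof. by apply: measurableI => //; exact: measurable_domain. Qed.

Lemma subdiff_selection_measurable : measurable_fun (closed_domain L) subdiff_selection.
Proof.
have m1 : measurable_fun (closed_domain L) (\1_(A `&` domain L) : R * R -> R).
  by apply: measurable_funTS; exact: measurable_indic.
apply: measurable_funD; apply: measurable_funM => //.
- by apply: measurable_funTS; exact: unweighted_measurable.
- exact: measurable_funB.
apply: measurableT_comp; last first.
  by apply: continuous_closed_measurable => //; exact: measurable_limit lim_u.
apply/(measurable_restrictT _ (measurable_itv _)).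
apply: continuous_at_measurable => // x; rewrite /= in_itv/= => /andP[x1 x2].
have [||_ dd _] := Phi_C2 hPhi (x := x); [lra|lra|].
exact/differentiable_continuous/derivable1_diffP.
Qed.

Lemma limit_in_subdifferential : in_subdifferential L Phi u subdiff_selection.
Proof.
split; first exact: subdiff_selection_measurable.
have s1 := slope1_gt0 hPhi; have sN1 := slopeN1_lt0 hPhi.
move=> z _; rewrite /subdiff_selection indicE.
have [Sz|nS] := pselect ((A `&` domain L) z).
  rewrite mem_set// mulr1n mul1r subrr mul0r addr0.
  have := limit_subdifferential lim_u gs_hull gs_cvg hPhi eps0 eps_cvg (fun=> erefl)
    Sz.1 Sz.2.
  rewrite -/(unweighted Gl 2 z) /subdiff_lo /subdiff_hi; set hz := unweighted _ _ _.
  move=> Hz; split => uz; move: Hz.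
  - by rewrite uz => /andP[? ?]; apply/eqP; rewrite eq_le; apply/andP.
  - rewrite ltNge (ltW uz)/= !ifF; first by move=> /andP[? ?]; lra.
      by apply/eqP => uE; move: uz; rewrite uE normr1 ltxx.
    by apply/eqP => uE; move: uz; rewrite uE normrN normr1 ltxx.
  - by rewrite uz normr1 ltxx eqxx -subr_eq0 opprK ifF//; apply/eqP; lra.
  - by rewrite uz normrN normr1 ltxx eqxx ifF//; apply/eqP; lra.
rewrite memNset// mulr0n mul0r subr0 mul1r add0r /interior_slope patchE; split.
- by move=> uz; rewrite mem_set//= in_itv/= -ltr_norml.
- move=> uz; rewrite memNset//= in_itv/= -ltr_norml; apply/negP; rewrite -leNgt ltW//.
- by move=> ->; rewrite memNset ?lexx ?(ltW s1)//= in_itv/= ltxx andbF.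
- by move=> ->; rewrite memNset ?lexx ?(ltW sN1)//= in_itv/= ltxx.
Qed.

Lemma limit_weak_equation : weak_equation L rho mu u0 u1 u (unweighted Gl 1) subdiff_selection.
Proof.
move=> phi tphi; have sphi := test_function_compact_smooth tphi.
have sx := compact_smooth_dx (compact_smooth_dx sphi).
have st := compact_smooth_dt sphi; have stt := compact_smooth_dt st.
pose V := \int[leb]_(x in D) (u0 x * d_t phi (0, x)) - \int[leb]_(x in D) (u1 x * phi (0, x)).
have HV := initial_residual L0 lim_u i0 i1 b_init u_init sphi.
have [_ E0] := test_integral (isT : 0 < 3)%N sphi.
have [iw Ew] := test_integral (isT : 1 < 3)%N sx.
have [ig Eg] := test_integral (isT : 2 < 3)%N sphi.
pose U := \int[leb2]_z ((fun z => u z * d_t (d_t phi) z) \_ (domain L)) z.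
pose I1 := \int[leb2]_z ((fun z => unweighted Gl 1 z * d_x (d_x phi) z) \_ (domain L)) z.
pose I2 := \int[leb2]_z ((fun z => unweighted Gl 2 z * phi z) \_ (domain L)) z.
have E : V + U + (mu / rho * I1 + rho^-1 * I2) = 0.
  have sth i : (i < 3)%N -> compact_smooth (if i == 1%N then d_x (d_x phi) else phi).
    by case: ifP.
  have := @limit_identity V (d_t (d_t phi)) (fun i => if i == 1%N then d_x (d_x phi) else phi)
    (fun i => [:: 0; mu / rho; rho^-1]`_i) sth
    (weak_equation_residual L0 rho0 mu0 lim_u tphi HV).
  by rewrite !big_ord_recr big_ord0/= E0 Ew Eg mul0r !add0r.
have iU := integrable_limit_test L0 lim_u stt.
pose H z := ((fun z => subdiff_selection z * phi z) \_ (domain L)) z.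
have mH : measurable_fun setT H.
  rewrite (_ : H = fun z => (subdiff_selection \_ (domain L)) z * (phi \_ (domain L)) z).
    apply: measurable_funM; last exact: measurable_compact_smooth.
    apply/(measurable_restrictT _ (measurable_domain L)).
    apply: measurable_funS subdiff_selection_measurable.
      by apply: measurableX; exact: measurable_itv.
    move=> [t x] [/= + +]; rewrite !in_itv/= => /andP[/ltW t0 _] /andP[/ltW x0 /ltW xL].
    by split; rewrite /= in_itv/= ?t0 ?x0 ?xL.
  by apply/funext => z; rewrite /H !patchE; case: ifP; rewrite ?mulr0.
have [iH EH] : leb2.-integrable setT (fun z => (H z)%:E) /\ \int[leb2]_z H z = I2.
  apply: (@eq_off_null_integral _ _ _ leb2 H _ A mA A0 mH _ ig).
  move=> z Az; rewrite /H !patchE; case: ifPn => //; rewrite inE => dz.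
  by rewrite /subdiff_selection indicE mem_set// mulr1n mul1r subrr mul0r addr0.
pose F z := rho * u z * d_t (d_t phi) z + mu * unweighted Gl 1 z * d_x (d_x phi) z +
  subdiff_selection z * phi z.
have FE z : (F \_ (domain L)) z = rho * ((fun z => u z * d_t (d_t phi) z) \_ (domain L)) z +
    mu * ((fun z => unweighted Gl 1 z * d_x (d_x phi) z) \_ (domain L)) z + H z.
  have [dz|nz] := pselect (domain L z).
    rewrite /H /patch mem_set//.
    by rewrite /F (mulrA rho) (mulrA mu).
  rewrite /H /patch memNset//.
  by rewrite (mulr0 rho) (mulr0 mu) addr0 addr0.
have j1 := integrable_scale measurableT rho iU.
have j2 := integrable_scale measurableT mu iw.
have j12 := integrable_add measurableT j1 j2.
have jF : leb2.-integrable setT (fun z => ((F \_ (domain L)) z)%:E).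
  by apply: eq_integrable (integrable_add measurableT j12 iH) => // z _; rewrite FE.
have IF : \int[leb2]_z (F \_ (domain L)) z = rho * U + mu * I1 + I2.
  transitivity (\int[leb2]_z (rho * ((fun z => u z * d_t (d_t phi) z) \_ (domain L)) z +
      mu * ((fun z => unweighted Gl 1 z * d_x (d_x phi) z) \_ (domain L)) z + H z)).
    by apply: eq_Rintegral => z _; exact: FE.
  rewrite (RintegralD measurableT j12 iH) EH.
  have R12 := RintegralD measurableT j1 j2.
  have RU := RintegralZl rho measurableT iU; have Rw := RintegralZl mu measurableT iw.
  by rewrite /U /I1 -RU -Rw -R12.
have scale (f psi : R -> R) M : leb.-integrable D (fun x => (f x)%:E) ->
    measurable_fun D psi -> (forall x, `|psi x| <= M) ->
    \int[leb]_(x in D) (rho * f x * psi x) = rho * \int[leb]_(x in D) (f x * psi x).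
  move=> fi mpsi psiM.
  have ii := @integrable_bounded_mul _ _ R leb D mD f psi M fi mpsi (fun x _ => psiM x).
  rewrite -(@RintegralZl _ _ R leb D (fun x => f x * psi x) rho mD ii).
  by apply: eq_Rintegral => x _; rewrite mulrA.
have sec (theta : R * R -> R) : compact_smooth theta -> measurable_fun D (fun x => theta (0, x)).
  move=> sth; apply: continuous_at_measurable => // x _.
  exact: (compact_smooth_section 0 sth).2.
have [Mp _ HMp] := compact_smooth_bound sphi; have [Mt _ HMt] := compact_smooth_bound st.
rewrite (@scale u1 (fun x => phi (0, x)) Mp i1 (sec _ sphi))//.
rewrite (@scale u0 (fun x => d_t phi (0, x)) Mt i0 (sec _ st))//.
rewrite (iterated_domain_integral (F := F) jF) IF.
have solve (v x y1 y2 : R) : v + x + (mu / rho * y1 + rho^-1 * y2) = 0 ->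
    rho * x + mu * y1 + y2 = - (rho * v).
  have -> : rho * x + mu * y1 + y2 =
      rho * (v + x + (mu / rho * y1 + rho^-1 * y2)) - rho * v.
    by field; exact: lt0r_neq0.
  by move=> ->; rewrite mulr0 sub0r.
rewrite (solve _ _ _ _ E) /V.
by rewrite mulrBr opprB addrAC subrK subrr.
Qed.

Lemma initial_potential :
  \int[leb]_(x in D) Phi (u (0, x)) = \int[leb]_(x in D) Phi (u0 x).
Proof.
congr fine; apply: ae_eq_integral => //.
- apply: measurable_EFin_fun.
  apply: (measurableT_comp (continuous_measurable_fun (Phi_continuous hPhi))).
  exact: (limit_section_measurable L0 lim_u (lexx 0)).
- apply: measurable_EFin_fun.
  apply: (measurableT_comp (continuous_measurable_fun (Phi_continuous hPhi))).
  by apply/measurable_EFinP; exact: measurable_int i0.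
- move: u_init; apply: filterS; first exact: (ae_filter_ringOfSetsType leb).
  by move=> x H xD; rewrite H.
Qed.

Local Notation Etot := (E1 + \int[leb]_(x in D) Phi (u0 x)).

Lemma energy_data : energy L rho mu Phi u1 w0 u0 = Etot%:E.
Proof.
have m0 : measurable_fun D u0 by apply/measurable_EFinP; exact: measurable_int i0.
have iP := potential_section_integrable L0 hPhi m0.
have j1 := @integrable_scale _ _ R leb D mD (rho / 2) _ i12.
have j2 := @integrable_scale _ _ R leb D mD (mu / 2) _ iw2.
have j12 := @integrable_add _ _ R leb D mD _ _ j1 j2.
have j := @integrable_add _ _ R leb D mD _ _ j12 iP.
rewrite /energy (_ : (\int[leb]_(x in D) _)%E = (\int[leb]_(x in D)
    (rho / 2 * u1 x ^+ 2 + mu / 2 * w0 x ^+ 2 + Phi (u0 x))%:E)%E); last first.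
  by apply: eq_integral => x _; congr (_%:E); field.
rewrite (@eq_ge0_integral_Rintegral _ _ R leb D mD _ j); congr (_%:E).
rewrite (@RintegralD _ _ R leb D _ _ mD j12 iP) (@RintegralD _ _ R leb D _ _ mD j1 j2).
by rewrite (@RintegralZl _ _ R leb D _ _ mD i12) (@RintegralZl _ _ R leb D _ _ mD iw2).
Qed.

Lemma limit_kinetic : {ae leb, forall t, 0 < t ->
  (\int[leb]_(x in D) (kinetic_density rho mu Gl t x)%:E <=
   (Etot - \int[leb]_(x in D) Phi (u (t, x)))%:E)%E}.
Proof.
have := @kinetic_limit R L rho mu L0 rho0 mu0 _ _ _ _ _ _ _ _ _ lim_u gs Gl A gs_hull mA A0
  gs_cvg Gl_measurable (fun t => Etot - \int[leb]_(x in D) Phi (u (t, x))).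
rewrite -initial_potential => H.
have K t e : 0 < t -> 0 < e -> exists K, forall k, (K <= k)%N ->
    h k * (\sum_(j < N k) (rho / 2 * b k t j ^+ 2 +
      mu / 2 * bending (N k) (h k) (a k t) j ^+ 2)) <=
    E1 + \int[leb]_(x in D) Phi (u (0, x)) - \int[leb]_(x in D) Phi (u (t, x)) + e.
  by move=> t0; exact: kin (ltW t0).
move: (H K); apply: filterS; first exact: (ae_filter_ringOfSetsType leb).
move=> t Ht t0; apply: le_trans (Ht t0); apply: ge0_subset_integral => //.
  by apply: measurable_EFin_fun; apply: measurable_kinetic_density => i i2;
    apply: Gl_measurable; exact: ltnW.
by move=> x _; rewrite lee_fin kinetic_density_ge0.
Qed.

Let section_potential_ge0 t : 0 <= \int[leb]_(x in D) Phi (u (t, x)).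
Proof. by apply: Rintegral_ge0 => x _; exact: Phi_ge0 hPhi _. Qed.

Let total_energy_ge0 : 0 <= Etot.
Proof.
rewrite /data_energy !addr_ge0//.
- by rewrite mulr_ge0 ?divr_ge0 ?(ltW rho0)//; apply: Rintegral_ge0 => x _; exact: sqr_ge0.
- by rewrite mulr_ge0 ?divr_ge0 ?(ltW mu0)//; apply: Rintegral_ge0 => x _; exact: sqr_ge0.
- by apply: Rintegral_ge0 => x _; exact: Phi_ge0 hPhi _.
Qed.

Lemma limit_Linfty_L2 i (c : R) : (i < 2)%N -> 0 < c ->
  (forall t x, c * unweighted Gl i (t, x) ^+ 2 <= kinetic_density rho mu Gl t x) ->
  Linfty_L2 L (unweighted Gl i).
Proof.
move=> i2 c0 H; have i3 : (i < 3)%N := ltnW i2.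
apply: (@Linfty_L2_bound _ L _ (Etot / c)) => //.
- by rewrite divr_ge0// ltW.
- exact: unweighted_measurable.
move: limit_kinetic; apply: filterS; first exact: (ae_filter_ringOfSetsType leb).
move=> t Ht t0.
have ms : measurable_fun setT (fun x => unweighted Gl i (t, x)).
  exact: (measurableT_comp (unweighted_measurable i3) (pair1_measurable t)).
have ms2 : measurable_fun D (fun x => (unweighted Gl i (t, x) ^+ 2)%:E).
  by apply: measurable_EFin_fun; apply: measurable_funX; exact: measurable_funTS.
have E : (c%:E * \int[leb]_(x in D) (unweighted Gl i (t, x) ^+ 2)%:E <= Etot%:E)%E.
  rewrite -ge0_integralZl_EFin//; last 2 first.
  - by move=> x _; rewrite lee_fin sqr_ge0.
  - exact: ltW.
  apply: (@le_trans _ _ (\int[leb]_(x in D) (kinetic_density rho mu Gl t x)%:E)%E).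
    apply: ge0_le_integral => //.
    - by move=> x _; rewrite -EFinM lee_fin mulr_ge0 ?sqr_ge0// ltW.
    - exact: emeasurable_funM.
    - apply: measurable_EFin_fun; apply: measurable_funTS.
      by apply: measurable_kinetic_density => k k2; apply: Gl_measurable; exact: ltnW.
    - by move=> x _; rewrite -EFinM lee_fin.
  apply: le_trans (Ht t0) _; rewrite lee_fin; have := section_potential_ge0 t; lra.
move: E; case: (\int[leb]_(x in D) _)%E => [r| |].
- by rewrite -EFinM !lee_fin mulrC ler_pdivlMr.
- by rewrite gt0_muley ?lte_fin// leye_eq.
- by rewrite leNye.
Qed.

Lemma limit_energy : {ae leb, forall t, 0 < t ->
  (energy L rho mu Phi (fun x => unweighted Gl 0 (t, x))
    (fun x => unweighted Gl 1 (t, x)) (fun x => u (t, x)) <=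
   energy L rho mu Phi u1 w0 u0)%E}.
Proof.
move: limit_kinetic; apply: filterS; first exact: (ae_filter_ringOfSetsType leb).
move=> t Ht t0; rewrite energy_data.
have mu_t := limit_section_measurable L0 lim_u (ltW t0).
have iP := potential_section_integrable L0 hPhi mu_t.
rewrite /energy (_ : (\int[leb]_(x in D) _)%E = (\int[leb]_(x in D)
    ((kinetic_density rho mu Gl t x)%:E + (Phi (u (t, x)))%:E))%E); last first.
  apply: eq_integral => x _; rewrite -EFinD; congr (_%:E).
  by rewrite /kinetic_density /unweighted /=; field.
rewrite ge0_integralD//.
- rewrite (@eq_ge0_integral_Rintegral _ _ R leb D mD _ iP).
  by rewrite -[leRHS](subeK _ (isT : (\int[leb]_(x in D) Phi (u (t, x)))%:E \is a fin_num))
     leeD2r// -EFinB; exact: Ht.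
- by move=> x _; rewrite lee_fin kinetic_density_ge0.
- apply: measurable_EFin_fun; apply: measurable_funTS.
  by apply: measurable_kinetic_density => k k2; apply: Gl_measurable; exact: ltnW.
- by move=> x _; rewrite lee_fin; exact: Phi_ge0 hPhi _.
- exact: measurable_int iP.
Qed.

End existence.

Theorem theorem3p1 (R : realType) (L rho mu : R) (L_gt0 : 0 < L)
    (rho_gt0 : 0 < rho) (mu_gt0 : 0 < mu)
    (Phi : R -> R) (hPhi : potential Phi)
    (u0 u1 : R -> R) (hu0 : H2 L u0) (hu1 : L2 L u1) :
  exists u : R * R -> R, dissipative_solution L rho mu Phi u0 u1 u.
Proof.
have [_ i0 i02] := L2P L_gt0 hu0.1.
have [_ i1 i12] := L2P L_gt0 hu1.
have [_ [f1 [w0 [_ _ hw0 w0E]]]] := hu0.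
have [_ iw iw2] := L2P L_gt0 hw0.
have [th [th1 [th2 [th3 [C hk]]]]] := kernel_exists R.
have [B [B2 [W2 [N [h [a [b [u [eps [delta [G [lim_u ueq [eps0 epsc deltac GPhi] Hen
  [b_init u_init]]]]]]]]]]]]] := approximations_exist L_gt0 rho_gt0 mu_gt0 hPhi hk
  i0 i02 i1 i12 iw iw2 w0E.
pose y k i := weighted_step L (N k) (h k)
  (state_coef (N k) (h k) (potential_slope Phi (eps k)) (a k) (b k) i).
have sy k i : (i < 3)%N -> sqint (@lebesgue_measure R \x @lebesgue_measure R)%E (y k i).
  by move=> _; have [] := state_sqint L_gt0 lim_u k i.
have yC k : state_nrm2 (@lebesgue_measure R \x @lebesgue_measure R)%E 3 (y k) <=
    \sum_(i < 3) (B2 + W2 + L * B ^+ 2).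
  by apply: ler_sum => i _; have [] := state_sqint L_gt0 lim_u k i.
have [gs [Gl [A [hg mA A0 gcvg HG]]]] := convex_subsequence_cvg sy yC.
have HG' i : (i < 3)%N -> sqint (@lebesgue_measure R \x @lebesgue_measure R)%E (Gl i) /\
    forall m, sqint (@lebesgue_measure R \x @lebesgue_measure R)%E (fun z => gs m i z - Gl i z) /\
    nrm2 (@lebesgue_measure R \x @lebesgue_measure R)%E (fun z => gs m i z - Gl i z) <= 1 / 2 ^+ m.
  by move=> /HG [].
have kin := kinetic_bound L_gt0 lim_u hPhi GPhi deltac Hen.
exists u; split; first exact: unif_equicontinuous_within.
exists (unweighted Gl 0), (unweighted Gl 1), w0; split.
- split; first exact: (limit_velocity L_gt0 lim_u hg HG').
  apply: (limit_Linfty_L2 L_gt0 rho_gt0 mu_gt0 hPhi i0 lim_u u_init kin hg mA A0 gcvg HG'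
    (c := rho / 2)) => // [|t x]; first by rewrite divr_gt0.
  by rewrite /kinetic_density lerDl mulr_ge0 ?sqr_ge0// divr_ge0// ltW.
- split; first exact: (limit_bending L_gt0 lim_u hg HG').
  apply: (limit_Linfty_L2 L_gt0 rho_gt0 mu_gt0 hPhi i0 lim_u u_init kin hg mA A0 gcvg HG'
    (c := mu / 2)) => // [|t x]; first by rewrite divr_gt0.
  by rewrite /kinetic_density lerDr mulr_ge0 ?sqr_ge0// divr_ge0// ltW.
- by [].
- exists (subdiff_selection L Phi u Gl A).
    exact: (limit_in_subdifferential L_gt0 hPhi lim_u ueq eps0 epsc hg mA gcvg HG').
  exact: (limit_weak_equation L_gt0 rho_gt0 mu_gt0 hPhi i0 i1 lim_u ueq b_init u_init hg
    mA A0 HG').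
- exact: (limit_energy L_gt0 rho_gt0 mu_gt0 hPhi i0 i12 iw2 lim_u u_init kin hg mA A0
    gcvg HG').
Qed.
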